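(* Consider the Gaussian covert communication setting with noncausal CSI at the transmitter described in the context, and define $\gamma^*=\min\{1,\frac{P}{2T}\}$, $T^*=(1-\gamma^* )^2T$, $P^*=T-T^*$, and $\alpha=\frac{P^*}{P^*+1}$. If $$R_K>\frac12\log\Big(1+\frac{(P^*+\alpha T^* )^2}{(P^*+\alpha^2T^* )(P^*+T^*+\sigma^2)-(P^*+\alpha T^* )^2}\Big)-\frac12\log\Big(1+\frac{(P^*+\alpha T^* )^2}{(P^*+\alpha^2T^* )(P^*+T^*+1)-(P^*+\alpha T^* )^2}\Big),$$ then the covert capacity with noncausal CSI is $$C_{\mathrm{nc}}=\frac12\log(1+P^* ).$$
   Context: Gaussian channel with state: at each time $i$, the receiver observes $Y_i=X_i+S_i+N_{Y,i}$ and the warden observes $Z_i=X_i+S_i+N_{Z,i}$, where $X_i\in\mathbb{R}$ is the channel input, $S_i\sim\mathcal{N}(0,T)$ with $T>0$, $N_{Y,i}\sim\mathcal{N}(0,1)$, $N_{Z,i}\sim\mathcal{N}(0,\sigma^2)$ with $\sigma^2>0$, and all of $(S_i),(N_{Y,i}),(N_{Z,i})$ are IID over time and mutually independent, and independent of the message and key. The state is known to the transmitter (causally: $X_i$ depends on $(M,K,S^i)$ and possibly private randomness; noncausally: $X^n$ depends on $(M,K,S^n)$ and possibly private randomness), but not to the receiver or the warden. A secret key $K$ uniform on $[1:2^{nR_K}]$ and message $M$ uniform on $[1:2^{nR}]$ are independent; the decoder maps $(Y^n,K)$ to $\hat M$. The input power constraint is $\limsup_n \mathrm{E}[\frac1n\sum_{i=1}^n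 X_i^2]\leq P$ with $P>0$. The no-input symbol is $0$, so with no transmission the warden sees $Z^n\sim Q_0^{\times n}$ with $Q_0=\mathcal{N}(0,T+\sigma^2)$. A rate $R$ is achievable if there exist codes satisfying the power constraint with $P(\hat M\neq M)\to 0$ and $D(\widehat{P}_{Z^n}\|Q_0^{\times n})\to0$, where $\widehat{P}_{Z^n}$ is the warden's output distribution induced by the code; the covert capacities $C_{\mathrm{c}}$ (causal CSI) and $C_{\mathrm{nc}}$ (noncausal CSI) are the suprema of achievable rates. *)

(* Defs.v *)
From HB Require Import structures.
From mathcomp Require Import all_boot all_order all_algebra.
From mathcomp Require Import all_classical all_reals all_analysis.
Set Implicit Arguments. Unset Strict Implicit. Unset Printing Implicit Defensive.
Import Order.TTheory GRing.Theory Num.Theory.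
Local Open Scope classical_set_scope.
Local Open Scope ring_scope.

(* logarithm to base 2 (rates are in bits, message sets have 2^{...} elements) *)
Definition log2 {R : realType} (x : R) : R := ln x / ln 2.

(* size of the index set [1:2^{n r}], El Gamal--Kim convention 2^{ceil(n r)} *)
Definition idx_size {R : realType} (n : nat) (r : R) : nat :=
  (2 ^ `|Num.ceil (n%:R * r)|)%N.

Definition has_law {R : realType} {d : measure_display} {Om : measurableType d}
  (P : probability Om R) (X : Om -> R) (mu : set R -> \bar R) : Prop :=
  measurable_fun setT X /\ forall A, measurable A -> P (X @^-1` A) = mu A.

Definition mutually_independent {R : realType} {d : measure_display}
  {Om : measurableType d} (P : probability Om R) {I : eqType} (X : I -> Om -> R)
  : Prop :=
  forall (s : seq I) (B : I -> set R), uniq s -> (forall j, measurable (B j)) ->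
    P (\bigcap_(j in [set j | j \in s]) (X j @^-1` B j)) =
    (\prod_(j <- s) P (X j @^-1` B j))%E.

(* relative entropy (in bits) of set functions mu, nu on a measurable space,
   defined as the supremum over finite measurable partitions
   (Gelfand--Yaglom--Perez / Dobrushin definition). *)
Definition kl_term {R : realType} (p q : R) : \bar R :=
  if p == 0 then 0%E else if q == 0 then +oo%E else (p * log2 (p / q))%:E.

Definition rel_entropy {R : realType} {d : measure_display} {T : measurableType d}
  (mu nu : set T -> \bar R) : \bar R :=
  ereal_sup [set x | exists (k : nat) (A : 'I_k -> set T),
     [/\ (forall i, measurable (A i)),
         (forall i j, i != j -> A i `&` A j = set0),
         \bigcup_(i in [set: 'I_k]) A i = setT &
         x = (\sum_(i < k) kl_term (fine (mu (A i))) (fine (nu (A i))))%E]].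

Section GaussianStateModel.
Context {R : realType} {d : measure_display} {Om : measurableType d}
  (P : probability Om R).
Variables (T sig2 : R).
Variables (S NY NZ : nat -> Om -> R) (U : Om -> R).

Definition model_family (i : ((nat + nat) + nat) + unit) : Om -> R :=
  match i with
  | inl (inl (inl t)) => S t
  | inl (inl (inr t)) => NY t
  | inl (inr t) => NZ t
  | inr _ => U
  end.

Definition gaussian_state_model : Prop :=
  (forall t, has_law P (S t) (normal_prob 0 (Num.sqrt T))) /\
  (forall t, has_law P (NY t) (normal_prob 0 1)) /\
  (forall t, has_law P (NZ t) (normal_prob 0 (Num.sqrt sig2))) /\
  has_law P U (uniform_prob (@ltr01 R)) /\
  mutually_independent P model_family.

(* a code of blocklength n with NM messages and NK keys, noncausal CSI:
   X^n = enc m k (S^n, U), U the private randomness *)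
Record nc_code (n NM NK : nat) := NcCode {
  enc : 'I_NM -> 'I_NK -> n.-tuple R * R -> n.-tuple R ;
  dec : 'I_NK -> n.-tuple R -> 'I_NM ;
  enc_meas : forall m k, measurable_fun setT (enc m k) ;
  dec_meas : forall k m, measurable [set y | dec k y = m] }.

Definition Sn (n : nat) (w : Om) : n.-tuple R := [tuple S i w | i < n].
Arguments Sn : clear implicits.

Definition Xn n NM NK (c : nc_code n NM NK) m k (w : Om) : n.-tuple R :=
  enc c m k (Sn n w, U w).

Definition Yn n NM NK (c : nc_code n NM NK) m k (w : Om) : n.-tuple R :=
  [tuple tnth (Xn c m k w) i + S i w + NY i w | i < n].

Definition Zn n NM NK (c : nc_code n NM NK) m k (w : Om) : n.-tuple R :=
  [tuple tnth (Xn c m k w) i + S i w + NZ i w | i < n].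

Definition avg_mk NM NK (f : 'I_NM -> 'I_NK -> \bar R) : \bar R :=
  (((NM * NK)%:R)^-1%:E * \sum_(m < NM) \sum_(k < NK) f m k)%E.

Definition err_prob n NM NK (c : nc_code n NM NK) : \bar R :=
  avg_mk (fun m k => P [set w | dec c k (Yn c m k w) != m]).

Definition avg_power n NM NK (c : nc_code n NM NK) : \bar R :=
  avg_mk (fun m k =>
    (\int[P]_w ((n%:R)^-1 * \sum_(i < n) tnth (Xn c m k w) i ^+ 2)%:E)%E).

Definition warden_law n NM NK (c : nc_code n NM NK) : set (n.-tuple R) -> \bar R :=
  fun A => avg_mk (fun m k => P (Zn c m k @^-1` A)).

(* Q_0^{x n}: law of Z^n when nothing is transmitted *)
Definition Q0n (n : nat) : set (n.-tuple R) -> \bar R :=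
  fun A => P ((fun w => [tuple S i w + NZ i w | i < n]) @^-1` A).
Arguments Q0n : clear implicits.

Definition nc_achievable (Ppow RK r : R) : Prop :=
  0 <= r /\
  exists c : forall n, nc_code n (idx_size n r) (idx_size n RK),
    (limn_esup (fun n => avg_power (c n)) <= Ppow%:E)%E /\
    (err_prob (c n) @[n --> \oo] --> 0%E) /\
    (rel_entropy (warden_law (c n)) (Q0n n) @[n --> \oo] --> 0%E).

Definition covert_capacity_nc (Ppow RK : R) : \bar R :=
  ereal_sup [set r%:E | r in nc_achievable Ppow RK].

End GaussianStateModel.

Section RateParams.
Context {R : realType}.
Variables (T sig2 Ppow : R).
Definition gamma_star : R := Num.min 1 (Ppow / (2 * T)).
Definition T_star : R := (1 - gamma_star) ^+ 2 * T.
Definition P_star : R := T - T_star.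
Definition alpha_star : R := P_star / (P_star + 1).
Definition key_threshold : R :=
  let A := P_star + alpha_star * T_star in
  let B := P_star + alpha_star ^+ 2 * T_star in
  2^-1 * log2 (1 + A ^+ 2 / (B * (P_star + T_star + sig2) - A ^+ 2)) -
  2^-1 * log2 (1 + A ^+ 2 / (B * (P_star + T_star + 1) - A ^+ 2)).
End RateParams.

(* Main.v *)
(** Converse. Put g = gamma_star and compare the law of Y^n given S^n with the
    reference law N((1 - g) S^n, (1 + P_star) I), under which the output does not
    depend on the message; a log-likelihood inequality then bounds ln NM by the
    energy of X + g S. This energy equals (1 - g) E X^2 + g E (X + S)^2
    - g (1 - g) T, and covertness controls E (X + S)^2 = E Z^2 - sig2 by the
    variational formula for relative entropy, applied to lam |z|^2.

    Achievability. Codewords u are standard Gaussian vectors indexed by message,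
    key and a covering index l. The encoder picks l with probability proportional
    to the density of the posterior of S given u_l, capped so that the total is at
    most one, and sends X = coef_u u_l - coef_s S; with the remaining small
    probability it sends 0. The law of the code is thus dominated by the ideal
    Gaussian one plus a failure term which the no-input law dominates. Soft
    covering, i.e. E phi (average density) <= N^(-e) E r^(1 + e) / e with
    phi x = x ln x - x + 1, bounds both the failure probability and the divergence
    at the warden, and a threshold decoder is analysed with Chernoff bounds. *)

(* The weight g is a Lagrange multiplier. The input obeys E X^2 <= P and, by covertness, E (X + S)^2
   <= T in the limit. The resulting bound (1 - g) P + g T - g (1 - g) T on the energy of X + g S
   equals P_star + (1 - g) (P - 2 g T), and the minimum with 1 in [gamma_star] makes the last
   product vanish. The matching input is X' - g S with X' independent of S: the warden's ideal
   output then has the null law, and dirty-paper coding removes the residual state (1 - g) S, of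
   variance T_star, at the receiver. The rate of the covering index is taken just below what the
   receiver can resolve besides the message; the key must supply what is then missing to cover the
   warden's output, whence the threshold on R_K. Relative entropy is a supremum over finite
   partitions, so no density of the warden's law is formed: the lower bound is a Fenchel inequality
   on each cell and the upper bound uses only domination of cell masses, which is why the encoder is
   capped and not normalised. Only nonnegative functions are integrated, so Tonelli applies without
   integrability and identities are arranged without subtraction. *)
Require Import Defs.
From HB Require Import structures.
From mathcomp Require Import all_boot all_order all_algebra.
From mathcomp Require Import all_classical all_reals all_analysis.
From mathcomp Require Import measurable_realfun ring lra.
From mathcomp Require finmap.
Set Implicit Arguments. Unset Strict Implicit. Unset Printing Implicit Defensive.
Import Order.TTheory GRing.Theory Num.Theory.
Import numFieldNormedType.Exports.
Local Open Scope classical_set_scope.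
Local Open Scope ring_scope.

(** * Integrals and products of probability measures *)

Section NonnegIntegral.
Local Open Scope ereal_scope.
Context d (T : measurableType d) (R : realType).
Implicit Types (mu : {measure set T -> \bar R}) (f g : T -> \bar R).

Lemma intD mu f g : measurable_fun setT f -> measurable_fun setT g ->
  (forall x, 0 <= f x) -> (forall x, 0 <= g x) ->
  \int[mu]_x (f x + g x) = \int[mu]_x f x + \int[mu]_x g x.
Proof. by move=> mf mg f0 g0; rewrite ge0_integralD. Qed.

Lemma intZ mu f (c : R) : (0 <= c)%R -> measurable_fun setT f ->
  (forall x, 0 <= f x) -> \int[mu]_x (c%:E * f x) = c%:E * \int[mu]_x f x.
Proof. by move=> c0 mf f0; rewrite ge0_integralZl_EFin. Qed.

Lemma intZe mu f (c : \bar R) : 0 <= c -> measurable_fun setT f ->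
  (forall x, 0 <= f x) -> \int[mu]_x (c * f x) = c * \int[mu]_x f x.
Proof. by move=> c0 mf f0; rewrite ge0_integralZl. Qed.

Lemma int_le mu f g : measurable_fun setT f -> measurable_fun setT g ->
  (forall x, 0 <= f x) -> (forall x, f x <= g x) ->
  \int[mu]_x f x <= \int[mu]_x g x.
Proof.
move=> mf mg f0 fg; apply: ge0_le_integral => // x _.
Qed.

Lemma int_sum mu (I : finType) (F : I -> T -> \bar R) :
  (forall i, measurable_fun setT (F i)) -> (forall i x, 0 <= F i x) ->
  \int[mu]_x (\sum_i F i x) = \sum_i \int[mu]_x F i x.
Proof. by move=> mF F0; rewrite ge0_integral_sum. Qed.

Lemma int_prob_cst (P : probability T R) (c : \bar R) : \int[P]_x c = c.
Proof. by rewrite -[LHS]/(\int[P]_x cst c x) integral_cst// [X in (_ * X)%E]probability_setT mule1. Qed.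

End NonnegIntegral.

Section Currying.
Context d1 d2 d3 d4 (T1 : measurableType d1) (T2 : measurableType d2)
  (T3 : measurableType d3) (T4 : measurableType d4).

Lemma measurable_fun2 (f : T1 -> T2 -> T3) (a : T4 -> T1) (b : T4 -> T2) :
  measurable_fun setT (fun p : T1 * T2 => f p.1 p.2) ->
  measurable_fun setT a -> measurable_fun setT b ->
  measurable_fun setT (fun x => f (a x) (b x)).
Proof.
move=> mf ma mb.
exact: (measurableT_comp mf (measurable_fun_pair ma mb)).
Qed.

Lemma measurable_fun3 d5 (T5 : measurableType d5) (f : T1 -> T2 -> T5 -> T3)
    (a : T4 -> T1) (b : T4 -> T2) (c : T4 -> T5) :
  measurable_fun setT (fun p : T1 * T2 * T5 => f p.1.1 p.1.2 p.2) ->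
  measurable_fun setT a -> measurable_fun setT b -> measurable_fun setT c ->
  measurable_fun setT (fun x => f (a x) (b x) (c x)).
Proof.
move=> mf ma mb mc.
exact: (measurableT_comp mf (measurable_fun_pair (measurable_fun_pair ma mb) mc)).
Qed.

End Currying.

Lemma measurable_mktuple d1 d2 (T : measurableType d1) (B : measurableType d2) n
    (F : 'I_n -> T -> B) : (forall i, measurable_fun setT (F i)) ->
  measurable_fun setT (fun x => [tuple F i x | i < n]).
Proof.
move=> mF; apply/measurable_fun_tnthP => i.
rewrite (_ : _ \o _ = F i)//; apply/funext => t /=; by rewrite tnth_mktuple.
Qed.

(** Descent on the shape of the function. The last cases expect joint measurability of a curried
    function as a hypothesis on pairs or nested pairs, so proofs put such facts in the context
    before calling [msolve]. *)
Ltac msolve_step := first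
  [ assumption
  | exact: measurable_id
  | exact: measurable_cst
  | exact: measurable_tnth
  | exact: measurable_fst
  | exact: measurable_snd
  | match goal with
    | |- measurable_fun _ (GRing.add ?c) => apply: (@measurable_funD _ _ _ _ (cst c) id)
    | |- measurable_fun _ (GRing.mul ?c) => apply: (@measurable_funM _ _ _ _ (cst c) id)
    | |- measurable_fun _ (fun x => EFin _) => apply/measurable_EFinP
    | |- measurable_fun _ (fun x => (@?f x + @?g x)%E) => apply: emeasurable_funD
    | |- measurable_fun _ (fun x => (@?f x * @?g x)%E) => apply: emeasurable_funM
    | |- measurable_fun _ (fun x => (@?f x + @?g x)%R) => apply: measurable_funD
    | |- measurable_fun _ (fun x => (@?f x + @?g x)%R) => apply: emeasurable_funD
    | |- measurable_fun _ (fun x => (@?f x * @?g x)%R) => apply: measurable_funM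
    | |- measurable_fun _ (fun x => (- @?f x)%R) => apply: (measurableT_comp (@oppr_measurable _ _))
    | |- measurable_fun _ (fun x => ((@?f x) ^+ _)%R) => apply: measurable_funX
    | |- measurable_fun _ (fun x => expR (@?f x)) => apply: (measurableT_comp (@measurable_expR _))
    | |- measurable_fun _ (fun x => ln (@?f x)) => apply: (measurableT_comp (@measurable_ln _))
    | |- measurable_fun _ (fun x => (@?f x, @?g x)) => apply: measurable_fun_pair
    | |- measurable_fun _ (fun x => fst (@?f x)) => apply: (measurableT_comp measurable_fst)
    | |- measurable_fun _ (fun x => snd (@?f x)) => apply: (measurableT_comp measurable_snd)
    | |- measurable_fun _ (fun x => tnth (@?f x) ?i) => apply: (measurableT_comp (@measurable_tnth _ _ _ i))
    | |- measurable_fun _ (fun x => \sum_(i <- _) (@?f x i)%E) => apply: emeasurable_sum => ?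
    | |- measurable_fun _ (fun x => \sum_(i <- _) _)%R => apply: measurable_sum => ?
    | |- measurable_fun _ (fun x => \prod_(i <- _) _)%R => apply: measurable_prod => ? ?
    | |- measurable_fun _ (fun x => mktuple _) => apply: measurable_mktuple => ?
    | |- measurable_fun _ (fun x => [tuple of _ :: _]) => apply: measurable_cons
    | H : forall i, measurable_fun setT (?h i) |- measurable_fun _ (fun x => ?h ?i (@?f x)) => apply: (measurableT_comp (H i))
    | H : measurable_fun setT ?h |- measurable_fun _ (fun x => ?h (@?f x)) => apply: (measurableT_comp H)
    | H : measurable_fun setT (fun p => ?h p.1 p.2) |- measurable_fun _ (fun x => ?h (@?f x) (@?g x)) => apply: (measurable_fun2 H)
    | H : measurable_fun setT (fun p => ?h p.1.1 p.1.2 p.2) |- measurable_fun _ (fun x => ?h (@?f x) (@?g x) (@?k x)) => apply: (measurable_fun3 H)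
    end ].
Ltac msolve := repeat msolve_step.


Section Tonelli.
Local Open Scope ereal_scope.
Context d1 d2 (T1 : measurableType d1) (T2 : measurableType d2) (R : realType).
Variables (m1 : probability T1 R) (m2 : probability T2 R).
Variable f : T1 -> T2 -> \bar R.
Hypothesis mf : measurable_fun setT (fun p : T1 * T2 => f p.1 p.2).
Hypothesis f0 : forall x y, 0 <= f x y.

Lemma measurable_int1 : measurable_fun setT (fun x => \int[m2]_y f x y).
Proof.
exact: (@measurable_fun_fubini_tonelli_F _ _ _ _ _ m2 (fun p => f p.1 p.2)).
Qed.

Lemma int_swap : \int[m1]_x \int[m2]_y f x y = \int[m2]_y \int[m1]_x f x y.
Proof. exact: (@fubini_tonelli _ _ _ _ _ m1 m2 (fun p => f p.1 p.2)). Qed.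

Lemma int_prod : \int[m1 \x m2]_p f p.1 p.2 = \int[m1]_x \int[m2]_y f x y.
Proof. by rewrite (@fubini_tonelli1 _ _ _ _ _ m1 m2 (fun p => f p.1 p.2)). Qed.

Lemma measurable_app1 x : measurable_fun setT (f x).
Proof. by apply: (measurable_fun2 mf). Qed.
End Tonelli.

(** * Product laws on tuples *)

Section TupleProduct.
Local Open Scope ereal_scope.
Context d (E : measurableType d) (R : realType).

Definition consp n (p : E * n.-tuple E) : n.+1.-tuple E := [tuple of p.1 :: p.2].

Lemma measurable_consp n : measurable_fun setT (@consp n).
Proof. exact: measurable_cons. Qed.

HB.instance Definition _ n := isMeasurableFun.Build _ _ _ _ (@consp n) (@measurable_consp n).

(** Iterated binary products pushed forward along [consp]: integrals unfold by Tonelli and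
    statements on blocks go by induction on [n]. The laws are indexed by [nat] and not by ordinals
    so that passing to the tail is a mere shift of the family. *)
Fixpoint tprod n (mu : nat -> probability E R) : probability (n.-tuple E) R :=
  match n with
  | 0%N => \d_[tuple]
  | n'.+1 => distribution (mu 0%N \x tprod n' (fun i => mu i.+1)) (@consp n')
  end.

Lemma int_tprod0 (mu : nat -> probability E R) (F : 0.-tuple E -> \bar R) :
  measurable_fun setT F -> \int[tprod 0 mu]_t F t = F [tuple].
Proof. by move=> mF; rewrite /= integral_dirac// diracT mul1e. Qed.

Lemma int_tprodS n (mu : nat -> probability E R) (F : n.+1.-tuple E -> \bar R) :
  measurable_fun setT F -> (forall t, 0 <= F t) ->
  \int[tprod n.+1 mu]_t F t =
  \int[mu 0%N]_x \int[tprod n (fun i => mu i.+1)]_t F [tuple of x :: t].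
Proof.
move=> mF F0 /=.
rewrite ge0_integral_pushforward//.
rewrite preimage_setT.
rewrite -(@int_prod _ _ _ _ _ (mu 0%N) (tprod n (fun i => mu i.+1)) (fun x t => F (consp (x, t)))) //.
by apply: (measurableT_comp mF); apply: measurable_cons; msolve.
Qed.

End TupleProduct.

Section TupleProductTheory.
Local Open Scope ereal_scope.
Context d d' (E : measurableType d) (E' : measurableType d') (R : realType).

Lemma tuple_consE n (A B : Type) (psi : nat -> A -> B) x (t : n.-tuple A) :
  [tuple psi i (tnth [tuple of x :: t] i) | i < n.+1] =
  [tuple of psi 0%N x :: [tuple psi i.+1 (tnth t i) | i < n]].
Proof.
apply: eq_from_tnth => i; rewrite tnth_mktuple.
case: (unliftP ord0 i) => [j ->|->]; last by rewrite !tnth0.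
by rewrite !tnthS tnth_mktuple.
Qed.

Lemma tuple0E (A : Type) (s t : 0.-tuple A) : s = t.
Proof. by rewrite (tuple0 s) (tuple0 t). Qed.

(** A one-letter change of variables, weighted by [h] on one side and by [h'] on the other,
    tensorises. Both sides map into a common alphabet [B], so the letters themselves may live in
    different spaces; the block identities for Gaussian vectors are instances. *)
Lemma tprod_change n (mu : nat -> probability E R) (mu' : nat -> probability E' R)
    (d2 : measure_display) (B : measurableType d2)
    (h : nat -> E -> R) (h' : nat -> E' -> R)
    (psi : nat -> E -> B) (psi' : nat -> E' -> B) (g : n.-tuple B -> \bar R) :
  (forall i, measurable_fun setT (h i)) -> (forall i, measurable_fun setT (h' i)) ->
  (forall i x, 0 <= h i x)%R -> (forall i x, 0 <= h' i x)%R ->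
  (forall i, measurable_fun setT (psi i)) -> (forall i, measurable_fun setT (psi' i)) ->
  (forall i (f : B -> \bar R), measurable_fun setT f -> (forall x, 0 <= f x) ->
     \int[mu i]_x ((h i x)%:E * f (psi i x)) = \int[mu' i]_x ((h' i x)%:E * f (psi' i x))) ->
  measurable_fun setT g -> (forall t, 0 <= g t) ->
  \int[tprod n mu]_t ((\prod_(i < n) h i (tnth t i))%:E * g [tuple psi i (tnth t i) | i < n]) =
  \int[tprod n mu']_t ((\prod_(i < n) h' i (tnth t i))%:E * g [tuple psi' i (tnth t i) | i < n]).
Proof.
elim: n mu mu' h h' psi psi' g => [|n IH] mu mu' h h' psi psi' g mh mh' h0 h'0 mpsi mpsi' E1 mg g0.
  have m0 D (F : measurableType D) (f : 0.-tuple F -> \bar R) : measurable_fun setT f.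
    rewrite (_ : f = cst (f [tuple])); first exact: measurable_cst.
    by apply/funext => t; rewrite (tuple0 t).
  rewrite !int_tprod0//; try exact: m0.
  by rewrite !big_ord0; congr (_ * g _); exact: tuple0E.
have prodS D (F : measurableType D) (f : nat -> F -> R) x (t : n.-tuple F) :
   (\prod_(i < n.+1) f i (tnth [tuple of x :: t] i) = f 0%N x * \prod_(i < n) f i.+1 (tnth t i))%R.
  rewrite big_ord_recl tnth0; congr (_ * _)%R; apply: eq_bigr => i _.
  by rewrite tnthS.
rewrite !int_tprodS//.
(* For a fixed head the tail is handled by the induction hypothesis; [G] is what remains, as a
   function of the image of the head, and the one-letter hypothesis applies to it. *)
- pose G x := \int[tprod n (fun i => mu' i.+1)]_t ((\prod_(i < n) h' i.+1 (tnth t i))%:E *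
    g [tuple of x :: [tuple psi' i.+1 (tnth t i) | i < n]]).
  have mG : measurable_fun setT G.
    apply: measurable_int1.
    + by msolve.
    + by move=> x y; rewrite mule_ge0// lee_fin prodr_ge0.
  have G0 x : 0 <= G x.
    by apply: integral_ge0 => t _; rewrite mule_ge0// lee_fin prodr_ge0.
  transitivity (\int[mu 0%N]_x ((h 0%N x)%:E * G (psi 0%N x))).
    apply: eq_integral => x _.
    under eq_integral do rewrite tuple_consE prodS EFinM -muleA.
    rewrite intZ//.
    + congr (_ * _).
      apply: (IH _ _ (fun i => h i.+1) (fun i => h' i.+1) (fun i => psi i.+1) (fun i => psi' i.+1)
       (fun t => g [tuple of psi 0%N x :: t])) => //.
        by move=> i f; apply: (E1 i.+1).
      by msolve.
    + by msolve.
    + by move=> t; rewrite mule_ge0// lee_fin prodr_ge0.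
  rewrite E1//; apply: eq_integral => x _.
  under [RHS]eq_integral do rewrite tuple_consE prodS EFinM -muleA.
  rewrite intZ//.
  + by msolve.
  + by move=> t; rewrite mule_ge0// lee_fin prodr_ge0.
- by msolve.
- by move=> t; rewrite mule_ge0// lee_fin prodr_ge0.
- by msolve.
- by move=> t; rewrite mule_ge0// lee_fin prodr_ge0.
Qed.

Lemma tprod_coord n (mu : nat -> probability E R) (i : 'I_n) (f : E -> \bar R) :
  measurable_fun setT f -> (forall x, 0 <= f x) ->
  \int[tprod n mu]_t f (tnth t i) = \int[mu i]_x f x.
Proof.
move=> mf f0; elim: n mu i => [mu []//|n IH] mu i.
rewrite int_tprodS//; last by apply: (measurableT_comp mf); msolve.
case: (unliftP ord0 i) => [j ->|->].
  under eq_integral => x _.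
    under eq_integral do rewrite tnthS.
    rewrite IH; over.
  rewrite int_prob_cst.
  by [].
apply: eq_integral => x _.
by under eq_integral do rewrite tnth0; rewrite int_prob_cst.
Qed.

(** Random coding uses codewords only singly and in distinct pairs, for which this two-coordinate
    marginal is enough. *)
Lemma tprod_coord2 n (mu : probability E R) (i j : 'I_n) (f : E -> E -> \bar R) :
  i != j -> measurable_fun setT (fun p : E * E => f p.1 p.2) -> (forall x y, 0 <= f x y) ->
  \int[tprod n (fun=> mu)]_t f (tnth t i) (tnth t j) = \int[mu]_x \int[mu]_y f x y.
Proof.
move=> + mf f0; elim: n i j => [[]//|n IH] i j.
have mtn k (a : 'I_k) : measurable_fun setT (fun t : k.-tuple E => tnth t a) by exact: measurable_tnth.
rewrite int_tprodS//; last first.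
  by apply: (measurable_fun2 mf); msolve.
case: (unliftP ord0 i) => [i' ->|->]; case: (unliftP ord0 j) => [j' ->|->].
- move=> /eqP ij; under eq_integral => x _.
    under eq_integral do rewrite !tnthS.
    rewrite IH; last by apply/eqP => ij'; apply: ij; rewrite ij'.
    over.
  by rewrite int_prob_cst.
- move=> _; rewrite [RHS](int_swap mu mu mf f0).
  apply: eq_integral => x _.
  under eq_integral do rewrite tnthS tnth0.
  by rewrite (tprod_coord _ _ (f := f^~ x))//; apply: (measurable_fun2 mf); msolve.
- move=> _; apply: eq_integral => x _.
  under eq_integral do rewrite tnthS tnth0.
  by rewrite (tprod_coord _ _ (f := f x))//; apply: (measurable_fun2 mf); msolve.
- by rewrite eqxx.
Qed.

End TupleProductTheory.

Section TupleLaw.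
Local Open Scope ereal_scope.
Context d dE (Om : measurableType d) (E : measurableType dE) (R : realType).

Definition box n (B : nat -> set E) : set (n.-tuple E) :=
  [set t | forall i : 'I_n, B i (tnth t i)].

Lemma measurable_box n B : (forall i, measurable (B i)) -> measurable (@box n B).
Proof.
move=> mB; rewrite (_ : box _ = \bigcap_(i : 'I_n) ((fun t : n.-tuple E => tnth t i) @^-1` B i)).
  apply: fin_bigcap_measurable => // i _.
  by rewrite -[X in measurable X]setTI; apply: measurable_tnth.
by apply/seteqP; split => [t tB i _ //|t tB i]; exact: tB.
Qed.

Lemma tprod_box n (mu : nat -> probability E R) B : (forall i, measurable (B i)) ->
  tprod n mu (box B) = \prod_(i < n) mu i (B i).
Proof.
elim: n mu B => [|n IH] mu B mB.
  rewrite big_ord0 (_ : box B = setT) ?probability_setT//.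
  by apply/seteqP; split => // t _ [].
rewrite big_ord_recl -[RHS]/(_ * _).
rewrite -(IH (fun i => mu i.+1) (fun i => B i.+1))//.
rewrite -product_measure1E//; last exact: measurable_box.
rewrite /= /distribution /pushforward; congr (_ _).
apply/seteqP; split => [[x t] /= tB|[x t] /= [Bx tB]].
  split; first by have := tB ord0; rewrite tnth0.
  by move=> i; have := tB (lift ord0 i); rewrite tnthS.
move=> i; case: (unliftP ord0 i) => [j ->|->]; last by rewrite tnth0.
by rewrite tnthS; exact: tB.
Qed.

(** Boxes are stable under intersection and generate the product sigma-algebra, so a law is
    determined by its values on them. *)
Lemma tuple_measure_unique n (m1 m2 : probability (n.-tuple E) R) :
  (forall B, (forall i, measurable (B i)) -> m1 (box B) = m2 (box B)) ->
  forall A, measurable A -> m1 A = m2 A.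
Proof.
move=> m12.
pose G := [set A : set (n.-tuple E) | exists2 B, (forall i, measurable (B i)) & A = box B].
apply: (measure_unique G (fun=> setT)).
- rewrite -[LHS]/(g_sigma_preimage (fun i (x : n.-tuple E) => tnth x i)).
  apply/seteqP; split.
    apply: smallest_sub; first exact: smallest_sigma_algebra.
    move=> A; rewrite /= -bigcup_seq => -[i _ [B mB <-]].
    apply: sub_gen_smallest; exists (fun j : nat => if j == i then B else setT).
      by move=> j; case: ifP.
    rewrite setTI; apply/seteqP; split => [t tB j|t tB].
      by case: ifP => // /eqP ji; rewrite (_ : j = i)//; exact: val_inj.
    by have := tB i; rewrite eqxx.
  apply: smallest_sub; first exact: sigma_algebra_measurable.
  by move=> _ [B mB ->]; exact: measurable_box.
- move=> _ _ [B1 mB1 ->] [B2 mB2 ->]; exists (fun i => B1 i `&` B2 i).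
    by move=> i; exact: measurableI.
  by apply/seteqP; split => [t [t1 t2] i|t tB]; [split|split=> i; have [] := tB i].
- by move=> _; exists (fun=> setT) => //; apply/seteqP; split.
- by apply/seteqP; split => // t _; exists 0%N.
- by move=> _ [B mB ->]; exact: m12.
- by move=> _; rewrite [X in X < _]probability_setT ltry.
Qed.

Lemma tuple_law (P : probability Om R) n (X : nat -> Om -> E) (mu : nat -> probability E R) :
  (forall i, measurable_fun setT (X i)) ->
  (forall B : nat -> set E, (forall i, measurable (B i)) ->
    P [set w | forall i : 'I_n, B i (X i w)] = \prod_(i < n) mu i (B i)) ->
  forall F : n.-tuple E -> \bar R, measurable_fun setT F -> (forall t, 0 <= F t) ->
  \int[P]_w F [tuple X i w | i < n] = \int[tprod n mu]_t F t.
Proof.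
move=> mX XB F mF F0.
have mXt : measurable_fun setT (fun w => [tuple X i w | i < n]) by msolve.
pose mf := isMeasurableFun.Build _ _ _ _ _ mXt.
pose Y : {mfun Om >-> n.-tuple E} := HB.pack (fun w => [tuple X i w | i < n]) mf.
transitivity (\int[distribution P Y]_t F t).
  by rewrite ge0_integral_pushforward// preimage_setT.
apply: eq_measure_integral => A mA _; apply: tuple_measure_unique => // B mB.
rewrite tprod_box// -XB// /distribution /pushforward; congr (P _).
apply/seteqP; split => [w wB i|w wB i]; have := wB i; by rewrite tnth_mktuple.
Qed.

Lemma eq_tprod n (mu nu : nat -> probability E R) :
  (forall i, (i < n)%N -> mu i = nu i) -> tprod n mu = tprod n nu.
Proof.
elim: n mu nu => [//|n IH] mu nu mn.
by rewrite /= mn// (IH (fun i => mu i.+1) (fun i => nu i.+1))// => i im; exact: mn.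
Qed.

Lemma int_tprod_cat n m (mu : nat -> probability E R) (F : (n + m).-tuple E -> \bar R) :
  measurable_fun setT F -> (forall t, 0 <= F t) ->
  \int[tprod (n + m) mu]_t F t =
  \int[tprod n mu]_s \int[tprod m (fun i => mu (n + i)%N)]_t F (cat_tuple s t).
Proof.
have mcat k : measurable_fun setT (fun p : k.-tuple E * m.-tuple E => cat_tuple p.1 p.2).
  apply/measurable_fun_tnthP => i.
  case: (split_ordP i) => j ->.
    rewrite (_ : _ \o _ = fun p : k.-tuple E * m.-tuple E => tnth p.1 j).
      by msolve.
    by apply/funext => p /=; rewrite tnth_lshift.
  rewrite (_ : _ \o _ = fun p : k.-tuple E * m.-tuple E => tnth p.2 j).
    by msolve.
  by apply/funext => p /=; rewrite tnth_rshift.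
elim: n mu F => [|n IH] mu F mF F0.
  rewrite int_tprod0; last first.
    apply: (measurable_int1 _ (f := fun s t => F (cat_tuple s t))).
      by apply: (measurableT_comp mF (mcat 0%N)).
    by [].
  by apply: eq_integral => t _; congr (F _); apply: val_inj.
rewrite (@int_tprodS _ _ _ (n + m))// int_tprodS//; last first.
- by move=> t; exact: integral_ge0.
- apply: (measurable_int1 _ (f := fun s t => F (cat_tuple s t))) => //.
  by apply: (measurableT_comp mF (mcat _)).
apply: eq_integral => x _.
have mFx : measurable_fun setT (fun t : (n + m).-tuple E => F [tuple of x :: t]).
  by apply: (measurableT_comp mF); msolve.
refine (etrans (IH (fun i => mu i.+1) _ mFx (fun=> F0 _)) _).
apply: eq_integral => s _; apply: eq_integral => t _; congr (F _).
exact: val_inj.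
Qed.

End TupleLaw.

Section DefaultDisplay.
Context (R : realType).

(* [normal_prob] and [uniform_prob] live on [measurableTypeR R], which carries
   another display than [R] itself. *)
Definition idR (x : measurableTypeR R) : R := x.
Lemma measurable_idR : measurable_fun setT idR.
Proof. by move=> _ A mA; rewrite setTI. Qed.
HB.instance Definition _ := isMeasurableFun.Build _ _ _ _ idR measurable_idR.

Definition gaussP (s : R) : probability R R := distribution (normal_prob 0 s) idR.
Definition uniformP : probability R R := distribution (uniform_prob (@ltr01 R)) idR.

End DefaultDisplay.

(** * Law of the channel model *)

Section ModelLaw.
Local Open Scope ereal_scope.
Context (R : realType) (d : measure_display) (Om : measurableType d)
  (P : probability Om R) (T sig2 : R) (S NY NZ : nat -> Om -> R) (U : Om -> R).
Hypothesis model : gaussian_state_model P T sig2 S NY NZ U.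

(** Independence is assumed for a family over a mixed index type; an enumeration injective below [N]
    turns [N] of its members into one tuple with a product law, so that later computations take
    place on [tprod]. *)
Lemma independent_law (N : nat) (idx : nat -> ((nat + nat) + nat) + unit)
  (mu : nat -> probability R R) :
  {in gtn N &, injective idx} ->
  (forall i, has_law P (model_family S NY NZ U (idx i)) (mu i)) ->
  forall F : N.-tuple R -> \bar R, measurable_fun setT F -> (forall t, 0 <= F t) ->
  \int[P]_w F [tuple model_family S NY NZ U (idx i) w | i < N] = \int[tprod N mu]_t F t.
Proof.
move=> inj law F mF F0.
apply: (@tuple_law _ _ _ _ _ P N (fun i => model_family S NY NZ U (idx i)) mu) => //.
  by move=> i; have [] := law i.
move=> B mB.
have [_ [_ [_ [_ ind]]]] := model.
pose s := [seq idx i | i <- iota 0 N].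
have us : uniq s.
  rewrite map_inj_in_uniq ?iota_uniq// => i j; rewrite !mem_iota !add0n/= => iN jN.
  exact: inj.
have idxE i : (i < N)%N -> index (idx i) s = i.
  move=> iN; rewrite -[in index _ _](_ : nth (inr tt) s i = idx i).
    by rewrite index_uniq// size_map size_iota.
  by rewrite (nth_map 0%N) ?size_iota// nth_iota// add0n.
(* The position of a label in [s] recovers which side of the box constrains it. *)
have := ind s (fun j => B (index j s)) us (fun j => mB _).
rewrite (_ : \bigcap_(j in _) _ = [set w | forall i : 'I_N, B i (model_family S NY NZ U (idx i) w)]).
  move=> ->; rewrite big_map.
  rewrite (_ : iota 0 N = index_iota 0 N); last by rewrite /index_iota subn0.
  rewrite big_mkord; apply: eq_bigr => i _.
  by rewrite idxE//; have [_ ->] := law i.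
apply/seteqP; split => [w wB i|w wB j /=].
  have := wB (idx i); rewrite /= idxE//; apply.
  by apply/mapP; exists (i : nat) => //; rewrite mem_iota add0n/=.
move=> /mapP[i]; rewrite mem_iota add0n/= => iN ->.
by rewrite idxE//; exact: (wB (Ordinal iN)).
Qed.

(** Receiver and warden are analysed separately, so each law involves the state, the private
    randomness and a single noise family, selected by [b]. *)
Lemma model_law (b : bool) n (F : n.-tuple R -> R -> n.-tuple R -> \bar R) :
  measurable_fun setT (fun p : n.-tuple R * R * n.-tuple R => F p.1.1 p.1.2 p.2) ->
  (forall s u z, 0 <= F s u z) ->
  \int[P]_w F (Sn S n w) (U w) [tuple (if b then NY else NZ) i w | i < n] =
  \int[tprod n (fun=> gaussP (Num.sqrt T))]_s \int[uniformP R]_u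
    \int[tprod n (fun=> gaussP (if b then 1 else Num.sqrt sig2)%R)]_z F s u z.
Proof.
move=> mF F0.
have [lS [lNY [lNZ [lU _]]]] := model.
(* Position 0 is the private randomness, positions 1 to [n] are the states, and later ones the
   chosen noise. *)
pose idx i : ((nat + nat) + nat) + unit :=
  if i is i'.+1 then if (i' < n)%N then inl (inl (inl i'))
    else if b then inl (inl (inr (i' - n)%N)) else inl (inr (i' - n)%N) else inr tt.
pose mu i := if i is i'.+1 then if (i' < n)%N then gaussP (Num.sqrt T)
    else if b then gaussP 1 else gaussP (Num.sqrt sig2) else uniformP R.
pose G (t : (n + n).+1.-tuple R) := F [tuple tnth t (lift ord0 (lshift n i)) | i < n]
  (tnth t ord0) [tuple tnth t (lift ord0 (rshift n i)) | i < n].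
have mG : measurable_fun setT G by rewrite /G; msolve.
have inj : {in gtn (n + n).+1 &, injective idx}.
  rewrite /idx => -[|i] [|j]//= iN jN.
  - by case: ifP => // _; case: (b).
  - by case: ifP => // _; case: (b).
  - move: iN jN; rewrite !inE !ltnS => iN jN.
    case: ltnP => i1; case: ltnP => j1; case: (b) => // -[] ij; congr _.+1 => //.
    + by rewrite -(subnK i1) ij subnK.
    + by rewrite -(subnK i1) ij subnK.
have law i : has_law P (model_family S NY NZ U (idx i)) (mu i).
  rewrite /idx /mu; case: i => [|i]; first exact: lU.
  case: ifP => _; first exact: lS.
  by case: (b); [exact: lNY|exact: lNZ].
have H := @independent_law (n + n).+1 idx mu inj law G mG.
transitivity (\int[P]_w G [tuple model_family S NY NZ U (idx i) w | i < (n + n).+1]).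
  apply: eq_integral => w _; rewrite /G; congr F.
  - apply: eq_from_tnth => i; rewrite !tnth_mktuple /idx /= ltn_ord//.
  - by rewrite tnth_mktuple.
  - apply: eq_from_tnth => i; rewrite !tnth_mktuple /idx /=.
    by rewrite add0n ltnNge leq_addr/= addKn; case: (b).
rewrite (H (fun=> F0 _ _ _)) (int_tprodS _ mG (fun=> F0 _ _ _)).
pose nu := tprod n (fun=> gaussP (if b then 1 else Num.sqrt sig2)%R).
(* The enumeration has [U] first, whereas the statement integrates the state outermost. *)
rewrite (int_swap (tprod n (fun=> gaussP (Num.sqrt T))) (uniformP R)
  (f := fun s u => \int[nu]_z F s u z)); last 2 first.
- by apply: (measurable_int1 _ (f := fun p z => F p.1 p.2 z)).
- by move=> s u; exact: integral_ge0.
have mGu u : measurable_fun setT (fun t : (n + n).-tuple R => G [tuple of u :: t]).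
  have mc : measurable_fun setT (fun t : (n + n).-tuple R => [tuple of u :: t]) by msolve.
  exact: (measurableT_comp mG mc).
apply: eq_integral => u _.
rewrite (int_tprod_cat _ (mGu u) (fun=> F0 _ _ _)).
rewrite (_ : tprod n (fun i => mu i.+1) = tprod n (fun=> gaussP (Num.sqrt T))).
  apply: eq_integral => s _.
  rewrite (_ : tprod n (fun i => mu (n + i).+1) = tprod n (fun=> gaussP (if b then 1 else Num.sqrt sig2)%R)).
    apply: eq_integral => z _; rewrite /G; congr F.
    - by apply: eq_from_tnth => i; rewrite tnth_mktuple tnthS tnth_lshift.
    - by apply: eq_from_tnth => i; rewrite tnth_mktuple tnthS tnth_rshift.
  congr (tprod n _); apply/funext => i.
  by rewrite /mu ltnNge leq_addr/=; case: (b).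
by apply: eq_tprod => i im; rewrite /mu im.
Qed.
End ModelLaw.

(** * Gaussian changes of variables *)

Section Density.
Local Open Scope ereal_scope.
Context d (T : measurableType d) (R : realType).
Import HBNNSimple.

(** True by assumption for indicators, hence for simple functions, and in general by monotone
    convergence along [nnsfun_approx]. *)
Lemma int_density (mu nu : {measure set T -> \bar R}) (p : T -> R) (f : T -> \bar R) :
  measurable_fun setT p -> (forall x, 0 <= p x)%R ->
  (forall A, measurable A -> nu A = \int[mu]_(x in A) (p x)%:E) ->
  measurable_fun setT f -> (forall x, 0 <= f x) ->
  \int[nu]_x f x = \int[mu]_x ((p x)%:E * f x).
Proof.
move=> mp p0 nuE mf f0.
pose f_ := nnsfun_approx measurableT mf.
have f_cvg x : (f_ n x)%:E @[n --> \oo] --> f x by exact: cvg_nnsfun_approx.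
have mpf n : measurable_fun setT (fun x => (p x)%:E * (f_ n x)%:E).
  by apply: emeasurable_funM; apply/measurable_EFinP.
transitivity (limn (fun n => \int[nu]_x (f_ n x)%:E)).
  rewrite -monotone_convergence//.
  - by apply: eq_integral => y _; apply/esym/cvg_lim.
  - by move=> n; exact/measurable_EFinP.
  - by move=> n y _; rewrite lee_fin.
  - by move=> y _ m n mn; rewrite lee_fin; exact/lefP/nd_nnsfun_approx.
transitivity (limn (fun n => \int[mu]_x ((p x)%:E * (f_ n x)%:E))); last first.
  rewrite -monotone_convergence//.
  - apply: eq_integral => y _; apply/cvg_lim => //.
    by apply: cvgeZl.
  - by move=> n y _; rewrite mule_ge0// lee_fin.
  - move=> y _ m n mn; apply: lee_wpmul2l; first by rewrite lee_fin.
    by rewrite lee_fin; exact/lefP/nd_nnsfun_approx.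
congr (limn _); apply/funext => n.
under eq_integral do rewrite fimfunE -fsumEFin//.
rewrite ge0_integral_fsum//; last 2 first.
- by move=> y; exact/measurable_EFinP/measurable_funM.
- by move=> y x _; rewrite nnfun_muleindic_ge0.
under [RHS]eq_integral.
  move=> x _; rewrite fimfunE -fsumEFin// ge0_mule_fsumr; last first.
    by move=> r; rewrite EFinM nnfun_muleindic_ge0.
  over.
rewrite [RHS]ge0_integral_fsum//; last 2 first.
- by move=> r; apply: emeasurable_funM; apply/measurable_EFinP => //; exact/measurable_funM.
- by move=> r x _; rewrite EFinM mule_ge0 ?lee_fin// -lee_fin EFinM nnfun_muleindic_ge0.
apply: eq_fsbigr => r _; rewrite integralZl_indic_nnsfun//.
have [r0|r0] := ltP r 0%R.
  rewrite preimage_nnfun0// !integral0_eq ?mule0// => x _.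
    by rewrite indic0 mulr0 mule0.
  by rewrite indic0.
under [RHS]eq_integral do rewrite EFinM muleCA.
rewrite intZ//; last 2 first.
- by apply: emeasurable_funM; apply/measurable_EFinP.
- by move=> x; rewrite mule_ge0 ?lee_fin.
congr (_ * _); rewrite integral_indic// setIT nuE//.
rewrite integral_mkcond; apply: eq_integral => x _.
rewrite patchE indicE; case: ifP => _; by rewrite ?mule1 ?mule0.
Qed.
End Density.

Section Affine.
Context (R : realType).
Local Open Scope ereal_scope.
Notation leb := (@lebesgue_measure R).
Variables (a b : R).
Hypothesis a0 : (0 < a)%R.
Definition affR (x : measurableTypeR R) : measurableTypeR R := (a * x + b)%R.
Lemma measurable_affR : measurable_fun setT affR.
Proof.
have : measurable_fun [set: R] (fun x : R => a * x + b)%R by msolve.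
exact.
Qed.
HB.instance Definition _ := isMeasurableFun.Build _ _ _ _ affR measurable_affR.

Let pf : {measure set (measurableTypeR R) -> \bar R} :=
  measure_function_pushforward__canonical__measure_function_Measure leb measurable_affR.

(** Both measures agree on half-open intervals, which determine Lebesgue measure. *)
Lemma lebesgue_affine (A : set R) : measurable A ->
  leb A = mscale (NngNum (ltW a0)) pf A.
Proof.
apply: lebesgue_measure_unique => _ [[x y] _ <-] /=.
rewrite /mscale/= /pushforward.
rewrite (_ : affR @^-1` _ = `]((x - b) / a)%R, ((y - b) / a)%R]%classic); last first.
  apply/seteqP; split => z /=; rewrite !in_itv/= /affR.
    by move=> /andP[xz zy]; rewrite ltr_pdivrMr// ler_pdivlMr// (mulrC z) ltrBlDr lerBrDr xz zy.
  by rewrite ltr_pdivrMr// ler_pdivlMr// (mulrC z) ltrBlDr lerBrDr.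
rewrite !lebesgue_measure_itv/= !lte_fin ltr_pM2r ?invr_gt0// ltrD2r.
case: ifPn => _; last by rewrite mule0.
by rewrite -!EFinB -EFinM; congr EFin; field; rewrite gt_eqF.
Qed.

Lemma int_affine (f : R -> \bar R) : measurable_fun setT f -> (forall x, 0 <= f x) ->
  \int[leb]_x f x = \int[leb]_x (a%:E * f (a * x + b)%R).
Proof.
move=> mf f0.
have ma : measurable_fun setT (fun x : R => a * x + b)%R by msolve.
have mfa : measurable_fun setT (fun x : R => f (a * x + b)%R) by exact: (measurableT_comp mf ma).
rewrite (@intZ _ (measurableTypeR R) R leb (fun x => f (a * x + b)%R) a (ltW a0) mfa)//.
transitivity (\int[mscale (NngNum (ltW a0)) pf]_x f x).
  by apply: eq_measure_integral => A mA _; exact: lebesgue_affine.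
rewrite ge0_integral_mscale//; congr (_ * _).
by rewrite (ge0_integral_pushforward measurable_affR)// preimage_setT.
Qed.
End Affine.

Section Gaussian.
Context (R : realType).
Local Open Scope ereal_scope.
Notation leb := (@lebesgue_measure R).
Notation gauss := (gaussP (1%R : R)).

Lemma int_gaussP (s : R) (f : R -> \bar R) : measurable_fun setT f -> (forall x, 0 <= f x) ->
  \int[gaussP (s : R)]_x f x = \int[leb]_x ((normal_pdf 0 s x)%:E * f x).
Proof.
move=> mf f0.
rewrite (ge0_integral_pushforward (@measurable_idR R))// preimage_setT.
apply: (int_density (p := normal_pdf 0 s) (mu := leb) (nu := normal_prob 0 s)) => //.
- exact: measurable_normal_pdf.
- by move=> x; exact: normal_pdf_ge0.
Qed.

Lemma measurable_normal_pdfE m s : measurable_fun setT (fun x : R => (normal_pdf m s x)%:E).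
Proof. apply/measurable_EFinP; exact: measurable_normal_pdf. Qed.

Lemma int_normal_scale (s : R) (f : R -> \bar R) : (0 < s)%R ->
  measurable_fun setT f -> (forall x, 0 <= f x) ->
  \int[gaussP (s : R)]_x f x = \int[gauss]_x f (s * x)%R.
Proof.
move=> s0 mf f0.
have mfs : measurable_fun setT (fun x => f (s * x)%R).
  by apply: (measurableT_comp mf); msolve.
rewrite (int_gaussP _ mf f0) (int_gaussP _ mfs (fun=> f0 _)).
have m1 : measurable_fun setT (fun x : R => (normal_pdf 0 s x)%:E * f x).
  by apply: emeasurable_funM => //; exact: measurable_normal_pdfE.
have p1 (x : R) : 0 <= (normal_pdf 0 s x)%:E * f x.
  by rewrite mule_ge0// lee_fin normal_pdf_ge0.
refine (etrans (int_affine 0 s0 m1 p1) _).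
apply: eq_integral => x _; rewrite /= addr0 muleA -EFinM; congr (_%:E * _).
rewrite !normal_pdfE ?gt_eqF ?oner_eq0// /normal_peak /normal_fun.
rewrite mulrA; congr (_ * expR _)%R.
  rewrite -!mulrnAr sqrtrM ?sqr_ge0// sqrtr_sqr gtr0_norm// invfM mulrA divff ?mul1r ?gt_eqF//.
  by rewrite expr1n mul1r.
by rewrite !subr0; field; rewrite gt_eqF.
Qed.

(** The weight is the density of N(b, a^2) with respect to the standard Gaussian, the common
    reference law for the densities that follow. *)
Lemma gauss_shift (a b : R) (f : R -> \bar R) : (0 < a)%R ->
  measurable_fun setT f -> (forall x, 0 <= f x) ->
  \int[gauss]_w f (b + a * w)%R =
  \int[gauss]_y ((expR (y ^+ 2 / 2 - (y - b) ^+ 2 / (2 * a ^+ 2) - ln a))%:E * f y).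
Proof.
move=> a0 mf f0.
have mfs : measurable_fun setT (fun x => f (b + a * x)%R).
  by apply: (measurableT_comp mf); msolve.
have mfe : measurable_fun setT (fun y : R => (expR (y ^+ 2 / 2 - (y - b) ^+ 2 / (2 * a ^+ 2) - ln a))%:E * f y).
  by msolve.
have pfe (y : R) : 0 <= (expR (y ^+ 2 / 2 - (y - b) ^+ 2 / (2 * a ^+ 2) - ln a))%:E * f y.
  by rewrite mule_ge0// lee_fin expR_ge0.
rewrite (int_gaussP _ mfs (fun=> f0 _)) (int_gaussP _ mfe pfe).
have m1 := emeasurable_funM (measurable_normal_pdfE 0 1) mfe.
have p1 (x : R) : 0 <= (normal_pdf 0 1 x)%:E * ((expR (x ^+ 2 / 2 - (x - b) ^+ 2 / (2 * a ^+ 2) - ln a))%:E * f x).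
  by rewrite mule_ge0// lee_fin normal_pdf_ge0.
refine (esym (etrans (int_affine b a0 m1 p1) _)).
apply: eq_integral => x _; rewrite /= !muleA -!EFinM (addrC b); congr (_%:E * _).
rewrite !normal_pdfE ?oner_eq0// /normal_fun mulrCA -!mulrA; congr (_ * _)%R.
have {1}-> : a = expR (ln a) by rewrite lnK// posrE.
rewrite -!expRD; congr expR.
by field; rewrite gt_eqF.
Qed.

(** Completing the square: the integrand is a multiple of the density of N(a^2 be, a^2) with a^2 = 1
    / (1 - 2 al), whose total mass is one by [gauss_shift] applied to the constant 1. *)
Lemma gauss_quad (al be : R) : (al < 1 / 2)%R ->
  \int[gauss]_y (expR (al * y ^+ 2 + be * y))%:E =
  (expR (be ^+ 2 / (2 * (1 - 2 * al)) - ln (1 - 2 * al) / 2))%:E.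
Proof.
move=> al2; have D0 : (0 < 1 - 2 * al)%R by lra.
pose a := Num.sqrt (1 - 2 * al)^-1.
have a0 : (0 < a)%R by rewrite sqrtr_gt0 invr_gt0.
have a2 : (a ^+ 2 = (1 - 2 * al)^-1)%R by rewrite sqr_sqrtr// invr_ge0 ltW.
have lna : (ln a = - ln (1 - 2 * al) / 2)%R.
  have : (ln (a ^+ 2) = - ln (1 - 2 * al))%R by rewrite a2 lnV.
  by rewrite lnXn// -mulr_natr => h; lra.
have := gauss_shift (a ^+ 2 * be) (f := fun=> 1) a0 (measurable_cst _) (fun=> lee01).
rewrite int_prob_cst => h.
transitivity ((expR (be ^+ 2 / (2 * (1 - 2 * al)) - ln (1 - 2 * al) / 2))%:E * 1); last by rewrite mule1.
pose w (y : R) := (expR (y ^+ 2 / 2 - (y - a ^+ 2 * be) ^+ 2 / (2 * a ^+ 2) - ln a))%:E * 1.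
have mw : measurable_fun setT w by rewrite /w; msolve.
have w0 y : 0 <= w y by rewrite /w mule1 lee_fin expR_ge0.
rewrite h -(intZ _ (expR_ge0 _) mw w0) /w.
apply: eq_integral => y _; rewrite mule1 -EFinM -expRD; congr (expR _)%:E.
rewrite lna a2; field; rewrite gt_eqF//.
Qed.


(* Information density of a standard bivariate Gaussian pair with correlation rho. *)
Definition idens (rho x y : R) : R :=
  (- (ln (1 - rho ^+ 2) / 2) -
   (rho ^+ 2 * x ^+ 2 + rho ^+ 2 * y ^+ 2 - 2 * rho * x * y) / (2 * (1 - rho ^+ 2)))%R.

Lemma idensC rho x y : idens rho x y = idens rho y x.
Proof. by rewrite /idens; congr (_ - _ / _)%R; ring. Qed.

Lemma measurable_idens rho : measurable_fun setT (fun p : R * R => idens rho p.1 p.2).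
Proof. by rewrite /idens; msolve. Qed.

(** Given [x], the other component of the pair is rho x plus independent noise;
    [expR (idens rho x y)] is the density of this conditional law against the marginal. *)
Lemma idens_kernel (rho x : R) (f : R -> \bar R) : (rho ^+ 2 < 1)%R ->
  measurable_fun setT f -> (forall x, 0 <= f x) ->
  \int[gauss]_w f (rho * x + Num.sqrt (1 - rho ^+ 2) * w)%R =
  \int[gauss]_y ((expR (idens rho x y))%:E * f y).
Proof.
move=> r1 mf f0; have D0 : (0 < 1 - rho ^+ 2)%R by lra.
have a0 : (0 < Num.sqrt (1 - rho ^+ 2))%R by rewrite sqrtr_gt0.
rewrite (gauss_shift _ a0 mf f0); apply: eq_integral => y _; congr ((expR _)%:E * _).
rewrite sqr_sqrtr ?ltW//.
have -> : ln (Num.sqrt (1 - rho ^+ 2)) = (ln (1 - rho ^+ 2) / 2)%R.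
  have : ln (Num.sqrt (1 - rho ^+ 2) ^+ 2) = ln (1 - rho ^+ 2) by rewrite sqr_sqrtr// ltW.
  by rewrite lnXn// -mulr_natr => h; lra.
by rewrite /idens; field; rewrite gt_eqF.
Qed.

Lemma idens_int1 (rho x : R) : (rho ^+ 2 < 1)%R -> \int[gauss]_y (expR (idens rho x y))%:E = 1.
Proof.
move=> r1; have := idens_kernel x r1 (f := fun=> 1) (measurable_cst _) (fun=> lee01).
by rewrite int_prob_cst => ->; apply: eq_integral => y _; rewrite mule1.
Qed.

Lemma idens_int1r (rho y : R) : (rho ^+ 2 < 1)%R -> \int[gauss]_x (expR (idens rho x y))%:E = 1.
Proof.
move=> r1; rewrite -(idens_int1 y r1); apply: eq_integral => x _.
by rewrite idensC.
Qed.

(** No convolution of densities is computed: A w + B n is C times the second component of a pair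
    with correlation A / C, whose marginal is again standard by [idens_int1r]. *)
Lemma gauss_conv (A B : R) (f : R -> \bar R) : (0 < B)%R ->
  measurable_fun setT f -> (forall x, 0 <= f x) ->
  \int[gauss]_w \int[gauss]_n f (A * w + B * n)%R =
  \int[gauss]_t f (Num.sqrt (A ^+ 2 + B ^+ 2) * t)%R.
Proof.
move=> B0 mf f0.
have C0 : (0 < A ^+ 2 + B ^+ 2)%R by rewrite ltr_wpDl ?sqr_ge0// exprn_gt0.
set C := Num.sqrt _; have sC0 : (0 < C)%R by rewrite sqrtr_gt0.
have C2 : (C ^+ 2 = A ^+ 2 + B ^+ 2)%R by rewrite sqr_sqrtr ?ltW.
pose rho := (A / C)%R.
have r1 : (rho ^+ 2 < 1)%R.
  by rewrite expr_div_n C2 ltr_pdivrMr// mul1r ltrDl exprn_gt0.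
have sr : (Num.sqrt (1 - rho ^+ 2) = B / C)%R.
  rewrite (_ : 1 - rho ^+ 2 = (B / C) ^+ 2)%R; last first.
    by rewrite !expr_div_n C2; field; rewrite gt_eqF.
  by rewrite sqrtr_sqr gtr0_norm// divr_gt0.
have mfC : measurable_fun setT (fun x => f (C * x)%R) by apply: (measurableT_comp mf); msolve.
have mi := measurable_idens rho.
transitivity (\int[gauss]_x \int[gauss]_y ((expR (idens rho x y))%:E * f (C * y)%R)).
  apply: eq_integral => x _; rewrite -(idens_kernel x r1 mfC)//.
  apply: eq_integral => n _; congr (f _); rewrite sr /rho; field; rewrite gt_eqF//.
rewrite (int_swap gauss gauss (f := fun x y => (expR (idens rho x y))%:E * f (C * y)%R)); last 2 first.
- by msolve.
- by move=> x y; rewrite mule_ge0// lee_fin expR_ge0.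
apply: eq_integral => y _.
under eq_integral do rewrite muleC.
rewrite intZe ?idens_int1r ?mule1//; by msolve.
Qed.

(* The coefficients express that (p U + q S + v N) / V has correlation rho'
   with U when (U, S) has correlation rho. *)
Lemma idens_channel (rho rho' p q v V u : R) (f : R -> \bar R) :
  (0 < v)%R -> (0 < V)%R -> (rho ^+ 2 < 1)%R -> (rho' ^+ 2 < 1)%R ->
  (p + q * rho = rho' * V)%R ->
  (q ^+ 2 * (1 - rho ^+ 2) + v ^+ 2 = V ^+ 2 * (1 - rho' ^+ 2))%R ->
  measurable_fun setT f -> (forall x, 0 <= f x) ->
  \int[gauss]_s \int[gauss]_n ((expR (idens rho u s))%:E * f ((p * u + q * s + v * n) / V)%R) =
  \int[gauss]_z ((expR (idens rho' u z))%:E * f z).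
Proof.
move=> v0 V0 r1 r1' E1 E2 mf f0.
have mi := measurable_idens rho.
have mg : measurable_fun setT (fun x : R * R => f ((p * u + q * x.1 + v * x.2) / V)%R).
  by apply: (measurableT_comp mf); msolve.
pose h s := \int[gauss]_n f ((p * u + q * s + v * n) / V)%R.
have mh : measurable_fun setT h.
  by apply: (measurable_int1 _ (f := fun s n => f ((p * u + q * s + v * n) / V)%R)).
have h0 s : 0 <= h s by apply: integral_ge0.
transitivity (\int[gauss]_s ((expR (idens rho u s))%:E * h s)).
  apply: eq_integral => s _; rewrite intZ ?expR_ge0//.
  by apply: (measurableT_comp mf); msolve.
rewrite -(idens_kernel u r1 mh h0).
set D := (1 - rho ^+ 2)%R; have D0 : (0 < D)%R by rewrite /D; lra.
have mfr : measurable_fun setT (fun x : R => f (rho' * u + x)%R).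
  by apply: (measurableT_comp mf); msolve.
transitivity (\int[gauss]_w \int[gauss]_n f (rho' * u + (q * Num.sqrt D / V * w + v / V * n))%R).
  apply: eq_integral => w _; apply: eq_integral => n _; congr (f _).
  have -> : (p = rho' * V - q * rho)%R by lra.
  field; rewrite gt_eqF//.
rewrite (gauss_conv (q * Num.sqrt D / V) (f := fun x => f (rho' * u + x)%R)) ?divr_gt0//.
rewrite -(idens_kernel u r1' mf f0); apply: eq_integral => t _; congr (f (_ + Num.sqrt _ * _)%R).
rewrite !expr_div_n exprMn sqr_sqrtr ?ltW// -mulrDl E2; field; rewrite gt_eqF//.
Qed.

(** The moment of order 1 + e under the product law is the moment generating function at e under the
    correlated law. Integrating [y] leaves a Gaussian quadratic in [x] with coefficient [al'].
    Positive e serves the covering bounds, negative e the Chernoff bound of the decoder. *)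
Lemma idens_mgf (rho e : R) : (rho ^+ 2 < 1)%R -> (`|e| <= 1)%R ->
  \int[gauss]_x \int[gauss]_y (expR ((1 + e) * idens rho x y))%:E =
  (expR (- (e * ln (1 - rho ^+ 2) / 2) - ln (1 - e ^+ 2 * rho ^+ 2) / 2))%:E.
Proof.
move=> r1 e1; set D := (1 - rho ^+ 2)%R; have D0 : (0 < D)%R by rewrite /D; lra.
have r0 := sqr_ge0 rho.
have [e1n e1p] : (-1 <= e)%R /\ (e <= 1)%R by move: e1; rewrite ler_norml => /andP[].
have e2 : (e ^+ 2 <= 1)%R by nra.
have F0 : (0 < 1 + e * rho ^+ 2)%R by nra.
have G0 : (0 < 1 - e ^+ 2 * rho ^+ 2)%R by nra.
pose al := (- (1 + e) * rho ^+ 2 / (2 * D))%R.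
pose be := (fun x => (1 + e) * rho * x / D)%R.
have al2 : (al < 1 / 2)%R.
  by rewrite /al ltr_pdivrMr ?mulr_gt0// /D; nra.
have Eal : (1 - 2 * al = (1 + e * rho ^+ 2) / D)%R.
  by rewrite /al /D; field; move: D0; rewrite /D => D0; rewrite gt_eqF.
pose c := (- ((1 + e) * ln D / 2) - ln ((1 + e * rho ^+ 2) / D) / 2)%R.
pose al' := ((1 + e) * rho ^+ 2 * e / (2 * (1 + e * rho ^+ 2)))%R.
have al'2 : (al' < 1 / 2)%R.
  by rewrite /al' ltr_pdivrMr ?mulr_gt0//; nra.
have Eal' : (1 - 2 * al' = (1 - e ^+ 2 * rho ^+ 2) / (1 + e * rho ^+ 2))%R.
  by rewrite /al'; field; rewrite gt_eqF.
transitivity (\int[gauss]_x ((expR c)%:E * (expR (al' * x ^+ 2 + 0 * x))%:E)).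
  apply: eq_integral => x _.
  transitivity (\int[gauss]_y ((expR (- ((1 + e) * ln D / 2) + al * x ^+ 2))%:E *
    (expR (al * y ^+ 2 + be x * y))%:E)).
    apply: eq_integral => y _; rewrite -EFinM -expRD; congr (expR _)%:E.
    rewrite /idens /al /be -/D; field; rewrite gt_eqF//.
  rewrite intZ ?expR_ge0//; last by msolve.
  rewrite gauss_quad// -!EFinM -!expRD; congr (expR _)%:E.
  rewrite Eal /c /be /al /al'; set L := ln (_ / _).
  have Dn : (1 - rho ^+ 2 != 0)%R by rewrite gt_eqF.
  by rewrite /D; field; rewrite Dn gt_eqF.
rewrite intZ ?expR_ge0//; last by msolve.
rewrite gauss_quad// -EFinM -expRD; congr (expR _)%:E.
rewrite Eal' /c !ln_div ?posrE// expr0n/= mul0r -/D; by field.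
Qed.

End Gaussian.

Section Uniform.
Context (R : realType).

Lemma uniformP_itv (a b : R) : 0 <= a -> a <= b -> b <= 1 -> uniformP R `[a, b[%classic = (b - a)%:E.
Proof.
move=> a0 ab b1.
have -> : uniformP R `[a, b[%classic = (\int[@lebesgue_measure R]_(x in `[a, b[%classic) (uniform_pdf 0 1 x)%:E)%E by [].
under eq_integral => x.
  rewrite inE/= in_itv/= => /andP[ax xb].
  rewrite /uniform_pdf (le_trans a0 ax) (le_trans (ltW xb) b1)/= subr0 invr1.
  over.
rewrite integral_cst//= mul1e lebesgue_measure_itv/= lte_fin.
by case: ltgtP ab => // [-> _]; rewrite subrr.
Qed.

End Uniform.

(** * Logarithms and the variational bound on relative entropy *)

Section LogFacts.
Context (R : realType).
Implicit Types x y : R.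

Lemma expR_ge1 x : 1 + x <= expR x. Proof. exact: expR_ge1Dx. Qed.

Lemma ln_le_sub1 x : 0 < x -> ln x <= x - 1.
Proof. by move=> x0; have := expR_ge1 (ln x); rewrite lnK ?posrE// => h; lra. Qed.

Lemma ln_ge_1subV x : 0 < x -> 1 - x^-1 <= ln x.
Proof.
move=> x0; have := ln_le_sub1 (x := x^-1); rewrite invr_gt0 => /(_ x0).
by rewrite lnV ?posrE// => h; lra.
Qed.

Lemma ln2_gt0 : 0 < ln 2 :> R.
Proof. by apply: ln_gt0; lra. Qed.
End LogFacts.

Section Variational.
Context (R : realType).

(** Fenchel inequality for p ln (p / q): it is 1 + x <= exp x at x = f - c - ln (p / q), multiplied
    by p. The factor ln 2 converts bits to nats. *)
Lemma kl_term_variational (p q f c : R) : 0 <= p -> 0 <= q ->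
  ((p * (f - c) - q * expR (f - c) + p)%:E <= (ln 2)%:E * kl_term p q)%E.
Proof.
move=> p0 q0; rewrite /kl_term; case: eqVneq => [->|pn0].
  by rewrite mule0 mul0r addr0 sub0r lee_fin oppr_le0 mulr_ge0// expR_ge0.
have pp : 0 < p by rewrite lt_def pn0.
case: eqVneq => [->|qn0].
  by rewrite gt0_muley ?lte_fin ?ln2_gt0// leey.
have qp : 0 < q by rewrite lt_def qn0.
rewrite -EFinM lee_fin /log2.
have l2 := ln2_gt0 R.
rewrite (_ : ln 2 * (p * (ln (p / q) / ln 2)) = p * ln (p / q)); last first.
  by field; rewrite gt_eqF.
have := expR_ge1 (f - c - ln (p / q)).
rewrite expRB lnK ?posrE ?divr_gt0// => h.
have : p * (1 + (f - c - ln (p / q))) <= p * (expR (f - c) / (p / q)).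
  by rewrite ler_pM2l.
rewrite (_ : p * (expR (f - c) / (p / q)) = q * expR (f - c)); last first.
  by field; rewrite !gt_eqF.
by move=> h2; lra.
Qed.

(** Donsker-Varadhan inequality for a step function: when the cellwise inequality is summed, the
    unit mass of [mu] cancels against the normalised exponential sum. *)
Lemma rel_entropy_simple d (T : measurableType d) (mu nu : set T -> \bar R)
    (k : nat) (A : 'I_k -> set T) (f : 'I_k -> R) (c D : R) :
  (forall i, measurable (A i)) -> (forall i j, i != j -> A i `&` A j = set0) ->
  \bigcup_(i in [set: 'I_k]) A i = setT ->
  (forall i, 0 <= fine (mu (A i))) -> (forall i, 0 <= fine (nu (A i))) ->
  \sum_i fine (mu (A i)) = 1 ->
  \sum_i fine (nu (A i)) * expR (f i) <= expR c ->
  (rel_entropy mu nu <= D%:E)%E ->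
  \sum_i fine (mu (A i)) * f i <= c + D * ln 2.
Proof.
move=> mA dA cA mu0 nu0 mu1 nuf DD.
have l2 := ln2_gt0 R.
have klD : (\sum_(i < k) kl_term (fine (mu (A i))) (fine (nu (A i))) <= D%:E)%E.
  by apply: le_trans DD; apply: ereal_sup_ubound; exists k, A; split.
suff : ((\sum_i fine (mu (A i)) * f i - c)%:E <= (ln 2)%:E * D%:E)%E.
  by rewrite -EFinM lee_fin; lra.
apply: le_trans (_ : (ln 2)%:E * \sum_(i < k) kl_term (fine (mu (A i))) (fine (nu (A i))) <= _)%E; last first.
  by rewrite lee_wpmul2l// lee_fin ltW.
have -> : ((ln 2)%:E * \sum_(i < k) kl_term (fine (mu (A i))) (fine (nu (A i))) =
   \sum_(i < k) (ln 2)%:E * kl_term (fine (mu (A i))) (fine (nu (A i))))%E.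
  rewrite fin_num_sume_distrr// => i j _ _.
  by rewrite /kl_term; case: ifP => _; [|case: ifP => _]; case: ifP => _ //; case: ifP.
apply: le_trans (lee_sum _ (fun i _ => kl_term_variational (f i) c (mu0 i) (nu0 i))).
rewrite sumEFin lee_fin.
rewrite big_split/= sumrB mu1.
have -> : \sum_i fine (mu (A i)) * (f i - c) = \sum_i fine (mu (A i)) * f i - c.
  by under eq_bigr do rewrite mulrBr; rewrite sumrB -mulr_suml mu1 mul1r.
suff : \sum_i fine (nu (A i)) * expR (f i - c) <= 1 by move=> ?; lra.
under eq_bigr do rewrite expRB mulrA.
by rewrite -mulr_suml ler_pdivrMr ?expR_gt0// mul1r.
Qed.

End Variational.

Section DonskerVaradhan.
Context (R : realType) d d' (Om : measurableType d) (V : measurableType d')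
  (P : probability Om R).
Import HBNNSimple.

Lemma nnsfun_partition (g : {nnsfun V >-> R}) :
  exists (k : nat) (A : 'I_k -> set V) (v : 'I_k -> R),
  [/\ (forall i, measurable (A i)),
      (forall i j, i != j -> A i `&` A j = set0),
      \bigcup_(i in [set: 'I_k]) A i = setT,
      forall i z, A i z -> g z = v i & forall i, 0 <= v i].
Proof.
pose r := finmap.enum_fset (fset_set (range g)).
have ur : uniq r by exact: finmap.fset_uniq.
exists (size r), (fun i => g @^-1` [set nth 0 r i]), (fun i => nth 0 r i); split.
- by move=> i; exact: measurable_funPTI.
- move=> i j ij; apply/seteqP; split => // z [/= ->] /eqP.
  by rewrite nth_uniq// (negbTE (ij : val i != val j)).
- apply/seteqP; split => // z _.
  have zr : g z \in r by rewrite in_fset_set// inE; exists z.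
  have ir : (index (g z) r < size r)%N by rewrite index_mem.
  by exists (Ordinal ir) => //=; rewrite nth_index.
- by [].
- move=> i; have : nth 0 r i \in r by rewrite mem_nth.
  by rewrite in_fset_set// inE => -[z _ <-].
Qed.

(** The outer function [h] lets one decomposition serve for the mean of [g], for its exponential
    moment and for the total mass. *)
Lemma int_partition k (A : 'I_k -> set V) (v : 'I_k -> R) (g : V -> R) (Z : Om -> V) (h : R -> R) :
  (forall i, measurable (A i)) ->
  (forall i j, i != j -> A i `&` A j = set0) ->
  \bigcup_(i in [set: 'I_k]) A i = setT ->
  (forall i z, A i z -> g z = v i) ->
  measurable_fun setT Z -> (forall i, 0 <= h (v i)) ->
  (\int[P]_w (h (g (Z w)))%:E = (\sum_i fine (P (Z @^-1` A i)) * h (v i))%:E)%E.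
Proof.
move=> mA dA cA gv mZ h0.
have mZA i : measurable (Z @^-1` A i) by rewrite -[X in measurable X]setTI; exact: mZ.
transitivity (\int[P]_w (\sum_i (h (v i))%:E * (\1_(Z @^-1` A i) w)%:E))%E.
  apply: eq_integral => w _.
  have [i _ Ai] : (\bigcup_(i in [set: 'I_k]) A i) (Z w) by rewrite cA.
  rewrite (bigD1 i)//= big1 ?adde0.
    by rewrite indicE mem_set// mule1 (gv i).
  move=> j ji; rewrite indicE memNset ?mule0// => Aj.
  have : (A j `&` A i) (Z w) by [].
  by rewrite dA.
have mi i : measurable_fun setT (fun w => (\1_(Z @^-1` A i) w)%:E : \bar R).
  by apply/measurable_EFinP.
rewrite int_sum; last 2 first.
- by move=> i; apply: emeasurable_funM.
- by move=> i w; rewrite mule_ge0// lee_fin h0.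
rewrite -sumEFin; apply: eq_bigr => i _.
rewrite intZ ?h0// integral_indic// setIT EFinM muleC fineK//.
by rewrite fin_num_measure.
Qed.

(** Approximating [f] from below by simple functions keeps the exponential moment bound, and
    monotone convergence passes to the limit. The set [J] will consist of the message and key pairs,
    over which [mu] is a uniform mixture. *)
Lemma rel_entropy_variational (J : finType) (Z : J -> Om -> V) (W : Om -> V)
    (mu nu : set V -> \bar R) (f : V -> R) (c D : R) :
  (0 < #|J|)%N ->
  (forall j, measurable_fun setT (Z j)) -> measurable_fun setT W ->
  (forall A, measurable A -> mu A = ((#|J|%:R^-1)%:E * \sum_j P (Z j @^-1` A))%E) ->
  (forall A, measurable A -> nu A = P (W @^-1` A)) ->
  measurable_fun setT f -> (forall z, 0 <= f z) ->
  (\int[P]_w (expR (f (W w)))%:E <= (expR c)%:E)%E ->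
  (rel_entropy mu nu <= D%:E)%E ->
  (\sum_j \int[P]_w (f (Z j w))%:E <= (#|J|%:R * (c + D * ln 2))%:E)%E.
Proof.
move=> J0 mZ mW muE nuE mf f0 fc DD.
have J0' : 0 < #|J|%:R :> R by rewrite ltr0n.
have mfE : measurable_fun setT (EFin \o f) by exact/measurable_EFinP.
pose g := nnsfun_approx measurableT mfE.
have gcvg z : ((g n z)%:E @[n --> \oo] --> (f z)%:E)%E.
  by apply: cvg_nnsfun_approx => // x _; rewrite lee_fin.
have gnd z : {homo (fun n => g n z) : n m / (n <= m)%N >-> n <= m}.
  by move=> n m nm; exact/lefP/nd_nnsfun_approx.
have gle n z : g n z <= f z.
  have gr : g n z @[n --> \oo] --> f z by have := gcvg z; move/fine_cvg; exact.
  rewrite -(cvg_lim _ gr)//; apply: nondecreasing_cvgn_le; first exact: gnd.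
  exact: (cvgP _ gr).
have mZA j A : measurable A -> measurable (Z j @^-1` A).
  by move=> mA; rewrite -[X in measurable X]setTI; exact: mZ.
have mWA A : measurable A -> measurable (W @^-1` A).
  by move=> mA; rewrite -[X in measurable X]setTI; exact: mW.
have muF A : measurable A -> fine (mu A) = (#|J|%:R^-1 * \sum_j fine (P (Z j @^-1` A))).
  move=> mA; rewrite muE//.
  have -> : (\sum_j P (Z j @^-1` A) = (\sum_j fine (P (Z j @^-1` A)))%:E)%E.
    rewrite -sumEFin; apply: eq_bigr => j _.
    by rewrite fineK// fin_num_measure//; exact: mZA.
  by [].
have step n : (\sum_j \int[P]_w (g n (Z j w))%:E <= (#|J|%:R * (c + D * ln 2))%:E)%E.
  have [k [A [v [mA dA cA gv v0]]]] := nnsfun_partition (g n).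
  have E j : (\int[P]_w (g n (Z j w))%:E = (\sum_i fine (P (Z j @^-1` A i)) * v i)%:E)%E.
    by rewrite (int_partition (h := id) mA dA cA gv).
  under eq_bigr do rewrite E.
  rewrite sumEFin lee_fin.
  have := @rel_entropy_simple R _ V mu nu k A v c D mA dA cA.
  have mu1 : \sum_i fine (mu (A i)) = 1.
    under eq_bigr do rewrite muF//.
    rewrite -mulr_sumr exchange_big/=.
    under eq_bigr => j _.
      have := int_partition (h := fun=> 1) mA dA cA gv (mZ j) (fun=> ler01).
      rewrite int_prob_cst => -[].
      under eq_bigr do rewrite mulr1.
      move=> <-; over.
    by rewrite sumr_const -mulr_natl mulr1 mulVf// gt_eqF.
  have nuf : \sum_i fine (nu (A i)) * expR (v i) <= expR c.
    rewrite -lee_fin; apply: le_trans fc.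
    under eq_bigr do rewrite nuE//.
    rewrite -(int_partition (h := expR) mA dA cA gv mW); last by move=> *; exact: expR_ge0.
    apply: int_le.
    - by apply/measurable_EFinP; apply: (measurableT_comp (@measurable_expR _)); apply: measurableT_comp.
    - by apply/measurable_EFinP; apply: (measurableT_comp (@measurable_expR _)); apply: measurableT_comp.
    - by move=> w; rewrite lee_fin expR_ge0.
    - by move=> w; rewrite lee_fin ler_expR.
  move=> /(_ _ _ mu1 nuf DD) H.
  rewrite exchange_big/= -ler_pdivrMl//.
  apply: le_trans (H _ _); last 2 first.
  - by move=> i; rewrite muF// mulr_ge0 ?invr_ge0 ?ler0n// sumr_ge0// => j _; rewrite fine_ge0.
  - by move=> i; rewrite nuE// fine_ge0.
  rewrite mulr_sumr; apply: ler_sum => i _; rewrite muF//.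
  by rewrite -mulr_suml mulrA.
have mgZ n j : measurable_fun setT (fun w => (g n (Z j w))%:E).
  by apply/measurable_EFinP; apply: measurableT_comp.
have mfZ j : measurable_fun setT (fun w => (f (Z j w))%:E).
  by apply/measurable_EFinP; apply: measurableT_comp.
rewrite -int_sum//; last by move=> j w; rewrite lee_fin.
pose G n w := (\sum_j (g n (Z j w))%:E)%E.
have mG n : measurable_fun setT (G n) by apply: emeasurable_sum.
have cG := @cvg_monotone_convergence _ _ _ P setT measurableT G mG.
have -> : (\int[P]_w \sum_j (f (Z j w))%:E = limn (fun n => \int[P]_w G n w))%E.
  rewrite -monotone_convergence//.
  - apply: eq_integral => w _; apply/esym/cvg_lim => //.
    rewrite /G; apply: cvg_nnesum => j _; last exact: gcvg.
    by near=> n; rewrite lee_fin.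
  - by move=> n w _; rewrite sume_ge0// => j _; rewrite lee_fin.
  - by move=> w _ a b ab; apply: lee_sum => j _; rewrite lee_fin gnd.
apply: lime_le.
  apply/cvg_ex; eexists; apply: cG.
  - by move=> n w _; rewrite sume_ge0// => j _; rewrite lee_fin.
  - by move=> w _ a b ab; apply: lee_sum => j _; rewrite lee_fin gnd.
near=> n; rewrite /G int_sum//; last by move=> j w; rewrite lee_fin.
Unshelve. all: end_near.
Qed.

End DonskerVaradhan.

Section TupleProductMore.
Local Open Scope ereal_scope.
Context (R : realType).

(** Instance of [tprod_change] whose right-hand weights are the one-letter integrals and whose maps
    into the alphabet are constant. *)
Lemma int_tprod_prod d (E : measurableType d) n (mu : nat -> probability E R) (h : nat -> E -> R) :
  (forall i, measurable_fun setT (h i)) -> (forall i x, 0 <= h i x)%R ->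
  (forall i, \int[mu i]_x (h i x)%:E \is a fin_num) ->
  \int[tprod n mu]_t (\prod_(i < n) h i (tnth t i))%:E =
  (\prod_(i < n) fine (\int[mu i]_x (h i x)%:E))%:E.
Proof.
move=> mh h0 fh.
have := @tprod_change _ _ E E R n mu mu _ R h (fun i _ => fine (\int[mu i]_x (h i x)%:E))
  (fun _ _ => 0%R) (fun _ _ => 0%R) (fun=> 1).
rewrite -[X in _ -> X = _]/(\int[tprod n mu]_t (\prod_(i < n) h i (tnth t i))%:E) => H.
transitivity (\int[tprod n mu]_t ((\prod_(i < n) h i (tnth t i))%:E * 1)).
  by apply: eq_integral => t _; rewrite mule1.
rewrite H//; first by rewrite mule1 int_prob_cst.
- by move=> i x; rewrite fine_ge0// integral_ge0// => y _; rewrite lee_fin.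
- move=> i f mf f0; rewrite [RHS]int_prob_cst fineK//.
  under eq_integral do rewrite muleC.
  rewrite intZe ?f0//; [by rewrite muleC|exact/measurable_EFinP|by move=> x; rewrite lee_fin].
Qed.

(** Two independent blocks become one block of pairs, to which [tprod_change] applies. *)
Lemma int_tprod_pair d1 d2 (E1 : measurableType d1) (E2 : measurableType d2) n
    (mu : nat -> probability E1 R) (nu : nat -> probability E2 R)
    (F : n.-tuple E1 -> n.-tuple E2 -> \bar R) :
  measurable_fun setT (fun p : n.-tuple E1 * n.-tuple E2 => F p.1 p.2) ->
  (forall s t, 0 <= F s t) ->
  \int[tprod n mu]_s \int[tprod n nu]_t F s t =
  \int[tprod n (fun i => (mu i \x nu i : probability (E1 * E2)%type R))]_p
    F [tuple (tnth p i).1 | i < n] [tuple (tnth p i).2 | i < n].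
Proof.
elim: n mu nu F => [|n IH] mu nu F mF F0.
  rewrite !int_tprod0//; last 3 first.
  - by apply: (measurable_fun2 mF); msolve.
  - exact: (measurable_app1 mF).
  - by apply: (measurable_int1 _ (f := F)).
  by congr F; exact: tuple0E.
have mFc x y : measurable_fun setT (fun p : n.-tuple E1 * n.-tuple E2 =>
    F [tuple of x :: p.1] [tuple of y :: p.2]).
  by apply: (measurable_fun2 mF); msolve.
have mFy x : measurable_fun setT (fun p : n.-tuple E1 * (E2 * n.-tuple E2) =>
    F [tuple of x :: p.1] [tuple of p.2.1 :: p.2.2]).
  by apply: (measurable_fun2 mF); msolve.
rewrite int_tprodS//; last 2 first.
- by apply: (measurable_int1 _ (f := F)).
- by move=> s; exact: integral_ge0.
rewrite int_tprodS//; last by apply: (measurable_fun2 mF); msolve.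
pose G x y := \int[tprod n (fun i => (mu i.+1 \x nu i.+1 : probability (E1 * E2)%type R))]_p
  F [tuple of x :: [tuple (tnth p i).1 | i < n]] [tuple of y :: [tuple (tnth p i).2 | i < n]].
have mG : measurable_fun setT (fun p : E1 * E2 => G p.1 p.2).
  apply: (measurable_int1 _ (f := fun (q : E1 * E2) p =>
     F [tuple of q.1 :: [tuple (tnth p i).1 | i < n]] [tuple of q.2 :: [tuple (tnth p i).2 | i < n]])) => //.
  by apply: (measurable_fun2 mF); msolve.
transitivity (\int[mu 0%N]_x \int[nu 0%N]_y G x y).
  apply: eq_integral => x _.
  under eq_integral => s _.
    rewrite int_tprodS//; last by apply: (measurable_fun2 mF); msolve.
    over.
  rewrite (int_swap (tprod n (fun i => mu i.+1)) (nu 0%N)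
    (f := fun s y => \int[tprod n (fun i => nu i.+1)]_t F [tuple of x :: s] [tuple of y :: t])).
  + apply: eq_integral => y _.
    by rewrite (IH _ _ (fun s t => F [tuple of x :: s] [tuple of y :: t])).
  + apply: (measurable_int1 _ (f := fun (q : n.-tuple E1 * E2) (t : n.-tuple E2) => F [tuple of x :: q.1] [tuple of q.2 :: t])) => //.
    by apply: (measurable_fun2 mF); msolve.
  + by move=> s y; exact: integral_ge0.
rewrite -(int_prod (mu 0%N) (nu 0%N) mG); last first.
  by move=> x y; exact: integral_ge0.
apply: eq_integral => -[x y] _; apply: eq_integral => p _.
by rewrite -(tuple_consE (fun _ q => q.1) (x, y) p) -(tuple_consE (fun _ q => q.2) (x, y) p).
Qed.

Notation gauss := (gaussP (1%R : R)).
Definition gaussn n : probability (n.-tuple R) R := tprod n (fun=> gauss).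

Lemma int_tprod_gauss n (s : R) (F : n.-tuple R -> \bar R) : (0 < s)%R ->
  measurable_fun setT F -> (forall t, 0 <= F t) ->
  \int[tprod n (fun=> gaussP s)]_t F t = \int[gaussn n]_t F [tuple (s * tnth t i)%R | i < n].
Proof.
move=> s0 mF F0.
have ms : measurable_fun setT (fun x : R => s * x)%R by msolve.
have := @tprod_change _ _ R R R n (fun=> gaussP s) (fun=> gauss) _ R (fun _ _ => 1%R) (fun _ _ => 1%R)
  (fun _ => id) (fun _ x => s * x)%R F.
rewrite !big1_eq => H.
transitivity (\int[tprod n (fun=> gaussP s)]_t (1%:E * F [tuple id (tnth t i) | i < n])).
  by apply: eq_integral => t _; rewrite mul1e; congr F; apply: eq_from_tnth => i; rewrite tnth_mktuple.
transitivity (\int[gaussn n]_t (1%:E * F [tuple (s * tnth t i)%R | i < n])); last first.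
  by apply: eq_integral => t _; rewrite mul1e.
have m1 : nat -> measurable_fun [set: R] (fun=> 1%R : R) by move=> _; exact: measurable_cst.
have E : nat -> forall f : R -> \bar R, measurable_fun [set: R] f -> (forall x : R, 0%R <= f x) ->
     \int[gaussP s]_x (1 * f x) = \int[gauss]_x (1 * f (s * x)%R).
  move=> i f mf f0; under eq_integral do rewrite mul1e.
  by under [RHS]eq_integral do rewrite mul1e; exact: int_normal_scale.
exact: (H m1 m1 (fun _ _ => ler01) (fun _ _ => ler01) (fun=> @measurable_id _ _ _) (fun=> ms) E mF F0).
Qed.

(** Squeezed out of [gauss_quad] by 1 + al t <= exp (al t) for t = (a + x)^2: small positive al
    gives the upper bound, small negative al the lower one. *)
Lemma gauss_sq (a : R) : \int[gauss]_x ((a + x) ^+ 2)%:E = (a ^+ 2 + 1)%:E.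
Proof.
set c := (a ^+ 2 + 1)%R.
have c1 : (1 <= c)%R by rewrite lerDr sqr_ge0.
have msq : measurable_fun setT (fun x : R => ((a + x) ^+ 2)%:E) by msolve.
have quad al : (al < 1 / 2)%R -> \int[gauss]_x (expR (al * (a + x) ^+ 2))%:E =
    (expR (al * a ^+ 2 / (1 - 2 * al) - ln (1 - 2 * al) / 2))%:E.
  move=> al2; have D0 : (0 < 1 - 2 * al)%R by lra.
  transitivity (\int[gauss]_x ((expR (al * a ^+ 2))%:E * (expR (al * x ^+ 2 + (2 * al * a) * x))%:E)).
    by apply: eq_integral => x _; rewrite -EFinM -expRD; congr (expR _)%:E; ring.
  rewrite intZ ?expR_ge0//; last by msolve.
  rewrite gauss_quad// -EFinM -expRD; congr (expR _)%:E; field; rewrite gt_eqF//.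
have up e : (0 < e)%R -> (e < 1)%R -> \int[gauss]_x ((a + x) ^+ 2)%:E <= (c / (1 - e))%:E.
  (* The choice al (2 + c) = e turns the first-order terms 2 al + al c into exactly the e of the
     factor 1 - e. *)
  move=> e0 e1; pose al := (e / (2 + c))%R.
  have al0 : (0 < al)%R by rewrite divr_gt0//; lra.
  have alE : (al * (2 + c) = e)%R by rewrite /al; field; rewrite gt_eqF//; lra.
  have al2 : (al < 1 / 2)%R by nra.
  have mexp : measurable_fun setT (fun x : R => (expR (al * (a + x) ^+ 2))%:E) by msolve.
  have H : (al%:E * \int[gauss]_x ((a + x) ^+ 2)%:E + 1%:E <= (expR (al * a ^+ 2 / (1 - 2 * al) - ln (1 - 2 * al) / 2))%:E).
    rewrite -quad// -intZ ?(ltW al0)//; last by move=> x; rewrite lee_fin sqr_ge0.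
    rewrite -[X in _ + X](int_prob_cst gauss) -intD//; last 2 first.
    - by msolve.
    - by move=> x; rewrite mule_ge0// lee_fin ?sqr_ge0// ltW.
    apply: int_le; [by apply: emeasurable_funD; msolve|exact: mexp| |].
    - by move=> x; rewrite -EFinM -EFinD lee_fin addr_ge0// mulr_ge0 ?sqr_ge0// ltW.
    - by move=> x; rewrite -EFinM -EFinD lee_fin addrC expR_ge1.
  have Jf : \int[gauss]_x ((a + x) ^+ 2)%:E \is a fin_num.
    rewrite ge0_fin_numE; last by apply: integral_ge0 => x _; rewrite lee_fin sqr_ge0.
    rewrite ltey; apply/eqP => J; move: H; rewrite J gt0_muley ?lte_fin// addye//.
  move: H; rewrite -(fineK Jf); set J := fine _; rewrite -EFinM -EFinD !lee_fin => H.
  set G := (_ - _)%R in H.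
  have D0 : (0 < 1 - 2 * al)%R by lra.
  have G1 : (G * (1 - 2 * al) <= al * c)%R.
    have := ln_ge_1subV D0; have : (al * a ^+ 2 / (1 - 2 * al) * (1 - 2 * al) = al * a ^+ 2)%R.
      by rewrite divfK// gt_eqF.
    have : ((1 - 2 * al)^-1 * (1 - 2 * al) = 1)%R by rewrite mulVf// gt_eqF.
    rewrite /G /c; set I := (_^-1)%R; set L := ln _; set Q := (al * a ^+ 2 * I)%R.
    by move=> h1 h2 h3; nra.
  have Gn := expR_ge1 (- G).
  have eG0 := expR_gt0 G.
  have eGN : (expR (- G) * expR G = 1)%R by rewrite -expRD addNr expR0.
  have e1' : (0 < 1 - e)%R by lra.
  rewrite ler_pdivlMr//.
  have h1 : ((1 - G) * expR G <= 1)%R by rewrite -[X in (_ <= X)%R]eGN ler_pM2r.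
  have h2 : ((1 - e) * expR G <= 1 - 2 * al)%R by nra.
  have h3 : (al * (J * (1 - e)) <= al * c)%R by nra.
  by move: h3; rewrite ler_pM2l.
have lo e : (0 < e)%R -> (e < 1)%R -> (c / (1 + e))%:E <= \int[gauss]_x ((a + x) ^+ 2)%:E.
  move=> e0 e1; pose al := (e / (2 + c))%R.
  have al0 : (0 < al)%R by rewrite divr_gt0//; lra.
  have alE : (al * (2 + c) = e)%R by rewrite /al; field; rewrite gt_eqF//; lra.
  have mexp : measurable_fun setT (fun x : R => (expR (- al * (a + x) ^+ 2))%:E) by msolve.
  have Jf : \int[gauss]_x ((a + x) ^+ 2)%:E \is a fin_num.
    rewrite ge0_fin_numE; last by apply: integral_ge0 => x _; rewrite lee_fin sqr_ge0.
    by apply: le_lt_trans (up (1/2)%R _ _) _; [lra|lra|exact: ltry].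
  have H : 1%:E <= al%:E * \int[gauss]_x ((a + x) ^+ 2)%:E + (expR (- al * a ^+ 2 / (1 - 2 * - al) - ln (1 - 2 * - al) / 2))%:E.
    rewrite -quad//; last by lra.
    rewrite -intZ ?(ltW al0)//; last by move=> x; rewrite lee_fin sqr_ge0.
    rewrite -[X in X <= _](int_prob_cst gauss) -intD//; last 2 first.
    - by msolve.
    - by move=> x; rewrite mule_ge0// lee_fin ?sqr_ge0// ltW.
    apply: int_le; [exact: measurable_cst|by apply: emeasurable_funD; msolve|by []|].
    - move=> x; rewrite -EFinM -EFinD lee_fin.
      by have := expR_ge1 (- al * (a + x) ^+ 2); lra.
  move: H; rewrite -(fineK Jf); set J := fine _; rewrite -EFinM -EFinD !lee_fin => H.
  set G := (_ - _)%R in H.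
  have D0 : (0 < 1 - 2 * - al)%R by lra.
  have G1 : (al * c <= - G * (1 + 2 * al))%R.
    have := ln_ge_1subV D0; have : (- al * a ^+ 2 / (1 - 2 * - al) * (1 - 2 * - al) = - al * a ^+ 2)%R.
      by rewrite divfK// gt_eqF.
    have : ((1 - 2 * - al)^-1 * (1 - 2 * - al) = 1)%R by rewrite mulVf// gt_eqF.
    rewrite /G /c; set I := (_^-1)%R; set L := ln _; set Q := (- al * a ^+ 2 * I)%R.
    by move=> h1 h2 h3; nra.
  have Gn := expR_ge1 (- G).
  have eG0 := expR_gt0 G.
  have eGN : (expR (- G) * expR G = 1)%R by rewrite -expRD addNr expR0.
  rewrite ler_pdivrMr; last by lra.
  have h1 : ((1 - G) * expR G <= 1)%R by rewrite -[X in (_ <= X)%R]eGN ler_pM2r.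
  have h2 : ((1 + e) * expR G <= 1 + 2 * al)%R by nra.
  have h3 : (al * c <= al * (J * (1 + e)))%R by nra.
  by move: h3; rewrite ler_pM2l.
have Jf : \int[gauss]_x ((a + x) ^+ 2)%:E \is a fin_num.
  rewrite ge0_fin_numE; last by apply: integral_ge0 => x _; rewrite lee_fin sqr_ge0.
  by apply: le_lt_trans (up (1/2)%R _ _) _; [lra|lra|exact: ltry].
move: up lo; rewrite -(fineK Jf); set J := fine _ => up lo; congr EFin.
apply/eqP; rewrite eq_le; apply/andP; split; apply/ler_addgt0Pr => e e0.
- pose e' := (e / (c + e))%R.
  have e'0 : (0 < e')%R by rewrite divr_gt0//; lra.
  have e'1 : (e' < 1)%R by rewrite ltr_pdivrMr; lra.
  have := up e' e'0 e'1; rewrite lee_fin => /le_trans -> //.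
  rewrite (_ : c / (1 - e') = c + e)%R//; rewrite /e'; field.
  by apply/andP; split; rewrite gt_eqF//; lra.
- pose e' := (Num.min (e / c) (1 / 2))%R.
  have e'0 : (0 < e')%R by rewrite lt_min divr_gt0//; lra.
  have e'1 : (e' < 1)%R by rewrite gt_min; apply/orP; right; lra.
  have := lo e' e'0 e'1; rewrite lee_fin ler_pdivrMr; last by lra.
  have : (e' <= e / c)%R by rewrite ge_min lexx.
  rewrite ler_pdivlMr; last by lra.
  have := up e' e'0 e'1.
  have [cJ|Jc] := leP c J; first by lra.
  by move=> _ h1 h2; nra.
Qed.

End TupleProductMore.

(** * Converse *)

Notation gauss := (gaussP 1).
Local Opaque tprod gaussP uniformP.

Section Mean.
Context (R : realType) d (T : measurableType d) (P : probability T R).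

(** Bundles measurability and nonnegativity with a finite value, so that expectations can be handled
    by linear arithmetic in [R]. Subtraction is replaced by [mean_uniq], which compares two
    decompositions of one nonnegative function. *)
Definition mean (f : T -> R) (a : R) :=
  [/\ measurable_fun setT f, forall w, 0 <= f w & (\int[P]_w (f w)%:E = a%:E)%E].

Lemma mean_cst c : 0 <= c -> mean (fun=> c) c.
Proof. by move=> c0; split => //; rewrite int_prob_cst. Qed.

Lemma meanD f g a b : mean f a -> mean g b -> mean (fun w => f w + g w) (a + b).
Proof.
move=> [mf f0 fa] [mg g0 gb]; split; first exact: measurable_funD.
- by move=> w; rewrite addr_ge0.
under eq_integral do rewrite EFinD.
rewrite intD ?fa ?gb//; by [exact/measurable_EFinP|move=> w; rewrite lee_fin].
Qed.

Lemma meanZ c f a : 0 <= c -> mean f a -> mean (fun w => c * f w) (c * a).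
Proof.
move=> c0 [mf f0 fa]; split; first by apply: measurable_funM.
- by move=> w; rewrite mulr_ge0.
under eq_integral do rewrite EFinM.
rewrite intZ ?fa//; by [exact/measurable_EFinP|move=> w; rewrite lee_fin].
Qed.

Lemma mean_sum (I : finType) (f : I -> T -> R) (a : I -> R) :
  (forall i, mean (f i) (a i)) -> mean (fun w => \sum_i f i w) (\sum_i a i).
Proof.
move=> fa; have mf i : measurable_fun setT (f i) by case: (fa i).
have f0 i w : 0 <= f i w by case: (fa i).
split; first exact: measurable_sum.
- by move=> w; rewrite sumr_ge0.
under eq_integral do rewrite -sumEFin.
rewrite int_sum; last 2 first.
- by move=> i; apply/measurable_EFinP.
- by move=> i w; rewrite lee_fin.
by rewrite -sumEFin; apply: eq_bigr => i _; case: (fa i).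
Qed.

Lemma mean_le f g a b : mean f a -> mean g b -> (forall w, f w <= g w) -> a <= b.
Proof.
move=> [mf f0 fa] [mg g0 gb] fg; rewrite -lee_fin -fa -gb.
by apply: int_le; [exact/measurable_EFinP|exact/measurable_EFinP|
  move=> w; rewrite lee_fin|move=> w; rewrite lee_fin].
Qed.

Lemma mean_ext f g a : (forall w, f w = g w) -> mean f a -> mean g a.
Proof. by move=> fg; rewrite (_ : f = g)//; apply/funext. Qed.

Lemma mean_exists (f : T -> R) (M : R) : measurable_fun setT f -> (forall w, 0 <= f w) ->
  (\int[P]_w (f w)%:E <= M%:E)%E -> exists2 a, mean f a & a <= M.
Proof.
move=> mf f0 fM; have I0 : (0 <= \int[P]_w (f w)%:E)%E.
  by apply: integral_ge0 => w _; rewrite lee_fin.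
have If : (\int[P]_w (f w)%:E)%E \is a fin_num.
  by rewrite ge0_fin_numE//; exact: le_lt_trans fM (ltry M).
exists (fine (\int[P]_w (f w)%:E)%E); first by split; rewrite ?fineK.
by rewrite -lee_fin fineK.
Qed.

Lemma mean_exists_le (f g : T -> R) (b : R) : measurable_fun setT f -> (forall w, 0 <= f w) ->
  mean g b -> (forall w, f w <= g w) -> exists2 a, mean f a & a <= b.
Proof.
move=> mf f0 [mg g0 gb] fg; apply: mean_exists => //; rewrite -gb.
by apply: int_le; [exact/measurable_EFinP|exact/measurable_EFinP|
  move=> w; rewrite lee_fin|move=> w; rewrite lee_fin].
Qed.

Lemma mean_ge0 f a : mean f a -> 0 <= a.
Proof.
by move=> [_ f0 fa]; rewrite -lee_fin -fa; apply: integral_ge0 => w _; rewrite lee_fin.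
Qed.

Lemma mean_uniq f a b : mean f a -> mean f b -> a = b.
Proof. by move=> [_ _ fa] [_ _ fb]; apply: EFin_inj; rewrite -fa -fb. Qed.
End Mean.

Section FinFamily.
Context (R : realType) (J : finType).
Local Open Scope ereal_scope.

Lemma fin_family (p : J -> \bar R) (M : R) : (forall j, 0 <= p j) ->
  \sum_j p j <= M%:E -> exists a : J -> R, (forall j, p j = (a j)%:E) /\ (\sum_j a j <= M)%R.
Proof.
move=> p0 pM; have pf j : p j \is a fin_num.
  rewrite ge0_fin_numE//; apply: le_lt_trans (ltry M); apply: le_trans pM.
  by rewrite (bigD1 j)//= leeDl// sume_ge0.
exists (fun j => fine (p j)); split; first by move=> j; rewrite fineK.
rewrite -lee_fin -sumEFin; apply: le_trans pM.
by apply: lee_sum => j _; rewrite fineK.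
Qed.
End FinFamily.

(** * Second moments and the finite-blocklength converse *)

Section Model.
Local Open Scope ereal_scope.
Context (R : realType) (d : measure_display) (Om : measurableType d)
  (P : probability Om R) (T sig2 : R) (S NY NZ : nat -> Om -> R) (U : Om -> R).
Hypothesis T0 : (0 < T)%R.
Hypothesis sig0 : (0 < sig2)%R.
Hypothesis model : gaussian_state_model P T sig2 S NY NZ U.

Definition noise (b : bool) := if b then NY else NZ.
Definition noise_std (b : bool) : R := if b then 1%R else Num.sqrt sig2.

Lemma noise_std_gt0 b : (0 < noise_std b)%R.
Proof. by case: b; rewrite /noise_std ?ltr01 ?sqrtr_gt0. Qed.

Lemma measurable_S i : measurable_fun setT (S i).
Proof. by have [lS _] := model; have [] := lS i. Qed.
Lemma measurable_U : measurable_fun setT U.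
Proof. by have [_ [_ [_ [[] ]]]] := model. Qed.
Lemma measurable_noise b i : measurable_fun setT (noise b i).
Proof. by have [_ [lY [lZ _]]] := model; case: b; [have [] := lY i|have [] := lZ i]. Qed.

Lemma measurable_Sn n : measurable_fun setT (fun w => Sn S n w).
Proof. by apply: measurable_mktuple => i; exact: measurable_S. Qed.

Lemma model_law_std b n (F : n.-tuple R -> R -> n.-tuple R -> \bar R) :
  measurable_fun setT (fun p : n.-tuple R * R * n.-tuple R => F p.1.1 p.1.2 p.2) ->
  (forall s u z, 0 <= F s u z) ->
  \int[P]_w F (Sn S n w) (U w) [tuple noise b i w | i < n] =
  \int[gaussn R n]_s \int[uniformP R]_u \int[gaussn R n]_z
    F [tuple (Num.sqrt T * tnth s i)%R | i < n] u [tuple (noise_std b * tnth z i)%R | i < n].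
Proof.
move=> mF F0; rewrite (model_law model b mF F0).
pose G s := \int[uniformP R]_u \int[tprod n (fun=> gaussP (noise_std b))]_z F s u z.
have mG : measurable_fun setT G.
  apply: (measurable_int1 _ (f := fun s u => \int[tprod n (fun=> gaussP (noise_std b))]_z F s u z)).
    by apply: (measurable_int1 _ (f := fun p z => F p.1 p.2 z)).
  by move=> s u; exact: integral_ge0.
have G0 s : 0 <= G s by apply: integral_ge0 => u _; exact: integral_ge0.
have sT : (0 < Num.sqrt T)%R by rewrite sqrtr_gt0.
refine (etrans (int_tprod_gauss sT mG G0) _).
apply: eq_integral => s _; apply: eq_integral => u _.
by rewrite (int_tprod_gauss (noise_std_gt0 b) (F := F _ u))//; apply: (measurable_fun3 mF); msolve.
Qed.

(** The cross term vanishes because the noise is centred and independent of state and input; with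
    these fixed, [gauss_sq] gives the moment about the shift. *)
Lemma noise_second_moment b n (a : n.-tuple R -> R -> R) (i : 'I_n) :
  measurable_fun setT (fun p : n.-tuple R * R => a p.1 p.2) ->
  \int[P]_w ((a (Sn S n w) (U w) + noise b i w) ^+ 2)%:E =
  \int[P]_w ((a (Sn S n w) (U w)) ^+ 2)%:E + (noise_std b ^+ 2)%:E.
Proof.
move=> ma; have v0 := noise_std_gt0 b.
transitivity (\int[P]_w ((a (Sn S n w) (U w) + tnth [tuple noise b i w | i < n] i) ^+ 2)%:E).
  by apply: eq_integral => w _; rewrite tnth_mktuple.
have v2 : (0 <= noise_std b ^+ 2)%R by rewrite sqr_ge0.
rewrite (model_law_std b (F := fun s u z => ((a s u + tnth z i) ^+ 2)%:E)); last 2 first.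
- by msolve.
- by move=> s u z; rewrite lee_fin sqr_ge0.
rewrite -[X in _ + X](int_prob_cst P) -intD//; last 2 first.
- by apply/measurable_EFinP; apply: measurable_funX; apply: (measurable_fun2 ma); [exact: measurable_Sn|exact: measurable_U].
- by move=> w; rewrite lee_fin sqr_ge0.
rewrite (model_law_std b (F := fun s u z => ((a s u) ^+ 2)%:E + (noise_std b ^+ 2)%:E)); last 2 first.
- by apply: emeasurable_funD; msolve.
- by move=> s u z; rewrite -EFinD lee_fin addr_ge0// sqr_ge0.
apply: eq_integral => s _; apply: eq_integral => u _.
rewrite int_prob_cst; set A := a _ _.
under eq_integral do rewrite tnth_mktuple.
rewrite (tprod_coord _ i (f := fun x => ((A + noise_std b * x) ^+ 2)%:E)); last 2 first.
- by msolve.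
- by move=> x; rewrite lee_fin sqr_ge0.
transitivity (\int[gaussP (1%R : R)]_x ((noise_std b ^+ 2)%:E * ((A / noise_std b + x) ^+ 2)%:E)).
  by apply: eq_integral => x _; rewrite -EFinM; congr EFin; field; rewrite gt_eqF.
rewrite intZ ?sqr_ge0//; last 2 first.
- by msolve.
- by move=> x; rewrite lee_fin sqr_ge0.
by rewrite gauss_sq -EFinM -EFinD; congr EFin; field; rewrite gt_eqF.
Qed.

Lemma state_second_moment n (i : 'I_n) : \int[P]_w ((S i w) ^+ 2)%:E = T%:E.
Proof.
transitivity (\int[P]_w ((tnth (Sn S n w) i) ^+ 2)%:E).
  by apply: eq_integral => w _; rewrite tnth_mktuple.
rewrite (model_law_std true (F := fun s u z => ((tnth s i) ^+ 2)%:E)); last 2 first.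
- by msolve.
- by move=> s u z; rewrite lee_fin sqr_ge0.
under eq_integral do rewrite !int_prob_cst tnth_mktuple exprMn sqr_sqrtr ?(ltW T0)//.
rewrite (tprod_coord _ i (f := fun x : R => (T * x ^+ 2)%:E)); last 2 first.
- by msolve.
- by move=> x; rewrite lee_fin mulr_ge0 ?sqr_ge0// ltW.
transitivity (\int[gaussP (1%R : R)]_x (T%:E * ((0 + x) ^+ 2)%:E)).
  by apply: eq_integral => x _; rewrite -EFinM add0r.
rewrite intZ ?(ltW T0)//; last 2 first.
- by msolve.
- by move=> x; rewrite lee_fin sqr_ge0.
by rewrite gauss_sq expr0n add0r mule1.
Qed.

(** Without input the letters of Z^n are independent N(0, T + sig2), so this is a product of
    chi-square moment generating functions. *)
Lemma null_output_mgf n (lam : R) : (0 < lam)%R -> (2 * lam * (T + sig2) < 1)%R ->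
  \int[P]_w (expR (\sum_(i < n) lam * (S i w + NZ i w) ^+ 2))%:E =
  (expR (- (n%:R / 2 * ln (1 - 2 * lam * (T + sig2)))))%:E.
Proof.
move=> l0 l1; set V := (T + sig2)%R in l1 *.
have V0 : (0 < V)%R by rewrite addr_gt0.
pose h (x : R * R) := expR (lam * (Num.sqrt T * x.1 + Num.sqrt sig2 * x.2) ^+ 2).
transitivity (\int[P]_w (\prod_(i < n) expR (lam * (tnth (Sn S n w) i + tnth [tuple noise false i w | i < n] i) ^+ 2))%:E).
  apply: eq_integral => w _; rewrite expR_sum; congr EFin; apply: eq_bigr => i _.
  by rewrite !tnth_mktuple.
rewrite (model_law_std false (F := fun s u z => (\prod_(i < n) expR (lam * (tnth s i + tnth z i) ^+ 2))%:E)); last 2 first.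
- by msolve.
- by move=> s u z; rewrite lee_fin prodr_ge0// => i _; exact: expR_ge0.
have mh : measurable_fun setT h by rewrite /h; msolve.
transitivity (\int[gaussn R n]_s \int[gaussn R n]_z (\prod_(i < n) h (tnth s i, tnth z i))%:E).
  apply: eq_integral => s _; rewrite int_prob_cst; apply: eq_integral => z _.
  by congr EFin; apply: eq_bigr => i _; rewrite /h/= !tnth_mktuple.
rewrite /gaussn (int_tprod_pair (fun=> gauss) (fun=> gauss) (F := fun s z => (\prod_(i < n) h (tnth s i, tnth z i))%:E)); last 2 first.
- by msolve.
- by move=> s z; rewrite lee_fin prodr_ge0// => i _; exact: expR_ge0.
have hE : \int[gauss \x gauss]_x (h x)%:E = (expR (- (ln (1 - 2 * lam * V) / 2)))%:E.
  have -> : \int[gauss \x gauss]_x (h x)%:E = \int[gauss \x gauss]_x (h (x.1, x.2))%:E.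
    by apply: eq_integral => -[].
  rewrite (int_prod gauss gauss (f := fun x y => (h (x, y))%:E)); last 2 first.
  - by msolve.
  - by move=> x y; rewrite lee_fin expR_ge0.
  rewrite /h/= (gauss_conv (Num.sqrt T) (f := fun x : R => (expR (lam * x ^+ 2))%:E));
    [|by rewrite sqrtr_gt0|by msolve|by move=> x; rewrite lee_fin expR_ge0].
  rewrite !sqr_sqrtr ?ltW// -/V.
  transitivity (\int[gaussP (1%R : R)]_x (expR ((lam * V) * x ^+ 2 + 0 * x))%:E).
    by apply: eq_integral => x _; rewrite exprMn sqr_sqrtr ?(ltW V0)//; congr (expR _)%:E; ring.
  rewrite gauss_quad; last by lra.
  by rewrite expr0n/= mul0r sub0r mulrA.
transitivity (\int[tprod n (fun=> (gauss \x gauss : probability (R * R)%type R))]_p (\prod_(i < n) h (tnth p i))%:E).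
  apply: eq_integral => p _; congr EFin; apply: eq_bigr => i _.
  by rewrite !tnth_mktuple; case: (tnth p i).
refine (etrans (@int_tprod_prod R _ _ n _ (fun=> h) (fun=> mh) (fun _ x => expR_ge0 _) _) _).
  by move=> _; rewrite hE.
rewrite hE /= prodr_const card_ord -expRM_natl; congr (expR _)%:E.
by ring.
Qed.


Section ConverseBound.
Variables (n NM NK : nat) (c : @nc_code R n NM NK).
Hypotheses (NM0 : (0 < NM)%N) (NK0 : (0 < NK)%N) (n0 : (0 < n)%N).
Variables (g A : R).
Hypotheses (g0 : (0 <= g <= 1)%R) (A1 : (1 <= A)%R).
Let A0 : (0 < A)%R := lt_le_trans ltr01 A1.

Notation J := ('I_NM * 'I_NK)%type.
Notation xc j w i := (tnth (Xn S U c j.1 j.2 w) i).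

Lemma measurable_enc_coord (j : J) (i : 'I_n) :
  measurable_fun setT (fun p : n.-tuple R * R => tnth (enc c j.1 j.2 p) i).
Proof.
have m := enc_meas c j.1 j.2.
exact: (measurableT_comp (@measurable_tnth _ _ _ i) m).
Qed.

Lemma measurable_x (j : J) (i : 'I_n) : measurable_fun setT (fun w => xc j w i).
Proof.
have m : measurable_fun setT (fun w => (Sn S n w, U w)).
  by apply: measurable_fun_pair; [exact: measurable_Sn|exact: measurable_U].
exact: (measurableT_comp (measurable_enc_coord j i) m).
Qed.

(** Likelihood ratio of the reference law N((1 - g) s, A^2) to the true law N(x + s, 1) of one
    output letter, as a function of the noise z, for b = x + g s. *)
Definition ratio (b z : R) := expR (z ^+ 2 / 2 - (z + b) ^+ 2 / (2 * A ^+ 2) - ln A).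

Lemma measurable_ratio : measurable_fun setT (fun p : R * R => ratio p.1 p.2).
Proof. by rewrite /ratio; msolve. Qed.

(* Under the reference law the output no longer depends on the codeword. *)
Lemma change_of_reference (X s : n.-tuple R) (f : n.-tuple R -> \bar R) :
  measurable_fun setT f -> (forall t, 0 <= f t) ->
  \int[gaussn R n]_z ((\prod_(i < n) ratio (tnth X i + g * tnth s i) (tnth z i))%:E *
     f [tuple (tnth X i + tnth s i + tnth z i)%R | i < n]) =
  \int[gaussn R n]_z f [tuple ((1 - g) * tnth s i + A * tnth z i)%R | i < n].
Proof.
move=> mf f0.
(* The weights of [tprod_change] are indexed by [nat]; the default 0 only fills positions beyond the
   block. *)
pose b i := (nth 0 X i + g * nth 0 s i)%R.
have mr i : measurable_fun setT (ratio (b i)).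
  by rewrite /ratio; msolve.
transitivity (\int[gaussn R n]_z ((\prod_(i < n) ratio (b i) (tnth z i))%:E *
     f [tuple (nth 0 X i + nth 0 s i + tnth z i)%R | i < n])).
  apply: eq_integral => z _; congr (_%:E * f _).
    by apply: eq_bigr => i _; rewrite /b !(tnth_nth 0%R).
  by apply: eq_from_tnth => i; rewrite !tnth_mktuple !(tnth_nth 0%R).
transitivity (\int[gaussn R n]_z ((\prod_(i < n) (fun _ _ => 1%R) i (tnth z i))%:E *
     f [tuple ((1 - g) * nth 0 s i + A * tnth z i)%R | i < n])); last first.
  apply: eq_integral => z _; rewrite big1// mul1e; congr (f _).
  by apply: eq_from_tnth => i; rewrite !tnth_mktuple !(tnth_nth 0%R).
apply: (@tprod_change _ _ R R R n (fun=> gaussP 1%R) (fun=> gaussP 1%R) _ R (fun i => ratio (b i))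
  (fun _ _ => 1%R) (fun i z => (nth 0 X i + nth 0 s i + z)%R)
  (fun i z => ((1 - g) * nth 0 s i + A * z)%R)) => //.
- by move=> i z; exact: expR_ge0.
- by move=> i; msolve.
- by move=> i; msolve.
move=> i h mh h0; under [RHS]eq_integral do rewrite mul1e.
have mh' : measurable_fun setT (fun z : R => h (nth 0 X i + nth 0 s i + z)%R).
  by apply: (measurableT_comp mh); msolve.
(* Substituting z = - b + A z' turns x + s + z into (1 - g) s + A z'. *)
have := gauss_shift (- b i) A0 mh' (fun=> h0 _).
under [X in _ = X -> _]eq_integral do rewrite opprK.
move=> <-; apply: eq_integral => z _; congr (h _); rewrite /b; ring.
Qed.

Definition correct (j : J) w : R := (dec c j.2 (Yn S NY U c j.1 j.2 w) == j.1)%:R.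

Lemma measurable_decE k m : measurable_fun setT (fun y => (dec c k y == m)%:R : R).
Proof.
have := dec_meas c k m => mD.
rewrite (_ : (fun _ => _) = \1_[set y | dec c k y = m]); first exact: measurable_indic.
apply/funext => y; rewrite indicE; case: eqP => h; first by rewrite mem_set.
by rewrite memNset.
Qed.

Lemma Yn_E (j : J) w : Yn S NY U c j.1 j.2 w =
  [tuple (tnth (Xn S U c j.1 j.2 w) i + tnth (Sn S n w) i + tnth [tuple noise true i w | i < n] i)%R | i < n].
Proof. by apply: eq_from_tnth => i; rewrite !tnth_mktuple. Qed.

(** Reweighting by the likelihood ratio replaces the output law by the reference law, in which
    neither the message nor the key occurs. *)
Lemma ratio_law (j : J) (f : n.-tuple R -> R) :
  measurable_fun setT f -> (forall t, 0 <= f t)%R ->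
  \int[P]_w ((\prod_(i < n) ratio (xc j w i + g * S i w) (NY i w)) * f (Yn S NY U c j.1 j.2 w))%:E =
  \int[gaussn R n]_s \int[gaussn R n]_z
    (f [tuple ((1 - g) * (Num.sqrt T * tnth s i) + A * tnth z i)%R | i < n])%:E.
Proof.
move=> mf f0.
have mr := measurable_ratio.
pose F s u z := ((\prod_(i < n) ratio (tnth (enc c j.1 j.2 (s, u)) i + g * tnth s i) (tnth z i)) *
   f [tuple tnth (enc c j.1 j.2 (s, u)) i + tnth s i + tnth z i | i < n])%:E.
have me := measurable_enc_coord j.
have mF : measurable_fun setT (fun p : n.-tuple R * R * n.-tuple R => F p.1.1 p.1.2 p.2).
  have me' i : measurable_fun setT (fun p : n.-tuple R * R * n.-tuple R =>
      tnth (enc c j.1 j.2 (p.1.1, p.1.2)) i).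
    by apply: (measurableT_comp (me i)); msolve.
  rewrite /F; apply/measurable_EFinP; apply: measurable_funM.
    apply: measurable_prod => i _; apply: (measurable_fun2 mr); last by msolve.
    by apply: measurable_funD => //; msolve.
  apply: (measurableT_comp mf); apply: measurable_mktuple => i.
  by apply: measurable_funD; [apply: measurable_funD => //; msolve|msolve].
have F0 s u z : 0 <= F s u z.
  by rewrite lee_fin mulr_ge0// prodr_ge0// => i _; exact: expR_ge0.
transitivity (\int[P]_w F (Sn S n w) (U w) [tuple noise true i w | i < n]).
  apply: eq_integral => w _; rewrite Yn_E /F; congr ((_ * f _)%:E).
  by apply: eq_bigr => i _; rewrite !tnth_mktuple.
rewrite (model_law_std true mF F0).
apply: eq_integral => s _.
rewrite -[RHS](int_prob_cst (uniformP R)); apply: eq_integral => u _.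
pose s' := [tuple (Num.sqrt T * tnth s i)%R | i < n].
have mfE : measurable_fun setT (EFin \o f) by exact/measurable_EFinP.
have := change_of_reference (enc c j.1 j.2 (s', u)) s' mfE (fun t => f0 t).
rewrite /F -/s' => H; refine (etrans _ (etrans H _)).
  apply: eq_integral => z _; rewrite EFinM; congr (_%:E * (f _)%:E).
    by apply: eq_bigr => i _; rewrite !tnth_mktuple mul1r.
  by apply: eq_from_tnth => i; rewrite !tnth_mktuple mul1r.
apply: eq_integral => z _ /=; congr (f _)%:E.
by apply: eq_from_tnth => i; rewrite !tnth_mktuple.
Qed.

(** This is 1 + t <= exp t at t = v ln M - ln 2 + L, with L the log-likelihood ratio, together with
    M^v <= 1 + M v for boolean v. Under the reference law a correct guess has probability 1 / M on
    average over messages, so (1 + M v) times the ratio averages to 2; the shift by ln 2 halves it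
    and thus cancels the 1 on the left. *)
Lemma converse_pointwise (b z : 'I_n -> R) (v : bool) (M : R) : (0 < M)%R ->
  (ln M * v%:R + (\sum_i z i ^+ 2) / 2 + 1 <=
   (1 + M * v%:R) * (\prod_i ratio (b i) (z i)) / 2 +
   ln 2 + n%:R * ln A + (\sum_i (b i + z i) ^+ 2) / (2 * A ^+ 2))%R.
Proof.
move=> M0; pose L := (\sum_i (z i ^+ 2 / 2 - (z i + b i) ^+ 2 / (2 * A ^+ 2) - ln A))%R.
have -> : (\prod_i ratio (b i) (z i) = expR L)%R by rewrite /L expR_sum.
have LE : L = ((\sum_i z i ^+ 2) / 2 - (\sum_i (b i + z i) ^+ 2) / (2 * A ^+ 2) - n%:R * ln A)%R.
  rewrite /L !sumrB sumr_const card_ord -(mulr_natl (ln A)) -!mulr_suml.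
  by congr (_ - _ / _ - _)%R; apply: eq_bigr => i _; rewrite addrC.
have h := expR_ge1 (ln M * v%:R - ln 2 + L).
have l2 := ln2_gt0 R.
have e2 : (expR (ln M * v%:R - ln 2 + L) = expR (ln M * v%:R) * expR L / 2)%R.
  rewrite expRD expRB lnK ?posrE; last by lra.
  by rewrite mulrAC.
have hv : (expR (ln M * v%:R) <= 1 + M * v%:R)%R.
  by case: (v); rewrite ?mulr0 ?expR0 ?addr0// mulr1 lnK ?posrE// mulr1 lerDr.
have hL := expR_gt0 L.
have h3 : (expR (ln M * v%:R) * expR L <= (1 + M * v%:R) * expR L)%R by rewrite ler_pM2r.
by rewrite e2 in h; clearbody L; lra.
Qed.

Definition rho_w (j : J) w := (\prod_(i < n) ratio (xc j w i + g * S i w) (NY i w))%R.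

Lemma measurable_Y_coord (j : J) : measurable_fun setT (fun w => Yn S NY U c j.1 j.2 w).
Proof.
have mS := measurable_S; have mN := measurable_noise true; have mx := measurable_x j.
apply: measurable_mktuple => i; apply: measurable_funD; last exact: mN.
by apply: measurable_funD; [exact: mx|exact: mS].
Qed.

Lemma measurable_correct (j : J) : measurable_fun setT (correct j).
Proof. exact: (measurableT_comp (measurable_decE j.2 j.1) (measurable_Y_coord j)). Qed.

Lemma measurable_rho_w (j : J) : measurable_fun setT (rho_w j).
Proof.
have mS := measurable_S; have mN := measurable_noise true; have mx := measurable_x j.
apply: measurable_prod => i _; apply: (measurable_fun2 measurable_ratio); last exact: mN.
by apply: measurable_funD; [exact: mx|apply: measurable_funM => //; exact: measurable_cst].
Qed.

Lemma rho_w_ge0 j w : (0 <= rho_w j w)%R.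
Proof. by rewrite prodr_ge0// => i _; exact: expR_ge0. Qed.

Lemma int_rho_w j : \int[P]_w (rho_w j w)%:E = 1.
Proof.
have := ratio_law j (f := fun=> 1%R) (measurable_cst _) (fun=> ler01).
under eq_integral do rewrite mulr1.
by under [X in _ = X -> _]eq_integral do rewrite int_prob_cst; rewrite int_prob_cst.
Qed.

(** Under the reference law the output does not depend on m; each output decodes to exactly one
    message, so the probabilities of correctness add up to one. *)
Lemma sum_rho_correct (k : 'I_NK) :
  \sum_(m < NM) \int[P]_w (rho_w (m, k) w * correct (m, k) w)%:E = 1.
Proof.
have mD := measurable_decE k.
under eq_bigr => m _.
  rewrite (ratio_law (m, k) (f := fun y => (dec c k y == m)%:R%R)); last 2 first.
  - exact: mD.
  - by move=> y; rewrite ler0n.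
  over.
pose W (s z : n.-tuple R) := [tuple ((1 - g) * (Num.sqrt T * tnth s i) + A * tnth z i)%R | i < n].
have mW m : measurable_fun setT (fun p : n.-tuple R * n.-tuple R => ((dec c k (W p.1 p.2) == m)%:R)%:E : \bar R).
  apply/measurable_EFinP; apply: (measurableT_comp (mD m)).
  by rewrite /W; msolve.
rewrite -int_sum; last 2 first.
- move=> m; apply: (measurable_int1 _ (f := fun s z => ((dec c k (W s z) == m)%:R)%:E)) => //.
- by move=> m s; apply: integral_ge0 => z _; rewrite lee_fin ler0n.
transitivity (\int[gaussn R n]_s (1 : \bar R)); last by rewrite int_prob_cst.
apply: eq_integral => s _.
rewrite -int_sum; last 2 first.
- by move=> m; exact: (measurable_app1 (f := fun s z => ((dec c k (W s z) == m)%:R)%:E) (mW m) s).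
- by move=> m z; rewrite lee_fin ler0n.
rewrite -[RHS](int_prob_cst (gaussn R n)); apply: eq_integral => z _.
rewrite sumEFin (bigD1 (dec c k (W s z)))//= eqxx big1 ?addr0// => m mn.
by rewrite eq_sym (negbTE mn).
Qed.

Lemma mean_sq_noise b (j : J) (a : n.-tuple R -> R -> 'I_n -> R) (e : R) :
  (forall i, measurable_fun setT (fun p : n.-tuple R * R => a p.1 p.2 i)) ->
  mean P (fun w => \sum_i (a (Sn S n w) (U w) i) ^+ 2)%R e ->
  mean P (fun w => \sum_i (a (Sn S n w) (U w) i + noise b i w) ^+ 2)%R (e + n%:R * noise_std b ^+ 2).
Proof.
move=> ma [m1 p1 i1].
have maw i : measurable_fun setT (fun w => a (Sn S n w) (U w) i).
  have mS := @measurable_Sn n; have mU := measurable_U.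
  exact: (measurableT_comp (ma i) (measurable_fun_pair mS mU)).
have mN := measurable_noise b.
have mD i : measurable_fun setT (fun w => (a (Sn S n w) (U w) i + noise b i w) ^+ 2)%R.
  by apply: measurable_funX; exact: measurable_funD.
split.
- exact: measurable_sum.
- by move=> w; rewrite sumr_ge0// => i _; exact: sqr_ge0.
under eq_integral do rewrite -sumEFin.
rewrite int_sum; last 2 first.
- by move=> i; apply/measurable_EFinP; exact: mD.
- by move=> i w; rewrite lee_fin sqr_ge0.
under eq_bigr do rewrite (noise_second_moment b (a := fun s u => a s u _))//.
rewrite big_split/= -int_sum; last 2 first.
- by move=> i; apply/measurable_EFinP; exact: measurable_funX.
- by move=> i w; rewrite lee_fin sqr_ge0.
under eq_integral do rewrite sumEFin.
by rewrite i1 sumEFin sumr_const card_ord -EFinD -(mulr_natl (_ ^+ 2)).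
Qed.

Lemma measurable_gcoord r t (j : J) i : measurable_fun setT (fun p : n.-tuple R * R =>
  r * tnth (enc c j.1 j.2 p) i + t * tnth p.1 i)%R.
Proof.
apply: measurable_funD; last by msolve.
by apply: measurable_funM => //; exact: measurable_enc_coord.
Qed.

Lemma converse_single (j : J) (c1 q pb : R) :
  mean P (correct j) c1 -> mean P (fun w => rho_w j w * correct j w)%R q ->
  mean P (fun w => \sum_(i < n) (xc j w i + g * S i w) ^+ 2)%R pb ->
  (ln NM%:R * c1 + n%:R / 2 + 1 <=
   (1 + NM%:R * q) / 2 + ln 2 + n%:R * ln A + (pb + n%:R) / (2 * A ^+ 2))%R.
Proof.
move=> hc hq hb.
have M0 : (0 < NM%:R :> R)%R by rewrite ltr0n.
have lM : (0 <= ln NM%:R :> R)%R by rewrite ln_ge0// ler1n.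
have lA : (0 <= ln A)%R by rewrite ln_ge0.
have hr : mean P (rho_w j) 1.
  by split; [exact: measurable_rho_w|exact: rho_w_ge0|exact: int_rho_w].
have hN : mean P (fun w => \sum_(i < n) (NY i w) ^+ 2)%R n%:R.
  have := @mean_sq_noise true j (fun _ _ _ => 0%R) 0 (fun _ => measurable_cst _).
  rewrite /noise /noise_std expr1n mulr1 add0r => H.
  apply: mean_ext (H _); first by move=> w; apply: eq_bigr => i _; rewrite add0r.
  by apply: mean_ext (mean_cst P (lexx 0%R)) => w; rewrite big1// => i _; rewrite expr0n.
have hy : mean P (fun w => \sum_(i < n) (xc j w i + g * S i w + NY i w) ^+ 2)%R (pb + n%:R).
  have := @mean_sq_noise true j (fun s u i => 1 * tnth (enc c j.1 j.2 (s, u)) i + g * tnth s i)%R pb.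
  rewrite /noise /noise_std expr1n mulr1 => H.
  apply: mean_ext (H _ _).
  - by move=> w; apply: eq_bigr => i _; rewrite mul1r /Sn tnth_mktuple.
  - move=> i; apply: eq_measurable_fun (measurable_gcoord 1 g j i) => -[]//.
  - by apply: mean_ext hb => w; apply: eq_bigr => i _; rewrite mul1r /Sn tnth_mktuple.
have A2 : (0 <= (2 * A ^+ 2)^-1)%R by rewrite invr_ge0 mulr_ge0// sqr_ge0.
have h2 : (0 <= 2^-1 :> R)%R by rewrite invr_ge0.
have HL := meanD (meanD (meanZ lM hc) (meanZ h2 hN)) (mean_cst P ler01).
have HR := meanD (meanD (meanD (meanZ h2 (meanD hr (meanZ (ltW M0) hq)))
  (mean_cst P (ltW (ln2_gt0 R)))) (mean_cst P (mulr_ge0 (ler0n R n) lA))) (meanZ A2 hy).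
have := mean_le HL HR.
rewrite -!(mulrC (2^-1)%R) -!(mulrC (2 * A ^+ 2)^-1)%R; apply => w.
have := converse_pointwise (fun i => xc j w i + g * S i w)%R (fun i => NY i w)
  (dec c j.2 (Yn S NY U c j.1 j.2 w) == j.1) M0.
rewrite -/(correct j w) -/(rho_w j w).
by rewrite -!(mulrC (2^-1)%R) -!(mulrC (2 * A ^+ 2)^-1)%R mulrDl mul1r -mulrA (mulrC (correct j w)).
Qed.

Lemma avg_mkE (f : 'I_NM -> 'I_NK -> \bar R) :
  avg_mk f = ((NM * NK)%:R^-1)%:E * \sum_(j : J) f j.1 j.2.
Proof. by rewrite /avg_mk pair_bigA. Qed.

Lemma avg_mk_le (f : 'I_NM -> 'I_NK -> \bar R) (a : R) :
  avg_mk f <= a%:E -> \sum_(j : J) f j.1 j.2 <= ((NM * NK)%:R * a)%:E.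
Proof.
have K0 : (0 < (NM * NK)%:R :> R)%R by rewrite ltr0n muln_gt0 NM0.
rewrite avg_mkE => h.
have : (NM * NK)%:R%:E * (((NM * NK)%:R^-1)%:E * \sum_(j : J) f j.1 j.2) <= (NM * NK)%:R%:E * a%:E.
  by apply: lee_wpmul2l => //; rewrite lee_fin ltW.
by rewrite muleA -!EFinM divff ?mul1e// gt_eqF.
Qed.

Lemma mean_state_energy : mean P (fun w => \sum_(i < n) S i w ^+ 2)%R (n%:R * T).
Proof.
have mS := measurable_S.
have h (i : 'I_n) : mean P (fun w => S i w ^+ 2)%R T.
  by split; [exact: measurable_funX|move=> w; exact: sqr_ge0|exact: state_second_moment].
by have := mean_sum h; rewrite sumr_const card_ord mulr_natl.
Qed.

(** Average of [converse_single] over all message and key pairs; [lam] is the free parameter of the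
    exponential moment that bounds the warden's energy. *)
Lemma converse_finite (p D e lam : R) :
  avg_power P S U c <= p%:E ->
  rel_entropy (warden_law P S NZ U c) (Q0n (n:=n) P S NZ) <= D%:E ->
  err_prob P S NY U c <= e%:E ->
  (0 < lam)%R -> (2 * lam * (T + sig2) < 1)%R ->
  (ln NM%:R * (1 - e) + n%:R / 2 <= ln 2 + n%:R * ln A +
    ((1 - g) * (n%:R * p) +
     g * ((- (n%:R / 2 * ln (1 - 2 * lam * (T + sig2))) + D * ln 2) / lam - n%:R * sig2) -
     g * (1 - g) * (n%:R * T) + n%:R) / (2 * A ^+ 2))%R.
Proof.
move=> hp hD he l0 l1.
have [g00 g01] : (0 <= g)%R /\ (0 <= 1 - g)%R by move/andP: g0 => [? ?]; lra.
set K : R := (NM * NK)%:R.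
have K0 : (0 < K)%R by rewrite ltr0n muln_gt0 NM0.
have nn0 : (0 < n%:R :> R)%R by rewrite ltr0n.
have mS := measurable_S; have mN := measurable_noise; have mx := measurable_x.
have mxS r t (j : J) i : measurable_fun setT (fun w => r * xc j w i + t * S i w)%R.
  by apply: measurable_funD; apply: measurable_funM.
have mxS2 r t (j : J) : measurable_fun setT (fun w => \sum_(i < n) (r * xc j w i + t * S i w) ^+ 2)%R.
  by apply: measurable_sum => i; apply: measurable_funX; exact: mxS.
have sum_sq_ge0 (f : 'I_n -> R) : (0 <= \sum_i f i ^+ 2)%R.
  by rewrite sumr_ge0// => i _; exact: sqr_ge0.
have [ax [axE axS]] : exists a : J -> R, (forall j, mean P (fun w => \sum_(i < n) xc j w i ^+ 2)%R (n%:R * a j)) /\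
    (\sum_j a j <= K * p)%R.
  have [|a [aE aS]] := fin_family _ (avg_mk_le hp).
    by move=> j; apply: integral_ge0 => w _; rewrite lee_fin mulr_ge0// invr_ge0.
  exists a; split=> // j.
  have m : measurable_fun setT (fun w => \sum_(i < n) xc j w i ^+ 2)%R.
    by apply: measurable_sum => i; apply: measurable_funX; exact: mx.
  have h : mean P (fun w => n%:R^-1 * \sum_(i < n) xc j w i ^+ 2)%R (a j).
    split; [exact: measurable_funM|by move=> w; rewrite mulr_ge0// invr_ge0|exact: aE].
  apply: mean_ext (meanZ (ltW nn0) h) => w.
  by rewrite mulrA divff ?mul1r// gt_eqF.
have hs := mean_state_energy.
(* Energies must be finite before [mean] can be used: (r x + t s)^2 <= 2 r^2 x^2 + 2 t^2 s^2, and
   the power bound makes the right side finite for every pair. *)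
have bexp (r t : R) (j : J) : exists b, mean P (fun w => \sum_(i < n) (r * xc j w i + t * S i w) ^+ 2)%R b.
  have hr : (0 <= 2 * r ^+ 2)%R by rewrite mulr_ge0// sqr_ge0.
  have ht : (0 <= 2 * t ^+ 2)%R by rewrite mulr_ge0// sqr_ge0.
  have h := meanD (meanZ hr (axE j)) (meanZ ht hs).
  have hle w : (\sum_(i < n) (r * xc j w i + t * S i w) ^+ 2 <=
      2 * r ^+ 2 * (\sum_(i < n) xc j w i ^+ 2) + 2 * t ^+ 2 * (\sum_(i < n) S i w ^+ 2))%R.
    rewrite !mulr_sumr -big_split/=; apply: ler_sum => i _.
    by have := sqr_ge0 (r * xc j w i - t * S i w)%R; move: (xc j w i) (S i w) => X Y h'; nra.
  have [b hb _] := mean_exists_le (mxS2 r t j) (fun w => sum_sq_ge0 _) h hle.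
  by exists b.
have /cid[bx bxE] : exists b : J -> R, forall j, mean P (fun w => \sum_(i < n) (1 * xc j w i + g * S i w) ^+ 2)%R (b j).
  by exists (fun j => projT1 (cid (bexp 1%R g j))) => j; exact: projT2 (cid _).
have /cid[sx sxE] : exists b : J -> R, forall j, mean P (fun w => \sum_(i < n) (1 * xc j w i + 1 * S i w) ^+ 2)%R (b j).
  by exists (fun j => projT1 (cid (bexp 1%R 1%R j))) => j; exact: projT2 (cid _).
(* Pointwise, (x + g s)^2 + g (1 - g) s^2 = (1 - g) x^2 + g (x + s)^2; all four terms are
   nonnegative, so the identity passes to means. *)
have bxsx j : (bx j + g * (1 - g) * (n%:R * T) = (1 - g) * (n%:R * ax j) + g * sx j)%R.
  have gg : (0 <= g * (1 - g))%R by rewrite mulr_ge0.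
  have h1 := meanD (bxE j) (meanZ gg hs).
  have h2 := meanD (meanZ g01 (axE j)) (meanZ g00 (sxE j)).
  apply: mean_uniq h1 _; apply: mean_ext h2 => w.
  rewrite !mulr_sumr -!big_split/=; apply: eq_bigr => i _; ring.
have hz j : mean P (fun w => \sum_(i < n) (xc j w i + S i w + NZ i w) ^+ 2)%R (sx j + n%:R * sig2).
  have := @mean_sq_noise false j (fun s u i => 1 * tnth (enc c j.1 j.2 (s, u)) i + 1 * tnth s i)%R (sx j).
  rewrite /noise /noise_std sqr_sqrtr ?(ltW sig0)// => H.
  apply: mean_ext (H _ _).
  - by move=> w; apply: eq_bigr => i _; rewrite !mul1r /Sn tnth_mktuple.
  - move=> i; apply: eq_measurable_fun (measurable_gcoord 1 1 j i) => -[]//.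
  - by apply: mean_ext (sxE j) => w; apply: eq_bigr => i _; rewrite !mul1r /Sn tnth_mktuple.
have mZ j : measurable_fun setT (fun w => Zn S NZ U c j.1 j.2 w).
  apply: measurable_mktuple => i; apply: measurable_funD; last exact: (mN false).
  by apply: measurable_funD; [exact: mx|exact: mS].
have mW : measurable_fun setT (fun w => [tuple S i w + NZ i w | i < n])%R.
  by apply: measurable_mktuple => i; apply: measurable_funD; [exact: mS|exact: (mN false)].
pose f (z : n.-tuple R) := (\sum_(i < n) lam * tnth z i ^+ 2)%R.
have hJ : #|{: J}| = (NM * NK)%N by rewrite card_prod !card_ord.
have hzS : (\sum_(j : J) lam * (sx j + n%:R * sig2) <=
   K * (- (n%:R / 2 * ln (1 - 2 * lam * (T + sig2))) + D * ln 2))%R.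
  have := @rel_entropy_variational R _ _ Om (n.-tuple R) P J
    (fun j w => Zn S NZ U c j.1 j.2 w) (fun w => [tuple S i w + NZ i w | i < n])%R
    (warden_law P S NZ U c) (Q0n (n:=n) P S NZ) f (- (n%:R / 2 * ln (1 - 2 * lam * (T + sig2)))) D.
  rewrite hJ -/K => H; rewrite -lee_fin -sumEFin; refine (le_trans _ (H _ _ _ _ _ _ _ _ hD)).
  - apply: lee_sum => j _; have [_ _ <-] := meanZ (ltW l0) (hz j).
    rewrite le_eqVlt; apply/orP; left; apply/eqP; apply: eq_integral => w _; congr EFin.
    by rewrite /f mulr_sumr; apply: eq_bigr => i _; rewrite tnth_mktuple.
  - by rewrite muln_gt0 NM0.
  - exact: mZ.
  - exact: mW.
  - by move=> B mB; rewrite /warden_law avg_mkE.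
  - by [].
  - by rewrite /f; msolve.
  - by move=> z; rewrite sumr_ge0// => i _; rewrite mulr_ge0 ?sqr_ge0// ltW.
  - rewrite -null_output_mgf// le_eqVlt; apply/orP; left; apply/eqP; apply: eq_integral => w _.
    by congr (expR _)%:E; rewrite /f; apply: eq_bigr => i _; rewrite tnth_mktuple.
have hc0 w j : (0 <= correct j w)%R by rewrite ler0n.
have hc1 w j : (correct j w <= 1)%R by rewrite lern1 leq_b1.
have cexp j : exists b, mean P (correct j) b.
  have [b hb _] := mean_exists_le (measurable_correct j) (hc0^~ j) (mean_cst P ler01) (hc1^~ j).
  by exists b.
have /cid[cx cxE] : exists b : J -> R, forall j, mean P (correct j) (b j).
  by exists (fun j => projT1 (cid (cexp j))) => j; exact: projT2 (cid _).
have cxS : (\sum_j (1 - cx j) <= K * e)%R.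
  have := avg_mk_le he; rewrite -lee_fin -sumEFin => h; apply: le_trans h; apply: lee_sum => j _.
  have mc := measurable_correct j.
  have m1 : measurable_fun setT (fun w => 1 - correct j w)%R by apply: measurable_funD => //; msolve.
  have h0 w : (0 <= 1 - correct j w)%R by rewrite subr_ge0; exact: hc1.
  have hle w : (1 - correct j w <= 1)%R by rewrite lerBlDr lerDl; exact: hc0.
  have [b hb _] := mean_exists_le m1 h0 (mean_cst P ler01) hle.
  have b1 : b = (1 - cx j)%R.
    suff : (b + cx j = 1)%R by lra.
    apply: mean_uniq (mean_cst P ler01); apply: mean_ext (meanD hb (cxE j)) => w; ring.
  rewrite -b1; have [_ _ <-] := hb.
  set B := [set w | _]; have -> : B = (correct j) @^-1` [set 0%R].
    apply/seteqP; split => w; rewrite /B /correct /=; case: eqP => //= _ //.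
    by move/eqP; rewrite oner_eq0.
  have mB : measurable ((correct j) @^-1` [set 0%R]).
    by rewrite -[X in measurable X]setTI; apply: mc.
  rewrite -[X in P X]setIT -(integral_indic _ measurableT)//.
  apply: int_le.
  - exact/measurable_EFinP.
  - by apply/measurable_EFinP; exact: measurable_indic.
  - by move=> w; rewrite lee_fin subr_ge0.
  - move=> w; rewrite lee_fin indicE; case: (boolP (w \in _)) => [_|].
      by rewrite lerBlDr lerDl.
    rewrite notin_setE /= /correct; case: eqP => //= _; first by rewrite subrr.
have qexp j : exists b, mean P (fun w => rho_w j w * correct j w)%R b.
  have m : measurable_fun setT (fun w => rho_w j w * correct j w)%R.
    by apply: measurable_funM; [exact: measurable_rho_w|exact: measurable_correct].
  have hr : mean P (rho_w j) 1.
    by split; [exact: measurable_rho_w|exact: rho_w_ge0|exact: int_rho_w].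
  have h0 w : (0 <= rho_w j w * correct j w)%R by rewrite mulr_ge0// rho_w_ge0.
  have hle w : (rho_w j w * correct j w <= rho_w j w)%R by rewrite ler_piMr// rho_w_ge0.
  have [b hb _] := mean_exists_le m h0 hr hle.
  by exists b.
have /cid[qx qxE] : exists b : J -> R, forall j, mean P (fun w => rho_w j w * correct j w)%R (b j).
  by exists (fun j => projT1 (cid (qexp j))) => j; exact: projT2 (cid _).
(* For each key the reweighted correctness sums to one over messages, so (1 + NM q) / 2 averages to
   one and cancels the constant 1 in [main]. *)
have qS : (\sum_j qx j = NK%:R)%R.
  have -> : (\sum_(j : J) qx j = \sum_m \sum_k qx (m, k))%R.
    by rewrite pair_bigA; apply: eq_bigr => -[].
  rewrite exchange_big/=.
  under eq_bigr => k _.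
    have : (\sum_(m < NM) qx (m, k))%:E = 1%:E :> \bar R.
      rewrite -(sum_rho_correct k) -sumEFin; apply: eq_bigr => m _.
      by have [_ _ <-] := qxE (m, k).
    move=> [->]; over.
  by rewrite sumr_const card_ord.
have main j : (ln NM%:R * cx j + n%:R / 2 + 1 <=
   (1 + NM%:R * qx j) / 2 + ln 2 + n%:R * ln A + (bx j + n%:R) / (2 * A ^+ 2))%R.
  apply: converse_single (cxE j) (qxE j) _; apply: mean_ext (bxE j) => w.
  by apply: eq_bigr => i _; rewrite mul1r.
have lM : (0 <= ln NM%:R :> R)%R by rewrite ln_ge0// ler1n.
set I := ((2 * A ^+ 2)^-1)%R; set L2 := (ln 2 : R)%R; set nl := (n%:R * ln A)%R.
have I0 : (0 <= I)%R by rewrite /I invr_ge0 mulr_ge0// sqr_ge0.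
have sc (a : R) : (\sum_(j : J) a = K * a)%R by rewrite sumr_const hJ mulr_natl.
have E1 : (ln NM%:R * (K - K * e) <= ln NM%:R * \sum_j cx j)%R.
  apply: ler_wpM2l => //; have : (\sum_j (1 - cx j) = K - \sum_j cx j)%R by rewrite sumrB sc mulr1.
  by move: cxS; lra.
have E2 : (ln NM%:R * (\sum_j cx j) + K * (n%:R / 2 + 1) <=
    (K + NM%:R * NK%:R) / 2 + K * L2 + K * nl + (\sum_j bx j + K * n%:R) * I)%R.
  have -> : (ln NM%:R * (\sum_j cx j) + K * (n%:R / 2 + 1) =
      \sum_(j : J) (ln NM%:R * cx j + n%:R / 2 + 1))%R.
    by under [RHS]eq_bigr do rewrite -addrA; rewrite big_split/= -mulr_sumr sc.
  refine (le_trans (ler_sum _ (fun j _ => main j)) _).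
  have -> : (\sum_j ((1 + NM%:R * qx j) / 2 + ln 2 + n%:R * ln A + (bx j + n%:R) / (2 * A ^+ 2)) =
     \sum_(j : J) (2^-1 + NM%:R / 2 * qx j + (ln 2 + n%:R * ln A + n%:R * I) + I * bx j))%R.
    by apply: eq_bigr => j _; rewrite -/I; field.
  rewrite !big_split/= -!mulr_sumr !sc qS /L2 /nl.
  by rewrite le_eqVlt; apply/orP; left; apply/eqP; field.
have E3 : (\sum_j bx j + K * (g * (1 - g) * (n%:R * T)) =
    (1 - g) * (n%:R * \sum_j ax j) + g * \sum_j sx j)%R.
  rewrite -sc -big_split/= (eq_bigr _ (fun j _ => bxsx j)) big_split/= !mulr_sumr.
  by congr (_ + _)%R; apply: eq_bigr => j _.
have E4 : (\sum_j sx j <= K * ((- (n%:R / 2 * ln (1 - 2 * lam * (T + sig2))) + D * ln 2) / lam - n%:R * sig2))%R.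
  move: hzS; rewrite -mulr_sumr big_split/= sc mulrC -ler_pdivlMr//; move: (- _ + _)%R => W.
  by rewrite mulrBr mulrA; lra.
have KE : K = (NM%:R * NK%:R)%R by rewrite /K natrM.
rewrite -(ler_pM2l K0) -/I -/L2 -/nl.
set W := ((_ / lam) - _)%R in E4 *.
have E5 : (g * \sum_j sx j <= g * (K * W))%R by exact: ler_wpM2l.
have E6 : ((1 - g) * (n%:R * \sum_j ax j) <= (1 - g) * (n%:R * (K * p)))%R.
  by do 2 apply: ler_wpM2l => //.
have E7 : ((\sum_j bx j + K * n%:R) * I <= K * ((1 - g) * (n%:R * p) + g * W - g * (1 - g) * (n%:R * T) + n%:R) * I)%R.
  by apply: ler_wpM2r => //; lra.
rewrite -KE in E2; lra.
Qed.

End ConverseBound.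

End Model.

Section Real.
Context {R : realType}.

Lemma limn_esup_lt (u : nat -> \bar R) (a : \bar R) :
  (limn_esup u < a -> \forall n \near \oo, u n <= a)%E.
Proof.
move/ereal_inf_lt => [_ [V FV <-] h]; apply: filterS FV => n Vn.
by apply: ltW; apply: le_lt_trans h; apply: ereal_sup_ubound; exists n.
Qed.

Lemma cvg0_near_le (u : nat -> \bar R) (e : R) : 0 < e ->
  (u n @[n --> \oo] --> 0)%E -> \forall n \near \oo, (u n <= e%:E)%E.
Proof.
move=> e0 /cvg_limn_einf_sup[_ h]; apply: limn_esup_lt.
by rewrite h lte_fin.
Qed.

Lemma near_div_le (a e : R) : 0 < e -> \forall n \near \oo, a <= n%:R * e.
Proof.
move=> e0; exists (`|Num.ceil (a / e)|)%N => //= n /= h.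
rewrite -ler_pdivrMr//; apply: le_trans (ceil_ge _) _.
rewrite -[n%:R]/(n%:~R) ler_int; apply: le_trans (ler_norm _) _.
by rewrite -abszE lez_nat.
Qed.

Lemma ln_idx_size (n : nat) (r : R) : 0 <= r ->
  ln ((idx_size n r)%:R : R) = (Num.ceil (n%:R * r))%:~R * ln 2.
Proof.
move=> r0; rewrite /idx_size natrX lnXn// -[ln 2 *+ _]mulr_natl; congr (_ * _).
have c0 : 0 <= Num.ceil (n%:R * r) by rewrite ceil_ge0; apply: lt_le_trans (mulr_ge0 (ler0n R n) r0).
by rewrite -{2}(gez0_abs c0).
Qed.

Lemma ln_idx_size_ge (n : nat) (r : R) : 0 <= r -> n%:R * r * ln 2 <= ln ((idx_size n r)%:R : R).
Proof.
by move=> r0; rewrite ln_idx_size// ler_wpM2r ?ceil_ge// ltW// ln2_gt0.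
Qed.

Lemma ln_idx_size_le (n : nat) (r : R) : 0 <= r ->
  ln ((idx_size n r)%:R : R) <= (n%:R * r + 1) * ln 2.
Proof.
move=> r0; rewrite ln_idx_size// ler_wpM2r ?(ltW (ln2_gt0 R))//.
by have := ceilB1_lt (n%:R * r); rewrite rmorphB /= => h; rewrite -lerBlDr ltW.
Qed.

Lemma idx_size_gt0 (n : nat) (r : R) : (0 < idx_size n r)%N.
Proof. by rewrite expn_gt0. Qed.

End Real.

(** * Optimal parameters and the asymptotic converse *)

Section RateParamsTheory.
Context {R : realType}.
Variables (T Ppow : R).
Hypotheses (T0 : 0 < T) (Pp0 : 0 < Ppow).
Local Notation g := (gamma_star T Ppow).
Local Notation Ps := (P_star T Ppow).

Lemma gamma_star_gt0 : 0 < g.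
Proof. by rewrite /gamma_star lt_min ltr01 divr_gt0// mulr_gt0. Qed.

Lemma gamma_star_le1 : g <= 1.
Proof. by rewrite /gamma_star ge_min lexx. Qed.

Lemma P_starE : Ps = 2 * g * T - g ^+ 2 * T.
Proof. by rewrite /P_star /T_star; ring. Qed.

Lemma P_star_gt0 : 0 < Ps.
Proof.
rewrite P_starE; have := gamma_star_gt0; have := gamma_star_le1 => g1 g0.
by rewrite -mulrBl mulr_gt0//; nra.
Qed.

(** Complementary slackness: either g = 1 or the power constraint is tight, Ppow = 2 g T. Hence one
    formula for the energy of X + g S yields [P_star] in both regimes. *)
Lemma gamma_star_power : (1 - g) * Ppow = (1 - g) * (2 * g * T).
Proof.
rewrite /gamma_star minEle; case: ifP => h; first by rewrite subrr !mul0r.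
by congr (_ * _); field; rewrite gt_eqF.
Qed.

Lemma gamma_star_power_le : 2 * g * T <= Ppow.
Proof.
have : g <= Ppow / (2 * T) by rewrite /gamma_star ge_min lexx orbT.
by rewrite ler_pdivlMr ?mulr_gt0// => h; lra.
Qed.

End RateParamsTheory.

Section Converse.
Context {R : realType} {d : measure_display} {Om : measurableType d}.
Variables (P : probability Om R) (T sig2 : R) (S NY NZ : nat -> Om -> R) (U : Om -> R).
Hypotheses (T0 : 0 < T) (sig0 : 0 < sig2).
Hypothesis model : gaussian_state_model P T sig2 S NY NZ U.

(** One [del] serves as slack in the power, bound on the error probability and parameter [lam] of
    the moment bound. The rate bound is then read off from a single sufficiently large
    blocklength. *)
Lemma converse_step (Ppow RK r del : R) : 0 < Ppow ->
  nc_achievable P S NY NZ U Ppow RK r -> 0 < del -> del < 1 -> 4 * del * (T + sig2) <= 1 ->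
  r * ln 2 <= 2^-1 * ln (1 + P_star T Ppow) +
    del * (r * ln 2 + 4 * (T + sig2) ^+ 2 + 3).
Proof.
move=> Pp0 [r0 [c [hp [he hD]]]] d0 d1 dV.
set g := gamma_star T Ppow; set Ps := P_star T Ppow.
have g0 : 0 < g by exact: gamma_star_gt0.
have g1 : g <= 1 by exact: gamma_star_le1.
have Ps0 : 0 < Ps by exact: P_star_gt0.
have l2 := ln2_gt0 R.
have hp' : \forall n \near \oo, (avg_power P S U (c n) <= (Ppow + del)%:E)%E.
  by apply: limn_esup_lt; apply: le_lt_trans hp _; rewrite lte_fin ltrDl.
have he' := cvg0_near_le d0 he.
have hD' := cvg0_near_le ltr01 hD.
have n1 := near_div_le (ln 2) d0.
(* The divergence enters as D ln 2 / del with D <= 1, to be absorbed into n del. *)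
have n2 := near_div_le (ln 2) (mulr_gt0 d0 d0).
have n3 : \forall n \near \oo, (0 < n)%N by exists 1%N.
have [n [[[[[pn en] Dn] n1n] n2n] npos]] :
  exists n, ((((((avg_power P S U (c n) <= (Ppow + del)%:E)%E /\ (err_prob P S NY U (c n) <= del%:E)%E) /\
   (rel_entropy (warden_law P S NZ U (c n)) (Q0n (n:=n) P S NZ) <= 1%:E)%E) /\ ln 2 <= n%:R * del) /\
   ln 2 <= n%:R * (del * del)) /\ (0 < n)%N).
  apply: (@filter_ex _ \oo).
  exact: filterI (filterI (filterI (filterI (filterI hp' he') hD') n1) n2) n3.
set V := T + sig2 in dV *.
have V0 : 0 < V by rewrite addr_gt0.
have A1 : 1 <= Num.sqrt (1 + Ps) by rewrite -{1}sqrtr1 ler_wsqrtr// lerDl ltW.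
have g01 : 0 <= g <= 1 by rewrite (ltW g0).
have lV : 2 * del * V < 1 by nra.
have := converse_finite T0 sig0 model (idx_size_gt0 n r) (idx_size_gt0 n RK) npos
  g01 A1 pn Dn en d0 lV.
rewrite -/V sqr_sqrtr; last by lra.
have -> : ln (Num.sqrt (1 + Ps)) = 2^-1 * ln (1 + Ps).
  have s0 : 0 < Num.sqrt (1 + Ps) by rewrite sqrtr_gt0 addr_gt0.
  have := lnXn 2 s0; rewrite sqr_sqrtr; last by lra.
  move=> ->.
  by rewrite -[ln _ *+ 2]mulr_natl mulrA mulVf ?mul1r// pnatr_eq0.
have := ln_idx_size_ge n r0; set LM := ln (idx_size n r)%:R => hL main.
set N := n%:R : R; have N0 : 0 < N by rewrite ltr0n.
rewrite -(ler_pM2l N0).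
have E1 : (1 - del) * (N * r * ln 2) <= (1 - del) * LM by apply: ler_wpM2l => //; lra.
have E2 : (- (N / 2 * ln (1 - 2 * del * V)) + 1 * ln 2) / del <= N * (V + 4 * del * V ^+ 2 + del).
  rewrite ler_pdivrMr//.
  have x0 : 0 < 1 - 2 * del * V by lra.
  have := ln_ge_1subV x0 => hl.
  (* Second-order bound for 1 / (1 - 2 y), valid for y = del V <= 1/4; after division by del only n
     V and terms of order n del remain. *)
  have h2 : (1 - 2 * del * V)^-1 <= 1 + 2 * del * V + 8 * (del * V) ^+ 2.
    rewrite -[_^-1]mul1r ler_pdivrMr//.
    have : 0 < del * V by exact: mulr_gt0.
    have : 4 * (del * V) <= 1 by lra.
    rewrite -[2 * del * V]mulrA; move: (del * V) => y; nra.
  have h3 : - ln (1 - 2 * del * V) <= 2 * del * V + 8 * (del * V) ^+ 2 by lra.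
  have : N / 2 * (- ln (1 - 2 * del * V)) <= N / 2 * (2 * del * V + 8 * (del * V) ^+ 2).
    by apply: ler_wpM2l => //; rewrite divr_ge0 ?(ltW N0).
  by rewrite -/N in n2n; lra.
set W := (_ / del) in E2 main.
have gg : (1 - g) * Ppow = (1 - g) * (2 * g * T) by exact: gamma_star_power.
have PE : Ps = 2 * g * T - g ^+ 2 * T by exact: P_starE.
have E3 : ((1 - g) * (N * (Ppow + del)) + g * (W - N * sig2) - g * (1 - g) * (N * T) + N) <=
   N * ((1 + Ps) + del * (2 + 4 * V ^+ 2)).
  have : g * W <= g * (N * (V + 4 * del * V ^+ 2 + del)) by apply: ler_wpM2l => //; exact: ltW.
  have : N * (g * (del * (4 * V ^+ 2 + 1))) <= N * (1 * (del * (4 * V ^+ 2 + 1))).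
    apply: ler_wpM2l; first exact: ltW.
    by apply: ler_wpM2r => //; rewrite mulr_ge0 ?(ltW d0)// addr_ge0// mulr_ge0// sqr_ge0.
  have : N * ((1 - g) * del) <= N * del by rewrite ler_pM2l// ler_piMl ?(ltW d0)//; lra.
  have : N * ((1 - g) * Ppow) = N * ((1 - g) * (2 * g * T)) by rewrite gg.
  rewrite PE /V; lra.
set Q := (_ - g * (1 - g) * (N * T) + N) in E3.
rewrite -/N -/Q in main.
have E4 : Q / (2 * (1 + Ps)) <= N / 2 + N * (del * (1 + 2 * V ^+ 2)).
  have P2 : 0 < 2 * (1 + Ps) by lra.
  rewrite (ler_pdivrMr _ _ P2); refine (le_trans E3 _).
  have : 0 <= N * (del * (1 + 2 * V ^+ 2)) * Ps.
    by rewrite !mulr_ge0 ?(ltW N0) ?(ltW d0) ?(ltW Ps0)// addr_ge0// mulr_ge0// sqr_ge0.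
  lra.
have : 0 <= N * (del * V ^+ 2) by apply: mulr_ge0 (ltW N0) (mulr_ge0 (ltW d0) (sqr_ge0 V)).
rewrite -/N in n1n; lra.
Qed.

Lemma converse (Ppow RK r : R) : 0 < Ppow ->
  nc_achievable P S NY NZ U Ppow RK r -> r <= 2^-1 * log2 (1 + P_star T Ppow).
Proof.
move=> Pp0 h; have r0 : 0 <= r by case: h.
have l2 := ln2_gt0 R; rewrite /log2 mulrA ler_pdivlMr//.
apply/ler_addgt0Pr => e /= e0.
have V0 : 0 < T + sig2 by rewrite addr_gt0.
set C := r * ln 2 + 4 * (T + sig2) ^+ 2 + 3.
have C0 : 0 < C.
  by rewrite /C ltr_wpDl// addr_ge0// mulr_ge0 ?sqr_ge0// ltW.
have V4 : 0 < (4 * (T + sig2))^-1 by rewrite invr_gt0 mulr_gt0.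
(* The first two bounds give the side conditions of [converse_step], the third makes its error term
   at most [e]. *)
pose del := Num.min (Num.min 2^-1 (4 * (T + sig2))^-1) (e / C).
have d0 : 0 < del by rewrite /del !lt_min V4 (divr_gt0 e0 C0) andbT andbT invr_gt0 ltr0n.
have := @converse_step Ppow RK r del Pp0 h d0 _ _.
have d1 : del <= 2^-1 by rewrite !ge_min lexx.
have d2 : del <= (4 * (T + sig2))^-1 by rewrite !ge_min lexx orbT.
have d3 : del <= e / C by rewrite ge_min lexx orbT.
move=> /(_ _ _)/le_trans; apply.
- by apply: le_lt_trans d1 _; rewrite invf_lt1// ltr1n.
- rewrite mulrAC mulrC -ler_pdivlMr ?mulr_gt0// mul1r //.
- by rewrite lerD2l -ler_pdivlMr.
Qed.

End Converse.

(** * Information densities of Gaussian vectors *)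

Section Nidens.
Context (R : realType) (n : nat).
Local Open Scope ereal_scope.
Local Notation vec := (n.-tuple R).

Definition nidens (rho : R) (u s : vec) : R := (\sum_(i < n) idens rho (tnth u i) (tnth s i))%R.

Lemma measurable_expR_comp d (D : measurableType d) (f : D -> R) :
  measurable_fun setT f -> measurable_fun setT (fun x => expR (f x)).
Proof. by move=> mf; exact: (measurableT_comp (@measurable_expR R)). Qed.

Lemma nidensC rho u s : nidens rho u s = nidens rho s u.
Proof. by apply: eq_bigr => i _; rewrite idensC. Qed.

Lemma measurable_nidens rho : measurable_fun setT (fun p : vec * vec => nidens rho p.1 p.2).
Proof.
apply: measurable_sum => i.
by apply: (measurable_fun2 (f := idens rho) (measurable_idens rho)); msolve.
Qed.

Lemma measurable_idens2 d (D : measurableType d) rho (a b : D -> R) :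
  measurable_fun setT a -> measurable_fun setT b ->
  measurable_fun setT (fun x => idens rho (a x) (b x)).
Proof. by move=> ma mb; apply: (measurable_fun2 (f := idens rho) (measurable_idens rho)). Qed.

Lemma measurable_nidens2 d (D : measurableType d) rho (a b : D -> vec) :
  measurable_fun setT a -> measurable_fun setT b ->
  measurable_fun setT (fun x => nidens rho (a x) (b x)).
Proof. by move=> ma mb; apply: (measurable_fun2 (f := nidens rho) (measurable_nidens rho)). Qed.

Lemma expR_nidens rho (u s : vec) : expR (nidens rho u s) = (\prod_(i < n) expR (idens rho (tnth u i) (tnth s i)))%R.
Proof. by rewrite /nidens expR_sum. Qed.

(** Block form of an identity between a double and a single one-letter Gaussian integral, such as
    [gauss_conv] or [idens_channel]. *)
Lemma gaussn_pair_change (h psi : nat -> R -> R -> R) (h' psi' : nat -> R -> R) (g : vec -> \bar R) :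
  (forall i, measurable_fun setT (fun p : R * R => h i p.1 p.2)) ->
  (forall i, measurable_fun setT (fun p : R * R => psi i p.1 p.2)) ->
  (forall i, measurable_fun setT (h' i)) -> (forall i, measurable_fun setT (psi' i)) ->
  (forall i x y, 0 <= h i x y)%R -> (forall i x, 0 <= h' i x)%R ->
  (forall i (f : R -> \bar R), measurable_fun setT f -> (forall x, 0 <= f x) ->
     \int[gauss]_x \int[gauss]_y ((h i x y)%:E * f (psi i x y)) =
     \int[gauss]_z ((h' i z)%:E * f (psi' i z))) ->
  measurable_fun setT g -> (forall t, 0 <= g t) ->
  \int[gaussn R n]_s \int[gaussn R n]_w ((\prod_(i < n) h i (tnth s i) (tnth w i))%:E *
     g [tuple psi i (tnth s i) (tnth w i) | i < n]) =
  \int[gaussn R n]_z ((\prod_(i < n) h' i (tnth z i))%:E * g [tuple psi' i (tnth z i) | i < n]).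
Proof.
move=> mh mp mh' mp' h0 h'0 E1 mg g0.
have mt : measurable_fun setT (fun x : vec * vec => [tuple psi i (tnth x.1 i) (tnth x.2 i) | i < n]).
  by apply: measurable_mktuple => i; apply: (measurable_fun2 (mp i)); msolve.
have mP : measurable_fun setT (fun x : vec * vec => (\prod_(i < n) h i (tnth x.1 i) (tnth x.2 i))%R).
  by apply: measurable_prod => i _; apply: (measurable_fun2 (mh i)); msolve.
rewrite int_tprod_pair//; last 2 first.
- by apply: emeasurable_funM; [exact/measurable_EFinP|exact: measurableT_comp mg mt].
- by move=> s t; rewrite mule_ge0// lee_fin prodr_ge0.
refine (etrans _ (@tprod_change _ _ _ _ R n (fun=> (gauss \x gauss : probability (R * R)%type R)) (fun=> gauss) _ _
  (fun i x => h i x.1 x.2) h' (fun i x => psi i x.1 x.2) psi' g _ _ _ _ _ _ _ _ _)) => //.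
- apply: eq_integral => x _; congr (_%:E * g _).
    by apply: eq_bigr => i _; rewrite !tnth_mktuple.
  by apply: eq_from_tnth => i; rewrite !tnth_mktuple.
- move=> i f mf f0; rewrite -E1//.
  apply: (int_prod gauss gauss (f := fun x y => (h i x y)%:E * f (psi i x y))).
  - by apply: emeasurable_funM; [exact/measurable_EFinP|exact: measurableT_comp mf (mp i)].
  - by move=> x y; rewrite mule_ge0// lee_fin.
Qed.

Lemma nidens_channel (rho rho' p q v V : R) (u : vec) (f : vec -> \bar R) :
  (0 < v)%R -> (0 < V)%R -> (rho ^+ 2 < 1)%R -> (rho' ^+ 2 < 1)%R ->
  (p + q * rho = rho' * V)%R ->
  (q ^+ 2 * (1 - rho ^+ 2) + v ^+ 2 = V ^+ 2 * (1 - rho' ^+ 2))%R ->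
  measurable_fun setT f -> (forall x, 0 <= f x) ->
  \int[gaussn R n]_s \int[gaussn R n]_w ((expR (nidens rho u s))%:E *
     f [tuple (p * tnth u i + q * tnth s i + v * tnth w i)%R | i < n]) =
  \int[gaussn R n]_z ((expR (nidens rho' u z))%:E * f [tuple (V * tnth z i)%R | i < n]).
Proof.
move=> v0 V0 r1 r'1 e1 e2 mf f0.
have := @gaussn_pair_change (fun i x _ => expR (idens rho (nth 0%R u i) x))
  (fun i x y => p * nth 0 u i + q * x + v * y)%R
  (fun i z => expR (idens rho' (nth 0%R u i) z)) (fun i z => V * z)%R f.
move=> H; refine (etrans _ (etrans (H _ _ _ _ _ _ _ mf f0) _)).
- apply: eq_integral => s _; apply: eq_integral => w _; rewrite expR_nidens.
  congr (_%:E * f _); first by apply: eq_bigr => i _; rewrite -tnth_nth.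
  by apply: eq_from_tnth => i; rewrite !tnth_mktuple -tnth_nth.
- by move=> i; apply: measurable_expR_comp; apply: measurable_idens2; msolve.
- by move=> i; msolve.
- by move=> i; apply: measurable_expR_comp; apply: measurable_idens2; msolve.
- by move=> i; msolve.
- by move=> i x y; exact: expR_ge0.
- by move=> i x; exact: expR_ge0.
- move=> i k mk k0.
  have mkV : measurable_fun setT (fun y => k (V * y)%R) by apply: (measurableT_comp mk); msolve.
  refine (etrans _ (idens_channel (nth 0%R u i) v0 V0 r1 r'1 e1 e2 mkV (fun y => k0 _))).
  apply: eq_integral => s _; apply: eq_integral => w _.
  by congr (_ * k _); rewrite [RHS]mulrC divfK// gt_eqF.
- by apply: eq_integral => z _; rewrite expR_nidens; congr (_%:E * _); apply: eq_bigr => i _; rewrite -tnth_nth.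
Qed.

Lemma gaussn_conv (a b : R) (f : vec -> \bar R) : (0 < b)%R ->
  measurable_fun setT f -> (forall x, 0 <= f x) ->
  \int[gaussn R n]_s \int[gaussn R n]_w f [tuple (a * tnth s i + b * tnth w i)%R | i < n] =
  \int[gaussn R n]_z f [tuple (Num.sqrt (a ^+ 2 + b ^+ 2) * tnth z i)%R | i < n].
Proof.
move=> b0 mf f0.
have := @gaussn_pair_change (fun _ _ _ => 1%R) (fun i x y => a * x + b * y)%R
  (fun _ _ => 1%R) (fun i z => Num.sqrt (a ^+ 2 + b ^+ 2) * z)%R f.
move=> H; refine (etrans _ (etrans (H _ _ _ _ _ _ _ mf f0) _)).
- by apply: eq_integral => s _; apply: eq_integral => w _; rewrite big1// mul1e.
- by move=> i; msolve.
- by move=> i; msolve.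
- by move=> i; msolve.
- by move=> i; msolve.
- by move=> i x y; exact: ler01.
- by move=> i x; exact: ler01.
- move=> i k mk k0; under eq_integral do under eq_integral do rewrite mul1e.
  by under [RHS]eq_integral do rewrite mul1e; exact: gauss_conv.
- by apply: eq_integral => z _; rewrite big1// mul1e.
Qed.

Lemma gaussn_sq (c : R) : (0 <= c)%R ->
  \int[gaussn R n]_z (\sum_(i < n) (c * tnth z i) ^+ 2)%:E = (n%:R * c ^+ 2)%:E.
Proof.
move=> c0.
under eq_integral do rewrite -sumEFin.
rewrite int_sum; last 2 first.
- by move=> i; msolve.
- by move=> i x; rewrite lee_fin sqr_ge0.
rewrite (eq_bigr (fun=> (c ^+ 2)%:E)) ?sumEFin ?sumr_const ?card_ord ?mulr_natl// => i _.
rewrite (@tprod_coord _ _ _ _ (fun=> gauss) i (fun x => ((c * x) ^+ 2)%:E)).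
- under eq_integral do rewrite exprMn EFinM.
  rewrite intZ ?sqr_ge0//.
  + have -> : \int[gauss]_x (x ^+ 2)%:E = \int[gauss]_x ((0 + x) ^+ 2)%:E :> \bar R.
      by apply: eq_integral => x _; rewrite add0r.
    by rewrite gauss_sq expr0n add0r mule1.
  + by msolve.
  + by move=> x; rewrite lee_fin sqr_ge0.
- by msolve.
- by move=> x; rewrite lee_fin sqr_ge0.
Qed.

(** Under correlation rho, p u + q s = (p rho + q) s + p sqrt (1 - rho^2) w with w independent of s,
    so its letters have variance c^2. *)
Lemma nidens_power (rho p q : R) : (rho ^+ 2 < 1)%R -> (0 < p)%R ->
  \int[gaussn R n]_u \int[gaussn R n]_s ((expR (nidens rho u s))%:E *
     (\sum_(i < n) (p * tnth u i + q * tnth s i) ^+ 2)%:E) =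
  (n%:R * (p ^+ 2 + q ^+ 2 + 2 * p * q * rho))%:E.
Proof.
move=> r1 p0.
set c := Num.sqrt ((p * rho + q) ^+ 2 + (p * Num.sqrt (1 - rho ^+ 2)) ^+ 2).
have rr : (0 < 1 - rho ^+ 2)%R by rewrite subr_gt0.
have -> : (p ^+ 2 + q ^+ 2 + 2 * p * q * rho)%R = (c ^+ 2)%R.
  by rewrite /c sqr_sqrtr ?addr_ge0 ?sqr_ge0// exprMn sqr_sqrtr ?(ltW rr)//; ring.
rewrite -gaussn_sq ?sqrtr_ge0//.
pose g (z : vec) := (\sum_(i < n) tnth z i ^+ 2)%:E.
have g0 z : 0 <= g z by rewrite lee_fin sumr_ge0// => i _; exact: sqr_ge0.
have mg : measurable_fun setT g by rewrite /g; msolve.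
have := @gaussn_pair_change (fun _ u s => expR (idens rho u s)) (fun i x y => p * x + q * y)%R
  (fun _ _ => 1%R) (fun i z => c * z)%R g.
move=> H; refine (etrans _ (etrans (H _ _ _ _ _ _ _ mg g0) _)).
- apply: eq_integral => s _; apply: eq_integral => w _; rewrite expR_nidens.
  by congr (_ * (_%:E)); apply: eq_bigr => i _; rewrite tnth_mktuple.
- by move=> i; apply: measurable_expR_comp; exact: measurable_idens.
- by move=> i; msolve.
- by move=> i; msolve.
- by move=> i; msolve.
- by move=> i x y; exact: expR_ge0.
- by move=> i x; exact: ler01.
- move=> i k mk k0; under [RHS]eq_integral do rewrite mul1e.
  rewrite int_swap; last 2 first.
  + apply: emeasurable_funM; last by apply: (measurableT_comp mk); msolve.
    by apply/measurable_EFinP; apply: measurable_expR_comp; exact: measurable_idens.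
  + by move=> x y; rewrite mule_ge0// lee_fin expR_ge0.
  have pc : (0 < p * Num.sqrt (1 - rho ^+ 2))%R by rewrite mulr_gt0 ?sqrtr_gt0.
  rewrite -(gauss_conv _ pc mk k0); apply: eq_integral => s _.
  under eq_integral do rewrite idensC.
  rewrite -(idens_kernel s (f := fun x => k (p * x + q * s)%R) r1) //; last first.
    by apply: (measurableT_comp mk); msolve.
  by apply: eq_integral => w _; congr (k _); ring.
- apply: eq_integral => z _; rewrite big1// mul1e; congr (_%:E).
  by apply: eq_bigr => i _; rewrite tnth_mktuple.
Qed.

Lemma nidens_int1 (rho : R) (u : vec) : (rho ^+ 2 < 1)%R ->
  \int[gaussn R n]_s (expR (nidens rho u s))%:E = 1.
Proof.
move=> r1; under eq_integral => s _.
  rewrite expR_nidens (eq_bigr (fun i : 'I_n => expR (idens rho (nth 0%R u i) (tnth s i)))); last first.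
    by move=> i _; rewrite -tnth_nth.
  over.
rewrite (@int_tprod_prod _ _ _ n (fun=> gauss) (fun i s => expR (idens rho (nth 0%R u i) s))).
- by rewrite big1// => i _; rewrite idens_int1.
- by move=> i; apply: measurable_expR_comp; apply: measurable_idens2; msolve.
- by move=> i x; exact: expR_ge0.
- by move=> i; rewrite idens_int1.
Qed.

Lemma nidens_int1r (rho : R) (s : vec) : (rho ^+ 2 < 1)%R ->
  \int[gaussn R n]_u (expR (nidens rho u s))%:E = 1.
Proof. by move=> r1; under eq_integral do rewrite nidensC; exact: nidens_int1. Qed.

Lemma nidens_mgf (rho e : R) : (rho ^+ 2 < 1)%R -> (`|e| <= 1)%R ->
  \int[gaussn R n]_u \int[gaussn R n]_s (expR ((1 + e) * nidens rho u s))%:E =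
  (expR (n%:R * (- (e * ln (1 - rho ^+ 2) / 2) - ln (1 - e ^+ 2 * rho ^+ 2) / 2)))%:E.
Proof.
move=> r1 e1.
pose M : R := (- (e * ln (1 - rho ^+ 2) / 2) - ln (1 - e ^+ 2 * rho ^+ 2) / 2)%R.
have mi : measurable_fun setT (fun p : R * R => expR ((1 + e) * idens rho p.1 p.2)).
  by apply: measurable_expR_comp; apply: measurable_funM => //; exact: measurable_idens.
have := @gaussn_pair_change (fun _ u s => expR ((1 + e) * idens rho u s)) (fun _ _ _ => 0%R)
  (fun _ _ => expR M) (fun i z => 0%R) (cst 1).
move=> H; refine (etrans _ (etrans (H _ _ _ _ _ _ _ _ _) _)).
- apply: eq_integral => s _; apply: eq_integral => w _; rewrite mule1 /nidens mulr_sumr expR_sum.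
  by [].
- by [].
- by move=> i; msolve.
- by move=> i; msolve.
- by move=> i; msolve.
- by move=> i x y; exact: expR_ge0.
- by move=> i x; exact: expR_ge0.
- move=> i f mf f0.
  rewrite (int_prob_cst gauss) /M.
  under eq_integral => x _.
    under eq_integral do rewrite muleC.
    rewrite intZe; [|exact: f0|by apply/measurable_EFinP; apply: measurable_expR_comp; apply: measurable_funM => //; apply: measurable_idens2; msolve|by move=> y; rewrite lee_fin expR_ge0].
    over.
  rewrite intZe; [|exact: f0| |by move=> x; apply: integral_ge0 => y _; rewrite lee_fin expR_ge0].
    by rewrite idens_mgf// muleC.
  by apply: measurable_int1 => [|x y]; [exact/measurable_EFinP|rewrite lee_fin expR_ge0].
- by msolve.
- by move=> t; rewrite lee01.
- under eq_integral do rewrite mule1.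
  by rewrite (int_prob_cst (gaussn R n)) prodr_const card_ord -expRM_natl.
Qed.

End Nidens.

(** * Soft covering *)

Section Phi.
Context (R : realType).

(** Generator of relative entropy, with a linear correction that makes it nonnegative and integrates
    to zero for a probability density. *)
Definition phi (x : R) : R := x * ln x - x + 1.

(** Pointwise form of the bound of relative entropy from below by the squared Hellinger distance. *)
Lemma phi_sqrt_ge (x : R) : 0 < x -> (1 - Num.sqrt x) ^+ 2 <= phi x.
Proof.
move=> x0; set t := Num.sqrt x; have t0 : 0 < t by rewrite sqrtr_gt0.
have -> : x = t ^+ 2 by rewrite sqr_sqrtr// ltW.
rewrite /phi lnXn// -[ln t *+ 2]mulr_natl.
have h := ln_ge_1subV t0.
have : t ^+ 2 * (2 * (1 - t^-1)) <= t ^+ 2 * (2 * ln t) by rewrite ler_pM2l ?exprn_gt0// ler_pM2l.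
have -> : t ^+ 2 * (2 * (1 - t^-1)) = 2 * t ^+ 2 - 2 * t by field; rewrite gt_eqF.
by lra.
Qed.

Lemma phi_ge0 (x : R) : 0 < x -> 0 <= phi x.
Proof. by move=> /phi_sqrt_ge; apply: le_trans; exact: sqr_ge0. Qed.

(** With t = sqrt x, 1 - x <= 2 (1 - t) <= l + (1 - t)^2 / l. The free parameter [l] balances the
    two terms when a small mean of [phi] has to bound a mean of 1 - x. *)
Lemma one_sub_le_phi (x l : R) : 0 < x -> 0 < l -> 1 - x <= l + phi x / l.
Proof.
move=> x0 l0; have := phi_sqrt_ge x0; set t := Num.sqrt x => h.
have t0 : 0 < t by rewrite sqrtr_gt0.
have xE : x = t ^+ 2 by rewrite sqr_sqrtr// ltW.
have : (1 - t) ^+ 2 / l <= phi x / l by rewrite ler_pM2r ?invr_gt0.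
suff : 1 - x <= l + (1 - t) ^+ 2 / l by lra.
rewrite -(ler_pM2r l0) [leRHS]mulrDl divfK ?gt_eqF// xE.
have := mulr_ge0 (sqr_ge0 (1 - t)) (ltW l0); have := sqr_ge0 (1 - t - l); lra.
Qed.

(** Tangent of the convex function [phi] at y. For fixed y it is affine in x, so it can be
    integrated over a cell of a partition. *)
Lemma phi_tangent (x y : R) : 0 < x -> 0 < y -> 1 - y + x * ln y <= phi x.
Proof.
move=> x0 y0; have yx : 0 < y / x by rewrite divr_gt0.
have := ln_le_sub1 yx; rewrite ln_div ?posrE// => h.
have : x * (ln y - ln x) <= x * (y / x - 1) by rewrite ler_pM2l.
by rewrite !mulrBr mulrCA divff ?gt_eqF// /phi; lra.
Qed.

(** Origin of the exponent 1 + e in soft covering: the logarithm is traded for a small power, whose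
    mean is a moment of the density. For t <= 0 use ln (1 + u) <= u, for t > 0 extract t first. *)
Lemma ln1_expR_le (t e : R) : 0 < e -> e <= 1 -> ln (1 + expR t) <= expR (e * t) / e.
Proof.
move=> e0 e1; have [t0|t0] := lerP t 0.
  have x0 := expR_gt0 t.
  have h : ln (1 + expR t) <= expR t.
    by apply: le_trans (ln_le_sub1 _) _; [rewrite addr_gt0|rewrite addrAC subrr add0r].
  apply: le_trans h _; rewrite ler_pdivlMr//.
  apply: (@le_trans _ _ (expR t)); first by rewrite ler_piMr// ltW.
  by rewrite ler_expR; nra.
have -> : ln (1 + expR t) = t + ln (1 + expR (- t)).
  rewrite -{2}(expRK t) -lnM ?posrE ?expR_gt0 ?addr_gt0 ?expR_gt0//.
  by rewrite mulrDr mulr1 -expRD subrr expR0 addrC.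
have h : ln (1 + expR (- t)) <= 1.
  apply: le_trans (ln_le_sub1 _) _; first by rewrite addr_gt0 ?expR_gt0.
  by rewrite addrAC subrr add0r -expR0 ler_expR oppr_le0 ltW.
rewrite ler_pdivlMr//; have := expR_ge1Dx (e * t).
by have : e * ln (1 + expR (- t)) <= 1; nra.
Qed.

End Phi.

Lemma measurable_fun_div_gt0 (R : realType) d (T : measurableType d) (f g : T -> R) :
  (forall x, 0 < f x) -> (forall x, 0 < g x) ->
  measurable_fun setT f -> measurable_fun setT g -> measurable_fun setT (fun x => f x / g x).
Proof.
move=> f0 g0 mf mg.
have ml (h : T -> R) : measurable_fun setT h -> measurable_fun setT (fun x => ln (h x)) by
  move=> mh; exact: (measurableT_comp (@measurable_ln R)).
apply: (eq_measurable_fun (fun x => expR (ln (f x) - ln (g x)))) => [x _|].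
  by rewrite expRB (lnK (f0 x)) (lnK (g0 x)).
by apply: measurable_expR_comp; apply: measurable_funB; exact: ml.
Qed.

Lemma sumr_cst (R : realType) (J : finType) (c : R) : \sum_(j : J) c = #|J|%:R * c.
Proof. by rewrite sumr_const mulr_natl. Qed.

Section CoveringPointwise.

Context (R : realType) (J : finType) (a : J -> R) (N : R).
Hypotheses (N0 : 0 < N).

(** The density x of a codeword times 1 / (1 + x / N), the slope of the logarithm at 1 + x / N. *)
Definition damp (x : R) : R := x / (1 + x / N).

(* Tangent line of [ln] at [1 + r j / N]: after integration the two damped sums cancel,
   because distinct codewords are independent and densities integrate to one. *)
Lemma covering_pointwise (e : R) : 0 < e -> e <= 1 -> (0 < #|J|)%N ->
  phi (N^-1 * \sum_j expR (a j)) + N^-1 * (\sum_j expR (a j)) +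
    N^-1 * (\sum_j damp (expR (a j))) <=
  N^-1 * (\sum_j e^-1 * expR (- (e * ln N)) * expR ((1 + e) * a j)) +
  (N^-1 * N^-1) * (\sum_j \sum_(i | i != j) damp (expR (a j)) * expR (a i)) + 1.
Proof.
move=> e0 e1 J0.
pose r j := expR (a j); pose kap j := damp (r j); set b := N^-1 * _.
have r0 j : 0 < r j by exact: expR_gt0.
have w0 j : 0 < r j / N by rewrite divr_gt0.
have Ni : 0 < N^-1 by rewrite invr_gt0.
have b0 : 0 < b.
  have /card_gt0P[j _] := J0; apply: (mulr_gt0 Ni); rewrite (bigD1 j)//=.
  by apply: ltr_pwDl (r0 j) _; apply: sumr_ge0 => i _; exact: (ltW (r0 i)).
have -> : phi b + b = N^-1 * \sum_j r j * ln b + 1.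
  by rewrite /phi -mulr_suml mulrA -/b; ring.
have key j : r j * ln b + kap j <= e^-1 * expR (- (e * ln N)) * expR ((1 + e) * a j) +
    N^-1 * \sum_(i | i != j) kap j * r i.
  have w1 : 0 < 1 + r j / N by rewrite addr_gt0.
  have h1 : ln b <= ln (1 + r j / N) + (b / (1 + r j / N) - 1).
    have := ln_le_sub1 (divr_gt0 b0 w1); rewrite ln_div ?posrE//; lra.
  have h2 : ln (1 + r j / N) <= expR (e * (a j - ln N)) / e.
    by rewrite /r -{1}(lnK N0) -expRN -expRD; exact: ln1_expR_le.
  have h3 : r j * ln b <= r j * (expR (e * (a j - ln N)) / e + (b / (1 + r j / N) - 1)).
    by rewrite ler_pM2l//; lra.
  have h4 : r j * (expR (e * (a j - ln N)) / e) = e^-1 * expR (- (e * ln N)) * expR ((1 + e) * a j).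
    rewrite /r mulrBr expRD mulrDl mul1r expRD; ring.
  have h5 : b = r j / N + N^-1 * \sum_(i | i != j) r i by rewrite /b (bigD1 j)//= mulrDr (mulrC N^-1).
  have h6 : r j * (b / (1 + r j / N) - 1) + kap j = N^-1 * \sum_(i | i != j) kap j * r i.
    rewrite -mulr_sumr h5 /kap /damp; move: (\sum_(i | _) _) => S; field.
    by rewrite !gt_eqF// addr_gt0.
  rewrite mulrDr in h3; lra.
have := ler_sum (index_enum J) (fun j (_ : true) => key j).
rewrite !big_split/= -!mulr_sumr => h.
have := ler_wpM2l (ltW Ni) h; rewrite !mulrDr mulrA; lra.
Qed.

End CoveringPointwise.

Section SoftCovering.
Local Open Scope ereal_scope.
Context (R : realType) d dE dF (D : measurableType d) (E : measurableType dE) (F : measurableType dF)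
  (Pc : probability D R) (mu : probability E R) (ka : probability F R)
  (J : finType) (C : J -> D -> E) (I : E -> F -> R).
Hypothesis J0 : (0 < #|J|)%N.
Hypothesis mC : forall j, measurable_fun setT (C j).
Hypothesis mI : measurable_fun setT (fun p : E * F => I p.1 p.2).
Hypothesis C1 : forall j (f : E -> \bar R), measurable_fun setT f -> (forall x, 0 <= f x) ->
  \int[Pc]_w f (C j w) = \int[mu]_u f u.
Hypothesis C2 : forall i j (f : E -> E -> \bar R), i != j ->
  measurable_fun setT (fun p : E * E => f p.1 p.2) -> (forall x y, 0 <= f x y) ->
  \int[Pc]_w f (C i w) (C j w) = \int[mu]_u \int[mu]_v f u v.
Hypothesis I1 : forall z, \int[mu]_u (expR (I u z))%:E = 1.

Local Notation N := (#|J|%:R : R).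
Local Notation Q := (Pc \x ka : probability (D * F)%type R).

Definition mixture (w : D) (z : F) : R := (N^-1 * \sum_j expR (I (C j w) z))%R.

Lemma mean_prod d1 d2 (X : measurableType d1) (Y : measurableType d2) (m1 : probability X R)
   (m2 : probability Y R) (f : X -> Y -> R) (a : R) :
  mean (m1 \x m2 : probability (X * Y)%type R) (fun p => f p.1 p.2) a <->
  [/\ measurable_fun setT (fun p : X * Y => f p.1 p.2), forall x y, (0 <= f x y)%R &
   \int[m1]_x \int[m2]_y (f x y)%:E = a%:E].
Proof.
split=> -[mf f0 fE]; split => //.
- by move=> x y; have := f0 (x, y).
- by rewrite -fE (int_prod _ _ (f := fun x y => (f x y)%:E))//;
    [exact/measurable_EFinP|move=> x y; rewrite lee_fin (f0 (x, y))].
- by rewrite -fE (int_prod _ _ (f := fun x y => (f x y)%:E))//; exact/measurable_EFinP.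
Qed.

Lemma measurable_letter d1 (X : measurableType d1) (u : X -> E) (z : X -> F) :
  measurable_fun setT u -> measurable_fun setT z -> measurable_fun setT (fun x => I (u x) (z x)).
Proof. by move=> mu' mz; apply: (measurable_fun2 (f := I) mI). Qed.

Lemma mean_codeword j (f : E -> F -> R) (a : R) :
  mean (mu \x ka : probability (E * F)%type R) (fun p => f p.1 p.2) a ->
  mean Q (fun p => f (C j p.1) p.2) a.
Proof.
move=> /mean_prod[mf f0 fE].
apply/(@mean_prod _ _ _ _ _ _ (fun w z => f (C j w) z)); split => //.
  apply: (measurable_fun2 mf); last exact: measurable_snd.
  exact: measurableT_comp (mC j) measurable_fst.
rewrite -fE (C1 j (f := fun u => \int[ka]_z (f u z)%:E))//.
- by apply: measurable_int1 => [|x y]; [exact/measurable_EFinP|rewrite lee_fin].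
- by move=> x; apply: integral_ge0 => z _; rewrite lee_fin.
Qed.

Lemma mean_density : mean (mu \x ka : probability (E * F)%type R) (fun p => expR (I p.1 p.2)) 1.
Proof.
apply/(@mean_prod _ _ _ _ _ _ (fun u z => expR (I u z))); split.
- exact: measurable_expR_comp.
- by move=> x y; exact: expR_ge0.
rewrite int_swap; last 2 first.
- by apply/measurable_EFinP; exact: measurable_expR_comp.
- by move=> x y; rewrite lee_fin expR_ge0.
by under eq_integral do rewrite I1; rewrite int_prob_cst.
Qed.

(** The second codeword is independent of the first and its density has mean one for every z, so the
    extra factor integrates away. *)
Lemma mean_codeword2 i j (f : E -> F -> R) (a : R) : i != j ->
  mean (mu \x ka : probability (E * F)%type R) (fun p => f p.1 p.2) a ->
  mean Q (fun p => f (C i p.1) p.2 * expR (I (C j p.1) p.2))%R a.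
Proof.
move=> ij /mean_prod[mf f0 fE].
have mg : measurable_fun setT (fun p : (E * E) * F => f p.1.1 p.2 * expR (I p.1.2 p.2))%R.
  apply: measurable_funM; first by apply: (measurable_fun2 mf); msolve.
  by apply: measurable_expR_comp; apply: measurable_letter; msolve.
have m1 i' := measurableT_comp (mC i') (@measurable_fst _ _ D F).
apply/(@mean_prod _ _ _ _ _ _ (fun w z => f (C i w) z * expR (I (C j w) z))%R); split.
- apply: measurable_funM; first by apply: (measurable_fun2 mf); [exact: m1|msolve].
  by apply: measurable_expR_comp; apply: measurable_letter; [exact: m1|msolve].
- by move=> x y; rewrite mulr_ge0// expR_ge0.
have fg0 u v z : 0 <= (f u z * expR (I v z))%:E by rewrite lee_fin mulr_ge0// expR_ge0.
rewrite (C2 (f := fun u v => \int[ka]_z (f u z * expR (I v z))%:E) ij); last 2 first.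
- by apply: (measurable_int1 ka (f := fun p z => (f p.1 z * expR (I p.2 z))%:E)); [exact/measurable_EFinP|].
- by move=> x y; apply: integral_ge0.
rewrite -fE; apply: eq_integral => u _.
have mu1 : measurable_fun setT (fun p : E * F => f u p.2 * expR (I p.1 p.2))%R.
  apply: measurable_funM; first by apply: (measurable_fun2 mf); msolve.
  exact: measurable_expR_comp.
rewrite int_swap; [|exact/measurable_EFinP|by []].
apply: eq_integral => z _; under eq_integral do rewrite EFinM.
rewrite intZ ?I1 ?mule1//.
by apply/measurable_EFinP; apply: measurable_expR_comp; apply: measurable_letter; msolve.
Qed.

Lemma mixture_gt0 w z : (0 < mixture w z)%R.
Proof.
have /card_gt0P[j _] := J0.
apply: mulr_gt0; first by rewrite invr_gt0 ltr0n.
rewrite (bigD1 j)//=; apply: ltr_pwDl (expR_gt0 _) _.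
by apply: sumr_ge0 => i _; exact: expR_ge0.
Qed.

Lemma measurable_mixture : measurable_fun setT (fun p : D * F => mixture p.1 p.2).
Proof.
apply: measurable_funM => //; apply: measurable_sum => j.
apply: measurable_expR_comp; apply: measurable_letter; last by msolve.
exact: measurableT_comp (mC j) measurable_fst.
Qed.

Lemma measurable_phi : measurable_fun setT (@phi R).
Proof.
apply: measurable_funD; last exact: measurable_cst.
apply: measurable_funB; last exact: measurable_id.
by apply: measurable_funM; [exact: measurable_id|exact: measurable_ln].
Qed.

Lemma mean_mixture : mean Q (fun p => mixture p.1 p.2) 1.
Proof.
have N0 : (0 < N)%R by rewrite ltr0n.
have h : (0 <= N^-1)%R by rewrite invr_ge0 ltW.
have hj j := @mean_codeword j (fun u z => expR (I u z)) 1 mean_density.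
have := meanZ h (mean_sum hj).
by rewrite sumr_const mulVf// gt_eqF.
Qed.

(** Integral of [covering_pointwise]. The damped terms have mean K on the left and at most K on the
    right, where the diagonal pairs are missing, and the unit mean of the mixture cancels the
    constant 1. *)
Lemma soft_covering (e m : R) : (0 < e)%R -> (e <= 1)%R ->
  \int[mu]_u \int[ka]_z (expR ((1 + e) * I u z))%:E = m%:E ->
  \int[Pc]_w \int[ka]_z (phi (mixture w z))%:E <= (e^-1 * expR (- (e * ln N)) * m)%:E.
Proof.
move=> e0 e1 hm.
have N0 : (0 < N)%R by rewrite ltr0n.
have Ni : (0 <= N^-1)%R by rewrite invr_ge0 ltW.
pose kap u z := damp N (expR (I u z)).
have r0 u z : (0 < expR (I u z))%R by exact: expR_gt0.
have d1 u z : (1 <= 1 + expR (I u z) / N)%R by rewrite lerDl divr_ge0 ?(ltW N0)// ltW.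
have d0 u z : (0 < 1 + expR (I u z) / N)%R by rewrite (lt_le_trans _ (d1 u z)).
have kap0 u z : (0 <= kap u z)%R by rewrite divr_ge0// ltW.
have kap1 u z : (kap u z <= expR (I u z))%R by rewrite ler_pdivrMr// ler_peMr// ltW.
have mr := @measurable_expR_comp R _ _ _ mI.
have mk : measurable_fun setT (fun p : E * F => kap p.1 p.2).
  apply: (measurable_fun_div_gt0 (f := fun p => expR (I p.1 p.2)) (g := fun p => 1 + expR (I p.1 p.2) / N)%R) => //.
  by apply: measurable_funD; [exact: measurable_cst|apply: measurable_funM].
(* K is finite because damping only decreases the density, which has mean one; finiteness is what
   allows K to be cancelled. *)
have [K hK K1] := mean_exists_le (f := fun p => kap p.1 p.2) mk (fun p => kap0 _ _) mean_density
  (fun p => kap1 _ _).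
have hA : mean (mu \x ka : probability (E * F)%type R) (fun p => expR ((1 + e) * I p.1 p.2)) m.
  apply/(@mean_prod _ _ _ _ _ _ (fun u z => expR ((1 + e) * I u z))); split => //.
  by apply: measurable_expR_comp; exact: measurable_funM.
set c := (e^-1 * expR _)%R.
have c0 : (0 <= c)%R by rewrite mulr_ge0 ?expR_ge0// invr_ge0 ltW.
have hA' j := meanZ c0 (@mean_codeword j (fun u z => expR ((1 + e) * I u z)) m hA).
have hK' j := @mean_codeword j kap K hK.
have hKK j i : mean Q (fun p => if i != j then kap (C j p.1) p.2 * expR (I (C i p.1) p.2) else 0)%R
    (if i != j then K else 0)%R.
  case: (boolP (i != j)) => ij; last exact: mean_cst.
  by apply: (@mean_codeword2 j i kap); rewrite // eq_sym.
have hR := meanD (meanD (meanZ Ni (mean_sum hA')) (meanZ (mulr_ge0 Ni Ni)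
  (mean_sum (fun j => mean_sum (hKK j))))) (mean_cst Q ler01).
have hpt w z : (phi (mixture w z) + mixture w z + N^-1 * (\sum_j kap (C j w) z) <=
   N^-1 * (\sum_j c * expR ((1 + e) * I (C j w) z)) +
   N^-1 * N^-1 * (\sum_j \sum_i (if i != j then kap (C j w) z * expR (I (C i w) z) else 0)) + 1)%R.
  have := covering_pointwise (fun j => I (C j w) z) N0 e0 e1 J0.
  have -> : (\sum_j \sum_(i | i != j) damp N (expR (I (C j w) z)) * expR (I (C i w) z) =
      \sum_j \sum_i (if i != j then kap (C j w) z * expR (I (C i w) z) else 0))%R.
    by apply: eq_bigr => j _; rewrite big_mkcond.
  by [].
have s0 w z : (0 <= N^-1 * (\sum_j kap (C j w) z))%R by rewrite mulr_ge0// sumr_ge0.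
have mp : measurable_fun setT (fun p : D * F => phi (mixture p.1 p.2)).
  exact: measurableT_comp measurable_phi measurable_mixture.
have [a ha _] := mean_exists_le mp (fun p => phi_ge0 (mixture_gt0 p.1 p.2)) hR
  (fun p => le_trans (ler_wpDr (s0 p.1 p.2) (ler_wpDr (ltW (mixture_gt0 p.1 p.2)) (lexx _))) (hpt p.1 p.2)).
have := mean_le (meanD (meanD ha mean_mixture) (meanZ Ni (mean_sum hK'))) hR (fun p => hpt p.1 p.2).
have -> : (\sum_(j : J) (c * m) = N * (c * m))%R by rewrite sumr_const mulr_natl.
have -> : (\sum_(j : J) K = N * K)%R by rewrite sumr_const mulr_natl.
rewrite !mulKf ?gt_eqF//.
have K0 := mean_ge0 hK.
have : (N^-1 * N^-1 * (\sum_(j : J) \sum_(i : J) (if i != j then K else 0)) <= K)%R.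
  have KE : (N^-1 * N^-1 * (\sum_(j : J) \sum_(i : J) K) = K)%R.
    have nN : N != 0%R by rewrite gt_eqF.
    by rewrite !sumr_cst -mulrA !(mulKf nN).
  rewrite -[leRHS]KE; apply: ler_wpM2l; first exact: mulr_ge0.
  by apply: ler_sum => j _; apply: ler_sum => i _; case: ifP.
have /(@mean_prod _ _ _ _ _ _ (fun w z => phi (mixture w z)))[_ _ ->] := ha.
rewrite lee_fin; lra.
Qed.

Lemma deficit_le_phi (l m : R) : (0 < l)%R ->
  \int[Pc]_w \int[ka]_z (phi (mixture w z))%:E <= m%:E ->
  \int[Pc]_w \int[ka]_z (Num.max 0 (1 - mixture w z))%:E <= (l + m / l)%:E.
Proof.
move=> l0 hm.
have mp : measurable_fun setT (fun p : D * F => phi (mixture p.1 p.2)).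
  exact: measurableT_comp measurable_phi measurable_mixture.
have p0 w z : (0 <= phi (mixture w z))%R by apply: phi_ge0; exact: mixture_gt0.
have [a ha am] : exists2 a, mean Q (fun p => phi (mixture p.1 p.2)) a & (a <= m)%R.
  apply: mean_exists => //; rewrite (int_prod _ _ (f := fun x y => (phi (mixture x y))%:E))//.
  exact/measurable_EFinP.
have li : (0 <= l^-1)%R by rewrite invr_ge0 ltW.
have mx : measurable_fun setT (fun p : D * F => Num.max 0 (1 - mixture p.1 p.2))%R.
  by apply: measurable_maxr => //; apply: measurable_funB => //; exact: measurable_mixture.
have [b hb bm] := mean_exists_le (b := (l + l^-1 * a)%R) mx
  (fun p => ltac:(by rewrite le_max lexx)) (meanD (mean_cst Q (ltW l0)) (meanZ li ha))
  (fun p => ltac:(by rewrite ge_max (mulrC l^-1)%R one_sub_le_phi ?mixture_gt0// andbT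
     addr_ge0 ?(ltW l0)// mulr_ge0)).
have /(@mean_prod _ _ _ _ _ _ (fun w z => Num.max 0 (1 - mixture w z))%R)[_ _ ->] := hb.
rewrite lee_fin; apply: le_trans bm _; rewrite lerD2l mulrC ler_wpM2r//.
Qed.

End SoftCovering.

(** * Upper bound on relative entropy *)

Section KlSum.
Context (R : realType).

(* The logarithm of [a / q] is replaced by that of [rho = (b + f + s q) / q],
   which is at least [s] and dominates [a / q]. *)
Lemma kl_term_le (a b f q v s : R) : 0 < s -> s <= 1 -> 0 <= a -> 0 <= b -> 0 <= f ->
  f <= q -> a <= b + f ->
  (forall y, 0 < y -> q + b * ln y <= v + y * q) ->
  (kl_term a q <= ((ln 2)^-1 * (v - q + b + f + s * q + f * - ln s + s * (b + f + s * q) +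
     (b + f - a) * - ln s))%:E)%E.
Proof.
move=> s0 s1 a0 b0 f0 fq abf tan; have l2 := ln2_gt0 R.
have l2i : 0 < (ln 2)^-1 :> R by rewrite invr_gt0.
have ls : 0 <= - ln s by rewrite oppr_ge0 ln_le0.
rewrite /kl_term; have [q0|q0] := eqVneq q 0.
  have f1 : f = 0 by lra.
  have b1 : b = 0.
    (* Where q vanishes the tangent hypothesis reads b ln y <= v for every y > 0, which forces b =
       0. *)
    apply/eqP; rewrite eq_le b0 andbT leNgt; apply/negP => bp.
    have := tan _ (expR_gt0 ((v + 1) / b)).
    by rewrite expRK q0 mulr0 mulrCA divff ?gt_eqF// mulr1; lra.
  have a1 : a = 0 by lra.
  rewrite a1 eqxx lee_fin q0 f1 b1; apply: mulr_ge0; first exact: ltW.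
  by have := tan 1 ltr01; rewrite q0 b1; lra.
have qp : 0 < q by rewrite lt_neqAle eq_sym q0/= (le_trans f0).
pose rho := (b + f + s * q) / q.
have dq : 0 < b + f + s * q by rewrite ltr_wpDl ?addr_ge0// mulr_gt0.
have r0 : 0 < rho by rewrite divr_gt0.
have rq : rho * q = b + f + s * q by rewrite divfK.
have rs : s <= rho by rewrite ler_pdivlMr// lerDr addr_ge0.
have lrs : ln s <= ln rho by rewrite ler_ln ?posrE.
have main : a * ln rho <= v - q + b + f + s * q + f * - ln s + s * (b + f + s * q) +
     (b + f - a) * - ln s.
  have h1 : (b + f - a) * (- ln rho) <= (b + f - a) * (- ln s) by rewrite ler_wpM2l ?subr_ge0// lerN2.
  have h2 := tan _ r0; rewrite rq in h2.
  have h3 : ln rho <= - ln s + s * rho.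
    have := ln_le_sub1 (mulr_gt0 s0 r0); rewrite lnM ?posrE//; lra.
  have h4 : f * ln rho <= f * (- ln s + s * rho) by rewrite ler_wpM2l.
  have h5 : f * (s * rho) <= q * (s * rho) by rewrite ler_wpM2r// mulr_ge0// ltW.
  have h6 : q * (s * rho) = s * (b + f + s * q) by rewrite mulrCA (mulrC q) rq.
  lra.
have [a1|a1] := eqVneq a 0.
  rewrite lee_fin mulr_ge0 ?(ltW l2i)//; apply: le_trans main; by rewrite a1 mul0r.
have ap : 0 < a by rewrite lt_neqAle eq_sym a1.
rewrite lee_fin /log2 mulrA mulrC ler_pM2l//; apply: le_trans main.
rewrite ler_pM2l// ler_ln ?posrE ?divr_gt0// ler_pM2r ?invr_gt0//.
by apply: le_trans abf _; rewrite lerDl mulr_ge0// ltW.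
Qed.

(** On each cell [a] is the mass under the code, [b] that under the mixture of ideal laws, [f] the
    failure mass and [q] the null mass. The floor [s] for the likelihood ratio costs 3 s in total,
    and failure mass is charged 2 - 2 ln s per unit. *)
Lemma kl_sum_le (I : finType) (a b f q v : I -> R) (s eta V : R) : 0 < s -> s <= 1 ->
  (forall i, 0 <= a i) -> (forall i, 0 <= b i) -> (forall i, 0 <= f i) ->
  (forall i, f i <= q i) -> (forall i, a i <= b i + f i) ->
  (forall i y, 0 < y -> q i + b i * ln y <= v i + y * q i) ->
  \sum_i a i = 1 -> \sum_i b i = 1 -> \sum_i q i = 1 -> \sum_i f i = eta -> \sum_i v i = V ->
  (\sum_i kl_term (a i) (q i) <= ((ln 2)^-1 * (V + eta * (2 - 2 * ln s) + 3 * s))%:E)%E.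
Proof.
move=> s0 s1 a0 b0 f0 fq abf tan Sa Sb Sq Sf Sv.
apply: (le_trans (lee_sum _ (fun i _ => kl_term_le s0 s1 (a0 i) (b0 i) (f0 i) (fq i) (abf i) (tan i)))).
rewrite sumEFin lee_fin -mulr_sumr ler_pM2l ?invr_gt0 ?ln2_gt0//.
rewrite !big_split/= sumrN -!mulr_suml -!mulr_sumr !big_split/= sumrN -!mulr_sumr Sa Sb Sq Sf Sv.
have eta0 : 0 <= eta by rewrite -Sf sumr_ge0.
have : s * eta <= eta by rewrite ler_piMl.
have : s * s <= s by rewrite ler_piMl// ltW.
lra.
Qed.

End KlSum.

Section Indicators.
Context (R : realType) d d' (Om : measurableType d) (V : measurableType d') (P : probability Om R).

Lemma mean_indic (X : Om -> V) (A : set V) : measurable_fun setT X -> measurable A ->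
  mean P (fun w => \1_A (X w)) (fine (P (X @^-1` A))).
Proof.
move=> mX mA.
have mXA : measurable (X @^-1` A) by rewrite -[X in measurable X]setTI; exact: mX.
have e w : \1_A (X w) = \1_(X @^-1` A) w :> R by rewrite !indicE.
split.
- exact: measurableT_comp (measurable_indic mA) mX.
- by move=> w; rewrite indicE.
- under eq_integral do rewrite e.
  by rewrite integral_indic// setIT fineK// fin_num_measure.
Qed.

Lemma sum_indic k (A : 'I_k -> set V) : (forall i j, i != j -> A i `&` A j = set0) ->
  \bigcup_(i in [set: 'I_k]) A i = setT -> forall z, \sum_i \1_(A i) z = 1 :> R.
Proof.
move=> dA cA z; have : [set: V] z by []; rewrite -cA => -[i _ Az].
rewrite (bigD1 i)//= big1 => [|j ji]; first by rewrite addr0 indicE mem_set.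
rewrite indicE memNset// => Ajz.
by have /seteqP[/(_ z) + _] := dA _ _ ji; apply; split.
Qed.

End Indicators.

Section RelEntropyUpper.
Context (R : realType) d d' dF dX (Om : measurableType d) (V : measurableType d')
  (F : measurableType dF) (X : measurableType dX)
  (P : probability Om R) (ka : probability F R) (xi : probability X R).

(** The null law is represented twice because the mixture will have its density on the normalised
    output space, while the failure term lives on pairs of state and noise. Integrating over the
    cells of a partition reduces the claim to [kl_sum_le]. *)
Lemma rel_entropy_le (J : finType) (Z : J -> Om -> V) (mu nu : set V -> \bar R)
    (g : F -> V) (b : F -> R) (h : X -> V) (w : X -> R) (s eta v : R) :
  (0 < #|J|)%N -> 0 < s -> s <= 1 ->
  (forall j, measurable_fun setT (Z j)) ->
  (forall A, measurable A -> mu A = ((#|J|%:R^-1)%:E * \sum_j P (Z j @^-1` A))%E) ->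
  measurable_fun setT g -> (forall A, measurable A -> nu A = ka (g @^-1` A)) ->
  measurable_fun setT h -> (forall A, measurable A -> nu A = xi (h @^-1` A)) ->
  (forall z, 0 < b z) -> mean ka b 1 -> mean ka (fun z => phi (b z)) v ->
  (forall x, w x <= 1) -> mean xi w eta ->
  (forall A, measurable A ->
     (mu A <= \int[ka]_z (\1_A (g z) * b z)%:E + \int[xi]_x (\1_A (h x) * w x)%:E)%E) ->
  (rel_entropy mu nu <= ((ln 2)^-1 * (v + eta * (2 - 2 * ln s) + 3 * s))%:E)%E.
Proof.
move=> J0 s0 s1 mZ muE mg nuE mh nuE' b0 hb hv w1 hw dom.
have w0 x : 0 <= w x by case: hw.
have J0' : 0 < #|J|%:R :> R by rewrite ltr0n.
apply: ge_ereal_sup => _ [k [A [mA dA cA ->]]].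
have i0 (T : Type) (B : set T) x : 0 <= \1_B x :> R by rewrite indicE.
have i1 (T : Type) (B : set T) x : \1_B x <= 1 :> R by rewrite indicE lern1 leq_b1.
have sA := @sum_indic R _ _ k A dA cA.
have hq i := mean_indic ka mg (mA i).
have split_mean d1 (D : measurableType d1) (Q : probability D R) (u : D -> R) (c : R) (k' : D -> V) :
    measurable_fun setT k' -> mean Q u c ->
    exists e : 'I_k -> R, (forall i, mean Q (fun z => \1_(A i) (k' z) * u z) (e i)) /\ \sum_i e i = c.
  move=> mk hu; have [mu' u0 _] := hu.
  have ex i : exists e, mean Q (fun z => \1_(A i) (k' z) * u z) e.
    have [m1 _ _] := mean_indic Q mk (mA i).
    have [e he _] := mean_exists_le (measurable_funM m1 mu')
      (fun z => mulr_ge0 (i0 _ _ _) (u0 z)) hu (fun z => ler_piMl (u0 z) (i1 _ _ _)).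
    by exists e.
  have /cid[e eE] : exists e : 'I_k -> R, forall i, mean Q (fun z => \1_(A i) (k' z) * u z) (e i).
    by exists (fun i => projT1 (cid (ex i))) => i; exact: projT2 (cid _).
  exists e; split => //; apply: mean_uniq (mean_sum eE) _.
  by apply: mean_ext hu => z; rewrite -mulr_suml sA mul1r.
have [eb [hbi Sb]] := split_mean _ _ _ _ _ _ mg hb.
have [ev [hvi Sv]] := split_mean _ _ _ _ _ _ mg hv.
have [ef [hfi Sf]] := split_mean _ _ _ _ _ _ mh hw.
have muF i : mu (A i) = (#|J|%:R^-1 * \sum_j fine (P (Z j @^-1` A i)))%:E.
  rewrite muE// EFinM; congr (_ * _)%E; rewrite -sumEFin; apply: eq_bigr => j _.
  by rewrite fineK// fin_num_measure// -[X in measurable X]setTI; exact: mZ.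
have nuq i : fine (nu (A i)) = fine (ka (g @^-1` A i)) by rewrite nuE.
apply: (@kl_sum_le R _ _ eb ef _ ev s eta v) => //.
- by move=> i; rewrite muF mulr_ge0 ?invr_ge0 ?(ltW J0')// sumr_ge0// => j _; rewrite fine_ge0.
- by move=> i; exact: mean_ge0 (hbi i).
- by move=> i; exact: mean_ge0 (hfi i).
- move=> i; rewrite nuE'//; apply: mean_le (hfi i) (mean_indic xi mh (mA i)) _ => x.
  by rewrite ler_piMr.
- move=> i; have := dom _ (mA i); have [_ _ ->] := hbi i; have [_ _ ->] := hfi i.
  by rewrite muF lee_fin.
- move=> i y y0; rewrite nuq.
  have hqi := hq i; have tb z : \1_(A i) (g z) * (1 - y + b z * ln y) <= \1_(A i) (g z) * phi (b z).
    by rewrite ler_wpM2l// phi_tangent.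
  (* [mean] only handles nonnegative functions, so the term with ln y is moved to the side where its
     sign is positive. *)
  have [ly|ly] := lerP 0 (ln y).
    rewrite (mulrC (eb i)); apply: mean_le (meanD hqi (meanZ ly (hbi i))) (meanD (hvi i) (meanZ (ltW y0) hqi)) _ => z.
    by have := tb z; lra.
  have nl : 0 <= - ln y by lra.
  suff : fine (ka (g @^-1` A i)) <= ev i + y * fine (ka (g @^-1` A i)) + - ln y * eb i by lra.
  apply: mean_le hqi (meanD (meanD (hvi i) (meanZ (ltW y0) hqi)) (meanZ nl (hbi i))) _ => z.
  by have := tb z; lra.
- under eq_bigr do rewrite muF/=.
  rewrite -mulr_sumr exchange_big/=.
  rewrite (eq_bigr (fun=> 1)) => [|j _]; first by rewrite sumr_cst mulr1 mulVf// gt_eqF.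
  apply: mean_uniq (mean_sum (fun i => mean_indic P (mZ j) (mA i))) _.
  by apply: mean_ext (mean_cst P ler01) => z; rewrite sA.
- under eq_bigr do rewrite nuq.
  apply: mean_uniq (mean_sum hq) _.
  by apply: mean_ext (mean_cst ka ler01) => z; rewrite sA.
Qed.

End RelEntropyUpper.

(** * The stochastic encoder *)

Section Selector.
Context (R : realType) d (X : measurableType d) (L : nat) (p : 'I_L -> X -> R).
Hypothesis mp : forall l, measurable_fun setT (p l).
Hypothesis p0 : forall l x, 0 <= p l x.
Hypothesis p1 : forall x, \sum_l p l x <= 1.

Definition cumul (l : 'I_L) (x : X) : R := \sum_(l' < L | (l' < l)%N) p l' x.

(* Consecutive intervals of [0, 1] of lengths [p l x]. *)
Definition selected (l : 'I_L) (x : X) (t : R) : bool := cumul l x <= t < cumul l x + p l x.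

Lemma measurable_cumul l : measurable_fun setT (cumul l).
Proof.
rewrite /cumul; under eq_fun do rewrite big_mkcond/=.
by apply: measurable_sum => l'; case: (l' < l)%N.
Qed.

Lemma cumul_ge0 l x : 0 <= cumul l x.
Proof. by apply: sumr_ge0. Qed.

Lemma cumul_le1 l x : cumul l x + p l x <= 1.
Proof.
apply: le_trans (p1 x); rewrite addrC (bigD1 l)//= lerD2l.
rewrite /cumul big_mkcond [leRHS]big_mkcond/=; apply: ler_sum => i _.
case: ifPn => [il|_]; last by case: ifP.
by rewrite -val_eqE/= (ltn_eqF il).
Qed.

Lemma cumul_lt (l l' : 'I_L) x : (l < l')%N -> cumul l x + p l x <= cumul l' x.
Proof.
move=> ll; rewrite /cumul [leRHS](bigD1 l)//= [leLHS]addrC; apply: lerD => //.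
rewrite big_mkcond [leRHS]big_mkcond/=; apply: ler_sum => i _.
case: ifPn => [il|_]; last by case: ifP.
by rewrite (ltn_trans il ll)/= -val_eqE/= (ltn_eqF il).
Qed.

Lemma selected_uniq l l' x t : selected l x t -> selected l' x t -> l = l'.
Proof.
wlog ll : l l' / (l <= l')%N.
  by move=> H s1 s2; case: (leqP l l') => [/H|/ltnW /H/(_ s2 s1)]; [apply|].
move=> /andP[_ h1] /andP[h2 _]; apply/val_inj/eqP; rewrite eqn_leq ll leqNgt/=.
apply/negP => /(cumul_lt x) h3; have := lt_le_trans h1 (le_trans h3 h2).
by rewrite ltxx.
Qed.

Lemma measurable_selected l : measurable_fun setT (fun q : X * R => ((selected l q.1 q.2)%:R : R)).
Proof.
have mc := measurableT_comp (measurable_cumul l) (@measurable_fst _ _ X R).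
have mpl := measurableT_comp (mp l) (@measurable_fst _ _ X R).
have mb : measurable_fun setT (fun q : X * R => selected l q.1 q.2).
  apply: measurable_and; first by apply: measurable_fun_ler => //; msolve.
  by apply: measurable_fun_ltr; [msolve|exact: measurable_funD].
apply: (eq_measurable_fun (fun q : X * R => if selected l q.1 q.2 then 1 else 0 : R)) => [q _|].
  by case: selected.
exact: measurable_fun_if.
Qed.

Lemma sum_selected x t : \sum_l ((selected l x t)%:R : R) = ([exists l, selected l x t])%:R.
Proof.
case: (boolP [exists l, _]) => [/existsP[l sl]|/existsPn h].
  rewrite (bigD1 l)//= sl big1 ?addr0// => i il.
  by case: (boolP (selected i x t)) => // si; rewrite (selected_uniq si sl) eqxx in il.
by rewrite big1// => l _; rewrite (negbTE (h l)).
Qed.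

Lemma mean_selected l x : mean (uniformP R) (fun t => (selected l x t)%:R) (p l x).
Proof.
have := @mean_indic R _ _ R R (uniformP R) id `[cumul l x, cumul l x + p l x[%classic (@measurable_id _ _ _) _.
rewrite (_ : _ @^-1` _ = `[cumul l x, cumul l x + p l x[%classic)// uniformP_itv ?cumul_ge0 ?cumul_le1 ?lerDl//=.
rewrite addrAC subrr add0r => /(_ (measurable_itv _)).
apply: mean_ext => t; rewrite indicE /selected.
by congr (nat_of_bool _)%:R; apply/idP/idP; rewrite inE/= in_itv.
Qed.

Lemma mean_unselected x : mean (uniformP R) (fun t => 1 - \sum_l ((selected l x t)%:R : R)) (1 - \sum_l p l x).
Proof.
have hs := mean_sum (fun l => mean_selected l x); have [ms _ _] := hs.
have h1 t : \sum_l ((selected l x t)%:R : R) <= 1 by rewrite sum_selected lern1 leq_b1.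
have h0 t : 0 <= \sum_l ((selected l x t)%:R : R) by rewrite sumr_ge0.
have m1 : measurable_fun setT (fun t => 1 - \sum_l ((selected l x t)%:R : R)) by exact: measurable_funB.
have [b hb _] := mean_exists_le m1 (fun t => ltac:(by rewrite subr_ge0)) (mean_cst (uniformP R) ler01)
  (fun t => ltac:(by rewrite gerBl)).
suff -> : 1 - \sum_l p l x = b by [].
have := mean_uniq (mean_cst (uniformP R) ler01) (mean_ext (fun t => subrK (\sum_l ((selected l x t)%:R : R)) 1) (meanD hb hs)).
lra.
Qed.

Local Open Scope ereal_scope.

(** For a given t at most one index is selected, so the sum is the selected vector, or zero when t
    falls outside all intervals; the latter has probability 1 minus the total weight. *)
Lemma int_selected (n : nat) (x : X) (c : 'I_L -> n.-tuple R) (H : n.-tuple R -> \bar R) :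
  measurable_fun setT H -> (forall y, 0 <= H y) ->
  \int[uniformP R]_t H [tuple \sum_l (selected l x t)%:R * tnth (c l) i | i < n]%R <=
  \sum_l (p l x)%:E * H (c l) + (1 - \sum_l p l x)%:E * H [tuple 0%R | i < n].
Proof.
move=> mH H0.
have msel l : measurable_fun setT (fun t => (selected l x t)%:R : R).
  by have [] := mean_selected l x.
have mleft : measurable_fun setT (fun t : R => H [tuple \sum_l (selected l x t)%:R * tnth (c l) i | i < n]%R).
  apply: (measurableT_comp mH); apply: measurable_mktuple => i; apply: measurable_sum => l.
  by apply: measurable_funM.
have [mu u0 uE] := mean_unselected x.
have t0 l t : 0 <= ((selected l x t)%:R : R)%:E * H (c l) by rewrite mule_ge0// lee_fin.
have mt l : measurable_fun setT (fun t => ((selected l x t)%:R : R)%:E * H (c l)).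
  by apply: emeasurable_funM => //; exact/measurable_EFinP.
have mlast : measurable_fun setT (fun t => (1 - \sum_l ((selected l x t)%:R : R))%:E * H [tuple 0%R | i < n]).
  by apply: emeasurable_funM => //; exact/measurable_EFinP.
have intcst (f : R -> R) (e : R) (a : \bar R) : 0 <= a -> mean (uniformP R) f e ->
    \int[uniformP R]_t ((f t)%:E * a) = e%:E * a.
  move=> a0 [mf f0 fE]; under eq_integral do rewrite muleC.
  by rewrite intZe// ?fE 1?muleC//; exact/measurable_EFinP.
apply: (@le_trans _ _ (\int[uniformP R]_t (\sum_l ((selected l x t)%:R : R)%:E * H (c l) +
   (1 - \sum_l ((selected l x t)%:R : R))%:E * H [tuple 0%R | i < n]))).
  apply: int_le => //.
    by apply: emeasurable_funD => //; exact: emeasurable_sum.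
  move=> t; rewrite sum_selected; case: (boolP [exists l, _]) => [/existsP[l sl]|/existsPn h].
    rewrite subrr mul0e adde0 (bigD1 l)//= sl mul1e.
    have -> : [tuple (\sum_l (selected l x t)%:R * tnth (c l) i)%R | i < n] = c l.
      apply: eq_from_tnth => i; rewrite tnth_mktuple (bigD1 l)//= sl mul1r big1 ?addr0// => l' ll.
      by case: (boolP (selected l' x t)) => [sl'|_]; [rewrite (selected_uniq sl' sl) eqxx in ll|rewrite mul0r].
    by rewrite leeDl// sume_ge0.
  rewrite subr0 mul1e.
  have -> : [tuple (\sum_l (selected l x t)%:R * tnth (c l) i)%R | i < n] = [tuple 0%R | i < n].
    by apply: eq_from_tnth => i; rewrite !tnth_mktuple big1// => l _; rewrite (negbTE (h l)) mul0r.
  by rewrite leeDr// sume_ge0.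
rewrite intD//; last 3 first.
- exact: emeasurable_sum.
- by move=> t; exact: sume_ge0.
- by move=> t; rewrite mule_ge0// lee_fin.
rewrite int_sum//; rewrite (intcst _ _ _ (H0 _) (mean_unselected x)).
by rewrite (eq_bigr (fun l => (p l x)%:E * H (c l)))// => l _; exact: intcst (mean_selected l x).
Qed.

End Selector.

Section Encoder.
Local Open Scope ereal_scope.
Context (R : realType) (d : measure_display) (Om : measurableType d)
  (P : probability Om R) (T sig2 : R) (S NY NZ : nat -> Om -> R) (U : Om -> R).
Hypothesis T0 : (0 < T)%R.
Hypothesis sig0 : (0 < sig2)%R.
Hypothesis model : gaussian_state_model P T sig2 S NY NZ U.
Variables (n L : nat) (rhoS cB cS : R).
Hypothesis L0 : (0 < L)%N.
Hypothesis rhoS1 : (rhoS ^+ 2 < 1)%R.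
Local Notation vec := (n.-tuple R).
Local Notation g := (gaussn R n).
Local Notation sqT := (Num.sqrt T).

Definition vscale (c : R) (s : vec) : vec := [tuple c * tnth s i | i < n]%R.
Definition vinput (u s : vec) : vec := [tuple cB * tnth u i - cS * tnth s i | i < n]%R.
Definition vadd3 (x s w : vec) : vec := [tuple tnth x i + tnth s i + tnth w i | i < n]%R.

Lemma measurable_vscale d1 (D : measurableType d1) c (s : D -> vec) :
  measurable_fun setT s -> measurable_fun setT (fun x => vscale c (s x)).
Proof.
move=> ms; apply: measurable_mktuple => i.
by apply: measurable_funM => //; exact: (measurableT_comp (measurable_tnth i) ms).
Qed.

Lemma measurable_vinput d1 (D : measurableType d1) (u s : D -> vec) :
  measurable_fun setT u -> measurable_fun setT s -> measurable_fun setT (fun x => vinput (u x) (s x)).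
Proof.
move=> mu ms; apply: measurable_mktuple => i; apply: measurable_funB; apply: measurable_funM => //.
  exact: (measurableT_comp (measurable_tnth i) mu).
exact: (measurableT_comp (measurable_tnth i) ms).
Qed.

Lemma measurable_vadd3 d1 (D : measurableType d1) (x s w : D -> vec) :
  measurable_fun setT x -> measurable_fun setT s -> measurable_fun setT w ->
  measurable_fun setT (fun q => vadd3 (x q) (s q) (w q)).
Proof.
move=> mx ms mw; apply: measurable_mktuple => i.
have mt (f : D -> vec) : measurable_fun setT f -> measurable_fun setT (fun q => tnth (f q) i).
  by move=> mf; exact: (measurableT_comp (measurable_tnth i) mf).
by apply: measurable_funD; [apply: measurable_funD|]; exact: mt.
Qed.

Lemma vscaleK s : vscale sqT^-1 (vscale sqT s) = s.
Proof.
apply: eq_from_tnth => i; rewrite !tnth_mktuple mulKf//.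
by rewrite gt_eqF// sqrtr_gt0.
Qed.

Definition noise_avg (b : bool) (F : vec -> vec -> vec -> \bar R) (x s : vec) : \bar R :=
  \int[g]_w F x (vscale sqT s) (vscale (noise_std sig2 b) w).

Section OneCell.
Variable u : 'I_L -> vec.

Definition avg_density (s : vec) : R := (L%:R^-1 * \sum_l expR (nidens rhoS (u l) s))%R.

(** With [avg_density] alone in place of the maximum this would be the exact posterior. The maximum
    keeps each weight below 1 / L times the density, hence the law of the code below the ideal joint
    law up to failure; what is lost is [deficit], positive only where the codewords cover the state
    too thinly. *)
Definition weight (l : 'I_L) (s : vec) : R :=
  (expR (nidens rhoS (u l) s) / (L%:R * Num.max 1 (avg_density s)))%R.

(** The state is rescaled to unit variance. If no index is selected, all terms vanish and the
    no-input vector 0 is sent. *)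
Definition encode (q : vec * R) : vec :=
  [tuple \sum_l (selected weight l (vscale sqT^-1 q.1) q.2)%:R *
     tnth (vinput (u l) (vscale sqT^-1 q.1)) i | i < n]%R.

Let LR0 : (0 < L%:R :> R)%R. Proof. by rewrite ltr0n. Qed.

Lemma max1_gt0 (x : R) : (0 < Num.max 1 x)%R.
Proof. by rewrite lt_max ltr01. Qed.

Lemma measurable_avg_density : measurable_fun setT avg_density.
Proof.
apply: measurable_funM => //; apply: measurable_sum => l.
by apply: measurable_expR_comp; apply: measurable_nidens2.
Qed.

Lemma measurable_weight l : measurable_fun setT (weight l).
Proof.
apply: (measurable_fun_div_gt0 (f := fun s => expR (nidens rhoS (u l) s))
  (g := fun s => L%:R * Num.max 1 (avg_density s))%R).
- by move=> x; exact: expR_gt0.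
- by move=> x; rewrite mulr_gt0// max1_gt0.
- by apply: measurable_expR_comp; apply: measurable_nidens2.
- apply: measurable_funM => //; apply: measurable_maxr => //; exact: measurable_avg_density.
Qed.

Lemma weight_ge0 l s : (0 <= weight l s)%R.
Proof. by rewrite divr_ge0 ?expR_ge0// ltW// mulr_gt0// max1_gt0. Qed.

Lemma sum_weight s : (\sum_l weight l s = avg_density s / Num.max 1 (avg_density s))%R.
Proof. by rewrite -mulr_suml invfM mulrA [X in (X / _)%R]mulrC. Qed.

Lemma avg_density_ge0 s : (0 <= avg_density s)%R.
Proof. by rewrite mulr_ge0 ?invr_ge0// sumr_ge0// => l _; exact: expR_ge0. Qed.

Lemma sum_weight_le1 s : (\sum_l weight l s <= 1)%R.
Proof. by rewrite sum_weight ler_pdivrMr ?max1_gt0// mul1r le_max lexx orbT. Qed.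

Lemma sub_sum_weight s : (1 - \sum_l weight l s = Num.max 0 (1 - avg_density s))%R.
Proof.
rewrite sum_weight; set a := avg_density s; have a0 : (0 <= a)%R by exact: avg_density_ge0.
have [a1|a1] := lerP 1 a.
  rewrite divff ?subrr; last by rewrite gt_eqF// (lt_le_trans ltr01).
  by rewrite max_l// subr_le0.
by rewrite divr1 max_r// subr_ge0 ltW.
Qed.

Lemma weight_le l s : (weight l s <= L%:R^-1 * expR (nidens rhoS (u l) s))%R.
Proof.
rewrite /weight mulrC ler_wpM2r ?expR_ge0// lef_pV2 ?posrE ?mulr_gt0 ?max1_gt0//.
by rewrite ler_peMr ?(ltW LR0)// le_max lexx.
Qed.

Lemma measurable_encode : measurable_fun setT encode.
Proof.
have m1 : measurable_fun setT (fun q : vec * R => vscale sqT^-1 q.1).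
  by apply: measurable_vscale; exact: measurable_fst.
apply: measurable_mktuple => i; apply: measurable_sum => l; apply: measurable_funM.
  have ms := measurable_selected measurable_weight l.
  have mp : measurable_fun setT (fun q : vec * R => (vscale sqT^-1 q.1, q.2)).
    by apply: measurable_fun_pair => //; exact: measurable_snd.
  exact: (measurableT_comp ms mp).
apply: (measurableT_comp (measurable_tnth i)).
by apply: measurable_vinput.
Qed.

(** The private randomness is integrated out for a fixed state by [int_selected]; [weight_le] then
    replaces the weights by the ideal joint density and [sub_sum_weight] identifies the failure
    term. *)
Lemma encode_law (b : bool) (F : vec -> vec -> vec -> \bar R) :
  measurable_fun setT (fun q : vec * vec * vec => F q.1.1 q.1.2 q.2) ->
  (forall x s w, 0 <= F x s w) ->
  \int[P]_o F (encode (Sn S n o, U o)) (Sn S n o) [tuple noise NY NZ b i o | i < n] <=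
  \sum_l (L%:R^-1)%:E * \int[g]_s ((expR (nidens rhoS (u l) s))%:E * noise_avg b F (vinput (u l) s) s) +
  \int[g]_s ((Num.max 0 (1 - avg_density s))%R%:E * noise_avg b F [tuple 0%R | i < n] s).
Proof.
move=> mF F0; set H := noise_avg b F.
have mFc d1 (D : measurableType d1) (x s w : D -> vec) : measurable_fun setT x -> measurable_fun setT s ->
   measurable_fun setT w -> measurable_fun setT (fun q => F (x q) (s q) (w q)).
  by move=> mx ms mw; exact: (measurable_fun3 mF).
have mfst1 d1 d2 d3 (D1 : measurableType d1) (D2 : measurableType d2) (D3 : measurableType d3) :
   measurable_fun setT (fun q : D1 * D2 * D3 => q.1.1).
  exact: (measurableT_comp (@measurable_fst _ _ D1 D2) (@measurable_fst _ _ _ D3)).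
have msnd1 d1 d2 d3 (D1 : measurableType d1) (D2 : measurableType d2) (D3 : measurableType d3) :
   measurable_fun setT (fun q : D1 * D2 * D3 => q.1.2).
  exact: (measurableT_comp (@measurable_snd _ _ D1 D2) (@measurable_fst _ _ _ D3)).
have H0 x s : 0 <= H x s by exact: integral_ge0.
have mH : measurable_fun setT (fun q : vec * vec => H q.1 q.2).
  apply: (measurable_int1 g (f := fun q w => F q.1 (vscale sqT q.2) (vscale (noise_std sig2 b) w))) => //.
  by apply: mFc; [exact: mfst1|apply: measurable_vscale; exact: msnd1|apply: measurable_vscale; exact: measurable_snd].
have mHc d1 (D : measurableType d1) (x s : D -> vec) : measurable_fun setT x -> measurable_fun setT s ->
   measurable_fun setT (fun q => H (x q) (s q)).
  by move=> mx ms; exact: (measurable_fun2 mH).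
have mE := measurable_encode.
rewrite (model_law_std T0 sig0 model b (F := fun s t w => F (encode (s, t)) s w)); last 2 first.
- apply: mFc; [|exact: mfst1|exact: measurable_snd].
  by apply: (measurableT_comp mE); apply: measurable_fun_pair; [exact: mfst1|exact: msnd1].
- by [].
apply: (@le_trans _ _ (\int[g]_s \int[uniformP R]_t H (encode (vscale sqT s, t)) s)); first exact: lexx.
have mw l := measurable_weight l.
have md : measurable_fun setT (fun s => Num.max 0 (1 - avg_density s))%R.
  by apply: measurable_maxr => //; apply: measurable_funB => //; exact: measurable_avg_density.
have d0 s : (0 <= Num.max 0 (1 - avg_density s))%R by rewrite le_max lexx.
have mHl l : measurable_fun setT (fun s => H (vinput (u l) s) s).
  by apply: mHc => //; apply: measurable_vinput.
have mH1 : measurable_fun setT (fun s => H [tuple 0%R | i < n] s) by exact: mHc.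
have me l : measurable_fun setT (fun s => (expR (nidens rhoS (u l) s))%:E * H (vinput (u l) s) s).
  apply: emeasurable_funM => //; apply/measurable_EFinP; apply: measurable_expR_comp.
  by apply: measurable_nidens2.
have me0 l s : 0 <= (expR (nidens rhoS (u l) s))%:E * H (vinput (u l) s) s.
  by rewrite mule_ge0// lee_fin expR_ge0.
have Li : 0 <= (L%:R^-1 : R)%:E by rewrite lee_fin invr_ge0 ltW.
have mr : measurable_fun setT (fun s => \sum_l (L%:R^-1)%:E * ((expR (nidens rhoS (u l) s))%:E * H (vinput (u l) s) s)).
  by apply: emeasurable_sum => l; apply: emeasurable_funM.
have ml : measurable_fun setT (fun s => (Num.max 0 (1 - avg_density s))%R%:E * H [tuple 0%R | i < n] s).
  by apply: emeasurable_funM => //; exact/measurable_EFinP.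
apply: (@le_trans _ _ (\int[g]_s (\sum_l (L%:R^-1)%:E * ((expR (nidens rhoS (u l) s))%:E * H (vinput (u l) s) s) +
   (Num.max 0 (1 - avg_density s))%R%:E * H [tuple 0%R | i < n] s))); last first.
  rewrite intD//; last 2 first.
  - by move=> s; apply: sume_ge0 => l _; exact: mule_ge0.
  - by move=> s; rewrite mule_ge0// lee_fin.
  rewrite int_sum; last 2 first.
  - by move=> l; apply: emeasurable_funM.
  - by move=> l s; exact: mule_ge0.
  apply: leeD => //; rewrite le_eqVlt; apply/orP; left; apply/eqP; apply: eq_bigr => l _.
  by rewrite intZe.
apply: int_le.
- apply: (measurable_int1 (uniformP R) (f := fun s t => H (encode (vscale sqT s, t)) s)) => //.
  apply: mHc; last exact: measurable_fst.
  apply: (measurableT_comp mE); apply: measurable_fun_pair; last exact: measurable_snd.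
  by apply: measurable_vscale; exact: measurable_fst.
- exact: emeasurable_funD.
- by move=> s; exact: integral_ge0.
move=> s.
have := @int_selected R _ _ L weight weight_ge0 sum_weight_le1 n s (fun l => vinput (u l) s) (H^~ s).
have mHs : measurable_fun setT (H^~ s) by exact: mHc.
move=> /(_ mHs (fun=> H0 _ _)) h.
apply: (@le_trans _ _ (\sum_l (weight l s)%:E * H (vinput (u l) s) s +
   (1 - \sum_l weight l s)%R%:E * H [tuple 0%R | i < n] s)).
  apply: le_trans h; rewrite le_eqVlt; apply/orP; left; apply/eqP; apply: eq_integral => t _.
  by congr (H _ s); apply: eq_from_tnth => i; rewrite !tnth_mktuple/= vscaleK.
rewrite sub_sum_weight; apply: leeD => //; apply: lee_sum => l _.
by rewrite muleA -EFinM; apply: lee_wpmul2r => //; rewrite lee_fin weight_le.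
Qed.

Definition deficit (s : vec) : R := Num.max 0%R (1 - avg_density s)%R.

Lemma measurable_deficit : measurable_fun setT deficit.
Proof.
by apply: measurable_maxr => //; apply: measurable_funB => //; exact: measurable_avg_density.
Qed.

Lemma deficit_ge0 s : (0 <= deficit s)%R.
Proof. by rewrite le_max lexx. Qed.

Lemma deficit_le1 s : (deficit s <= 1)%R.
Proof. by rewrite ge_max ler01 gerBl avg_density_ge0. Qed.

Definition null_output (b : bool) (s w : vec) : vec :=
  [tuple sqT * tnth s i + noise_std sig2 b * tnth w i | i < n]%R.

(** In the ideal term [nidens_channel] with p = cB and q = sqrt T - cS merges state and noise into
    one normalised output of correlation [rho] with the codeword; the failure term is the output
    without input. *)
Lemma encode_channel (b : bool) (rho V : R) (f : vec -> \bar R) :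
  (0 < V)%R -> (rho ^+ 2 < 1)%R ->
  (cB + (sqT - cS) * rhoS = rho * V)%R ->
  ((sqT - cS) ^+ 2 * (1 - rhoS ^+ 2) + noise_std sig2 b ^+ 2 = V ^+ 2 * (1 - rho ^+ 2))%R ->
  measurable_fun setT f -> (forall y, 0 <= f y) ->
  \int[P]_o f (vadd3 (encode (Sn S n o, U o)) (Sn S n o) [tuple noise NY NZ b i o | i < n]) <=
  (\sum_l (L%:R^-1)%:E * \int[g]_z ((expR (nidens rho (u l) z))%:E * f (vscale V z))) +
  \int[g]_s \int[g]_w ((deficit s)%:E * f (null_output b s w)).
Proof.
move=> V0 r1 e1 e2 mf f0.
have v0 : (0 < noise_std sig2 b)%R by exact: noise_std_gt0.
have mF : measurable_fun setT (fun q : vec * vec * vec => f (vadd3 q.1.1 q.1.2 q.2)).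
  apply: (measurableT_comp mf); apply: measurable_vadd3; last exact: measurable_snd.
    exact: (measurableT_comp (@measurable_fst _ _ vec vec) (@measurable_fst _ _ _ vec)).
  exact: (measurableT_comp (@measurable_snd _ _ vec vec) (@measurable_fst _ _ _ vec)).
have mc d1 (D : measurableType d1) (x s w : D -> vec) : measurable_fun setT x -> measurable_fun setT s ->
   measurable_fun setT w -> measurable_fun setT (fun q => f (vadd3 (x q) (s q) (w q))).
  by move=> mx ms mw; apply: (measurableT_comp mf); exact: measurable_vadd3.
apply: le_trans (encode_law b mF (fun _ _ _ => f0 _)) _.
apply: leeD.
  apply: lee_sum => l _; apply: lee_wpmul2l; first by rewrite lee_fin invr_ge0.
  rewrite -(nidens_channel (u l) v0 V0 rhoS1 r1 e1 e2 mf f0).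
  rewrite le_eqVlt; apply/orP; left; apply/eqP; apply: eq_integral => s _.
  rewrite -intZe ?lee_fin ?expR_ge0//.
    apply: eq_integral => w _; congr (_ * f _); apply: eq_from_tnth => i.
    by rewrite !tnth_mktuple; ring.
  by apply: mc => //; exact: measurable_vscale.
rewrite le_eqVlt; apply/orP; left; apply/eqP; apply: eq_integral => s _.
rewrite -intZe ?lee_fin ?deficit_ge0//.
  apply: eq_integral => w _; congr (_ * f _); apply: eq_from_tnth => i.
  by rewrite !tnth_mktuple add0r.
by apply: mc => //; exact: measurable_vscale.
Qed.

Definition energy (x : vec) : R := (n%:R^-1 * \sum_(i < n) tnth x i ^+ 2)%R.

Lemma energy_ge0 x : (0 <= energy x)%R.
Proof. by rewrite mulr_ge0 ?invr_ge0// sumr_ge0// => i _; exact: sqr_ge0. Qed.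

Lemma measurable_energy : measurable_fun setT energy.
Proof. by rewrite /energy; msolve. Qed.

(** Failure contributes no energy, as the input is then 0. *)
Lemma encode_power :
  \int[P]_o (energy (encode (Sn S n o, U o)))%:E <=
  \sum_l (L%:R^-1)%:E * \int[g]_s ((expR (nidens rhoS (u l) s))%:E * (energy (vinput (u l) s))%:E).
Proof.
have mF : measurable_fun setT (fun q : vec * vec * vec => (energy q.1.1)%:E).
  apply/measurable_EFinP; apply: (measurableT_comp measurable_energy).
  exact: (measurableT_comp (@measurable_fst _ _ vec vec) (@measurable_fst _ _ _ vec)).
have H x s : noise_avg true (fun x _ _ => (energy x)%:E) x s = (energy x)%:E.
  exact: int_prob_cst.
have h0 (x s w : vec) : 0 <= (energy x)%:E by rewrite lee_fin energy_ge0.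
have := @encode_law true (fun x _ _ => (energy x)%:E) mF h0.
under eq_bigr do under eq_integral do rewrite H.
under [X in _ + X]eq_integral do rewrite H.
move=> /le_trans; apply; rewrite [X in _ + X]integral0_eq ?adde0// => s _.
rewrite /energy big1 ?mulr0 ?mule0// => i _.
by rewrite tnth_mktuple expr0n.
Qed.

End OneCell.

Lemma null_law (f : vec -> \bar R) : measurable_fun setT f -> (forall y, 0 <= f y) ->
  \int[P]_o f [tuple S i o + NZ i o | i < n]%R = \int[g]_s \int[g]_w f (null_output false s w).
Proof.
move=> mf f0.
have mF : measurable_fun setT (fun p : vec * R * vec => f [tuple tnth p.1.1 i + tnth p.2 i | i < n]%R).
  apply: (measurableT_comp mf); apply: measurable_mktuple => i; apply: measurable_funD.
    apply: (measurableT_comp (measurable_tnth i)).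
    exact: (measurableT_comp (@measurable_fst _ _ vec R) (@measurable_fst _ _ _ vec)).
  by apply: (measurableT_comp (measurable_tnth i)); exact: measurable_snd.
have := @model_law_std _ _ _ _ _ _ _ _ _ _ T0 sig0 model false n
  (fun s _ w => f [tuple tnth s i + tnth w i | i < n]%R) mF (fun _ _ _ => f0 _).
under eq_integral => o _.
  rewrite (_ : [tuple _ | i < n] = [tuple S i o + NZ i o | i < n]%R); last first.
    by apply: eq_from_tnth => i; rewrite !tnth_mktuple.
  over.
move=> ->; apply: eq_integral => s _; rewrite int_prob_cst; apply: eq_integral => w _.
by congr f; apply: eq_from_tnth => i; rewrite !tnth_mktuple.
Qed.

Lemma null_output_law b (f : vec -> \bar R) : measurable_fun setT f -> (forall y, 0 <= f y) ->
  \int[g]_s \int[g]_w f (null_output b s w) =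
  \int[g]_z f (vscale (Num.sqrt (T + noise_std sig2 b ^+ 2)) z).
Proof.
move=> mf f0; have := gaussn_conv sqT (noise_std_gt0 sig0 b) mf f0.
by rewrite sqr_sqrtr// ltW.
Qed.

End Encoder.

(** * Codes built from a codebook *)

Section Code.
Local Open Scope ereal_scope.
Context (R : realType) (d : measure_display) (Om : measurableType d)
  (P : probability Om R) (T sig2 : R) (S NY NZ : nat -> Om -> R) (U : Om -> R).
Hypothesis T0 : (0 < T)%R.
Hypothesis sig0 : (0 < sig2)%R.
Hypothesis model : gaussian_state_model P T sig2 S NY NZ U.
Variables (n L NM NK : nat) (rhoS cB cS : R) (rho : bool -> R) (th : R).
Hypothesis n0 : (0 < n)%N.
Hypothesis L0 : (0 < L)%N.
Hypothesis NM0 : (0 < NM)%N.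
Hypothesis NK0 : (0 < NK)%N.
Hypothesis rhoS1 : (rhoS ^+ 2 < 1)%R.
Local Notation vec := (n.-tuple R).
Local Notation g := (gaussn R n).
Local Notation sqT := (Num.sqrt T).
Local Notation J3 := ('I_NM * 'I_NK * 'I_L)%type.
Local Notation J2 := ('I_NM * 'I_NK)%type.

Definition out_std (b : bool) : R := Num.sqrt (T + noise_std sig2 b ^+ 2).

Lemma out_std_gt0 b : (0 < out_std b)%R.
Proof. by rewrite sqrtr_gt0 ltr_pwDl// sqr_ge0. Qed.

Hypothesis rho1 : forall b, (rho b ^+ 2 < 1)%R.
(** Correlation with the codeword and conditional variance of the ideal output, when it is
    normalised by [out_std], the standard deviation of the output without input. For [b = false]
    this says that the ideal law already looks like the null law to the warden. *)
Hypothesis match1 : forall b, (cB + (sqT - cS) * rhoS = rho b * out_std b)%R.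
Hypothesis match2 : forall b, ((sqT - cS) ^+ 2 * (1 - rhoS ^+ 2) + noise_std sig2 b ^+ 2 =
  out_std b ^+ 2 * (1 - rho b ^+ 2))%R.

Variable cb : J3 -> vec.

Definition hit (k : 'I_NK) (y : vec) (m : 'I_NM) : bool :=
  [exists l : 'I_L, th < nidens (rho true) (cb (m, k, l)) (vscale (out_std true)^-1 y)]%R.

(** Any message that is hit will do; without a hit the message of index 0 is returned. *)
Definition pick_message (h : 'I_NM -> bool) : 'I_NM := odflt (Ordinal NM0) [pick m | h m].

Definition decode (k : 'I_NK) (y : vec) : 'I_NM := pick_message (hit k y).

Lemma measurable_hit k m : measurable [set y | hit k y m].
Proof.
have -> : [set y | hit k y m] = \bigcup_(l in [set: 'I_L])
    [set y | th < nidens (rho true) (cb (m, k, l)) (vscale (out_std true)^-1 y)]%R.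
  apply/seteqP; split => y /=; first by move=> /existsP[l h]; exists l.
  by move=> [l _ h]; apply/existsP; exists l.
apply: fin_bigcup_measurable => // l _.
have mi : measurable_fun setT (fun y => nidens (rho true) (cb (m, k, l)) (vscale (out_std true)^-1 y)).
  by apply: measurable_nidens2 => //; exact: measurable_vscale.
have := mi measurableT _ (measurable_itv `]th, +oo[); rewrite setTI.
by congr measurable; apply/seteqP; split => y; rewrite /= in_itv/= andbT.
Qed.

Lemma measurable_decode k m : measurable [set y | decode k y = m].
Proof.
have pE (h1 h2 : 'I_NM -> bool) : h1 =1 h2 -> pick_message h1 = pick_message h2.
  by move=> e; rewrite /pick_message (eq_pick e).
(* The decoder sees [y] only through the finite pattern of hits, so the preimage is a finite union
   over patterns. *)
have -> : [set y | decode k y = m] = \bigcup_(f in [set f : {ffun 'I_NM -> bool} | pick_message f = m])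
    \bigcap_(m' in [set: 'I_NM]) [set y | hit k y m' = f m'].
  apply/seteqP; split => y /=.
    move=> h; exists [ffun m' => hit k y m'] => /=.
      by rewrite -h /decode; apply: pE => m'; rewrite ffunE.
    by move=> m' _ /=; rewrite ffunE.
  by move=> [f /= <- h]; rewrite /decode; apply: pE => m'; exact: (h m').
apply: fin_bigcup_measurable => [|f _]; first exact: finite_finset.
apply: fin_bigcap_measurable => // m' _.
have mh := measurable_hit k m'.
case: (f m'); first by [].
have -> : [set y | hit k y m' = false] = ~` [set y | hit k y m'].
  by apply/seteqP; split => y /=; case: (hit k y m').
exact: measurableC.
Qed.

Lemma measurable_cell m k : measurable_fun setT (encode T rhoS cB cS (fun l => cb (m, k, l))).
Proof. exact: measurable_encode. Qed.

Definition codebook_code : @nc_code R n NM NK := NcCode measurable_cell measurable_decode.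

Local Notation N2 := ((NM * NK)%:R : R).
Local Notation N3 := (#|{: J3}|%:R : R).

Lemma card_J3 : N3 = (N2 * L%:R)%R.
Proof. by rewrite !card_prod !card_ord natrM. Qed.

Lemma avg_J3 (f : J3 -> \bar R) : (forall j, 0 <= f j) ->
  (N2^-1)%:E * (\sum_(j : J2) \sum_(l < L) (L%:R^-1)%:E * f (j, l)) =
  (N3^-1)%:E * \sum_(j : J3) f j.
Proof.
move=> f0; have -> : \sum_(j : J3) f j = \sum_(j : J2) \sum_(l < L) f (j, l).
  by rewrite pair_bigA; apply: eq_bigr => -[].
rewrite card_J3 invfM EFinM -muleA; congr (_ * _).
rewrite ge0_sume_distrr; last by move=> j _; exact: sume_ge0.
by apply: eq_bigr => j _; rewrite ge0_sume_distrr.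
Qed.

Lemma avg_J2_le (p : 'I_NM -> 'I_NK -> \bar R) (f : J3 -> \bar R) (h : J2 -> \bar R) :
  (forall j, 0 <= f j) -> (forall j, 0 <= h j) ->
  (forall m k, p m k <= (\sum_(l < L) (L%:R^-1)%:E * f (m, k, l)) + h (m, k)) ->
  avg_mk p <= (N3^-1)%:E * (\sum_(j : J3) f j) + (N2^-1)%:E * \sum_(j : J2) h j.
Proof.
move=> f0 h0 ph.
have i0 : 0 <= (N2^-1)%:E :> \bar R by rewrite lee_fin invr_ge0.
have t0 (j : J2) l : 0 <= (L%:R^-1 : R)%:E * f (j, l) by rewrite mule_ge0// lee_fin invr_ge0.
rewrite avg_mkE -avg_J3// -ge0_muleDr//; last 2 first.
- by apply: sume_ge0 => j _; exact: sume_ge0.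
- exact: sume_ge0.
apply: lee_wpmul2l => //; rewrite -big_split/=; apply: lee_sum => -[m k] _; exact: ph.
Qed.

Lemma code_power : avg_power P S U codebook_code <=
  (N3^-1)%:E * \sum_(j : J3) \int[g]_s ((expR (nidens rhoS (cb j) s))%:E *
    (energy (vinput cB cS (cb j) s))%:E).
Proof.
have e0 (x : vec) : (0 <= energy x)%R by exact: energy_ge0.
apply: le_trans (avg_J2_le (f := fun j => \int[g]_s ((expR (nidens rhoS (cb j) s))%:E *
    (energy (vinput cB cS (cb j) s))%:E)) (h := fun=> 0) _ _ _) _ => //.
- by move=> j; apply: integral_ge0 => s _; rewrite mule_ge0// lee_fin// expR_ge0.
- by move=> m k; rewrite adde0; exact: (encode_power T0 sig0 model rhoS cB cS L0 (fun l => cb (m, k, l))).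
- by rewrite [X in _ + _ * X]big1// mule0 adde0.
Qed.

Local Notation IY := (nidens (rho true)).

(** Exponential majorants of two indicators: the sent codeword misses the threshold, or a codeword
    of another message with the same key exceeds it. *)
Lemma decode_error k m l (y : vec) (e : R) : (0 <= e)%R ->
  ((decode k y != m)%:R <= expR (e * (th - IY (cb (m, k, l)) (vscale (out_std true)^-1 y))) +
    \sum_(i : J3 | (i.1.1 != m) && (i.1.2 == k)) expR (IY (cb i) (vscale (out_std true)^-1 y) - th) :> R)%R.
Proof.
move=> e0; set z := vscale _ y.
have s0 : (0 <= \sum_(i : J3 | (i.1.1 != m) && (i.1.2 == k)) expR (IY (cb i) z - th) :> R)%R.
  by apply: sumr_ge0 => i _; exact: expR_ge0.
case: (eqVneq (decode k y) m) => [_|dm] /=; first by rewrite addr_ge0// expR_ge0.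
have [hm|hm] := boolP (hit k y m); last first.
  move/existsPn: hm => /(_ l); rewrite -leNgt -/z => h.
  apply: ler_wpDr => //; rewrite -expR0 ler_expR mulr_ge0// subr_ge0//.
have [m' m'm hm'] : exists2 m', m' != m & hit k y m'.
  move: dm; rewrite /decode /pick_message; case: pickP => [m' h' h|/(_ m)]; first by exists m'.
  by rewrite hm.
have /existsP[l' h'] := hm'.
apply: ler_wpDl; first exact: expR_ge0.
rewrite (bigD1 (m', k, l'))/= ?m'm ?eqxx//; apply: ler_wpDr.
  by apply: sumr_ge0 => i _; exact: expR_ge0.
by rewrite -expR0 ler_expR subr_ge0 ltW.
Qed.

Lemma sqrt_inv_vscale b (z : vec) : vscale (out_std b)^-1 (vscale (out_std b) z) = z.
Proof.
apply: eq_from_tnth => i; rewrite !tnth_mktuple mulKf//.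
by rewrite gt_eqF// out_std_gt0.
Qed.

Lemma measurable_out b m k : measurable_fun setT (fun o => vadd3 (Xn S U codebook_code m k o) (Sn S n o)
  [tuple noise NY NZ b i o | i < n]).
Proof.
have mS := @measurable_Sn _ _ _ _ _ _ _ _ _ _ model n; have mU := measurable_U model.
apply: measurable_vadd3 => //.
  by apply: (measurableT_comp (measurable_cell m k)); exact: measurable_fun_pair.
by apply: measurable_mktuple => i; exact: (measurable_noise model).
Qed.

Local Notation cell_deficit j := (deficit rhoS (fun l => cb (j, l))).

Lemma deficit_int_le b j (f : vec -> \bar R) : measurable_fun setT f -> (forall y, 0 <= f y) ->
  (forall y, f y <= 1) ->
  \int[g]_s \int[g]_w ((cell_deficit j s)%:E * f (null_output T sig2 b s w)) <= \int[g]_s (cell_deficit j s)%:E.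
Proof.
move=> mf f0 f1.
have md : measurable_fun setT (cell_deficit j) by exact: measurable_deficit.
have d0 s : 0 <= (cell_deficit j s)%:E by rewrite lee_fin deficit_ge0.
have mn : measurable_fun setT (fun p : vec * vec => null_output T sig2 b p.1 p.2).
  by apply: measurable_mktuple => i; msolve.
have mF : measurable_fun setT (fun p : vec * vec => (cell_deficit j p.1)%:E * f (null_output T sig2 b p.1 p.2)).
  apply: emeasurable_funM; last exact: (measurableT_comp mf mn).
  by apply/measurable_EFinP; apply: (measurableT_comp md); exact: measurable_fst.
have F0 s w : 0 <= (cell_deficit j s)%:E * f (null_output T sig2 b s w) by exact: mule_ge0.
apply: int_le.
- exact: (measurable_int1 g (f := fun s w => (cell_deficit j s)%:E * f (null_output T sig2 b s w))).
- exact/measurable_EFinP.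
- by move=> s; exact: integral_ge0.
move=> s; rewrite -[leRHS](int_prob_cst g); apply: int_le => //.
  exact: (measurable_app1 (f := fun s w => (cell_deficit j s)%:E * f (null_output T sig2 b s w)) mF).
by move=> w; rewrite -[leRHS]mule1; apply: lee_wpmul2l.
Qed.

Lemma code_error (e : R) : (0 <= e)%R ->
  err_prob P S NY U codebook_code <=
  (N3^-1)%:E * (\sum_(j : J3) \int[g]_z ((expR (IY (cb j) z) * (expR (e * (th - IY (cb j) z)) +
     \sum_(i : J3 | (i.1.1 != j.1.1) && (i.1.2 == j.1.2)) expR (IY (cb i) z - th)))%R)%:E) +
  (N2^-1)%:E * \sum_(j : J2) \int[g]_s (cell_deficit j s)%:E.
Proof.
move=> e0.
have s0 (j : J3) z : (0 <= expR (e * (th - IY (cb j) z)) +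
     \sum_(i : J3 | (i.1.1 != j.1.1) && (i.1.2 == j.1.2)) expR (IY (cb i) z - th))%R.
  by rewrite addr_ge0 ?expR_ge0// sumr_ge0// => i _; exact: expR_ge0.
apply: (avg_J2_le (f := fun j => \int[g]_z ((expR (IY (cb j) z) * (expR (e * (th - IY (cb j) z)) +
     \sum_(i : J3 | (i.1.1 != j.1.1) && (i.1.2 == j.1.2)) expR (IY (cb i) z - th)))%R)%:E)
   (h := fun j => \int[g]_s (cell_deficit j s)%:E)).
- by move=> j; apply: integral_ge0 => z _; rewrite lee_fin mulr_ge0 ?expR_ge0.
- by move=> j; apply: integral_ge0 => z _; rewrite lee_fin deficit_ge0.
move=> m k.
pose f (y : vec) : \bar R := ((decode k y != m)%:R)%:E.
have mb : measurable [set y | decode k y != m].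
  have -> : [set y | decode k y != m] = ~` [set y | decode k y = m].
    by apply/seteqP; split => y /=; [move/eqP|move/eqP].
  by apply: measurableC; exact: measurable_decode.
have fE y : f y = (\1_[set y | decode k y != m] y)%:E.
  by rewrite /f indicE; congr (nat_of_bool _)%:R%:E; apply/idP/idP; rewrite inE.
have mf : measurable_fun setT f.
  apply: (eq_measurable_fun (fun y => (\1_[set y | decode k y != m] y)%:E)) => [y _|]; first by rewrite fE.
  by apply/measurable_EFinP; exact: measurable_indic.
have f0 y : 0 <= f y by rewrite lee_fin.
have f1 y : f y <= 1 by rewrite lee_fin lern1 leq_b1.
have -> : P [set w | decode k (Yn S NY U codebook_code m k w) != m] =
   \int[P]_o f (vadd3 (encode T rhoS cB cS (fun l => cb (m, k, l)) (Sn S n o, U o)) (Sn S n o)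
      [tuple noise NY NZ true i o | i < n]).
  have mo := measurable_out true m k.
  under eq_integral do rewrite fE.
  have [_ _ ->] := mean_indic P mo mb.
  rewrite fineK; last first.
    by rewrite fin_num_measure// -[X in measurable X]setTI; exact: mo.
  congr (P _); apply/seteqP; split => o /=.
    by congr (decode k _ != m); apply: eq_from_tnth => i; rewrite !tnth_mktuple.
  by congr (decode k _ != m); apply: eq_from_tnth => i; rewrite !tnth_mktuple.
apply: le_trans (encode_channel T0 sig0 model L0 rhoS1 _ (out_std_gt0 true) (rho1 true)
  (match1 true) (match2 true) mf f0) _.
apply: leeD; last exact: deficit_int_le.
apply: lee_sum => l _; apply: lee_wpmul2l; first by rewrite lee_fin invr_ge0.
have mI i : measurable_fun setT (fun z => IY (cb i) z) by exact: measurable_nidens2.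
apply: int_le.
- apply: emeasurable_funM; first by apply/measurable_EFinP; exact: measurable_expR_comp.
  by apply: (measurableT_comp mf); exact: measurable_vscale.
- apply/measurable_EFinP; apply: measurable_funM; first exact: measurable_expR_comp.
  apply: measurable_funD; first by apply: measurable_expR_comp; apply: measurable_funM => //; exact: measurable_funB.
  rewrite (_ : (fun z => _) = (fun z => \sum_(i : J3) if (i.1.1 != m) && (i.1.2 == k) then expR (IY (cb i) z - th) else 0)%R).
    apply: measurable_sum => i; case: (_ && _) => //.
    by apply: measurable_expR_comp; exact: measurable_funB.
  by apply/funext => z; rewrite big_mkcond.
- by move=> z; rewrite mule_ge0// lee_fin expR_ge0.
move=> z; rewrite EFinM; apply: lee_wpmul2l; first by rewrite lee_fin expR_ge0.
by rewrite lee_fin; have := decode_error k m l (vscale (out_std true) z) e0; rewrite sqrt_inv_vscale.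
Qed.

Definition mix_density (z : vec) : R := (N3^-1 * \sum_(j : J3) expR (nidens (rho false) (cb j) z))%R.

(** The ideal part has density [mix_density] against the null law, by the choice of [out_std] as
    normalisation; the failure part has the averaged deficit as density on pairs of state and noise,
    and is below the null law since the deficit is at most 1. *)
Lemma code_kl (eta v s : R) : (0 < s)%R -> (s <= 1)%R ->
  mean g (fun x => N2^-1 * \sum_(j : J2) cell_deficit j x)%R eta ->
  mean g (fun z => phi (mix_density z)) v ->
  rel_entropy (warden_law P S NZ U codebook_code) (Q0n (n:=n) P S NZ) <=
  ((ln 2)^-1 * (v + eta * (2 - 2 * ln s) + 3 * s))%R%:E.
Proof.
move=> s0 s1 heta hv.
have N2E : #|{: J2}|%:R = N2 by rewrite card_prod !card_ord.
have N20 : (0 < N2)%R by rewrite ltr0n muln_gt0 NM0.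
have N30 : (0 < N3)%R by rewrite card_J3 mulr_gt0// ltr0n.
have N2i : (0 <= N2^-1)%R by rewrite invr_ge0 ltW.
have N3i : (0 <= N3^-1)%R by rewrite invr_ge0 ltW.
have mI i : measurable_fun setT (fun z => expR (nidens (rho false) (cb i) z)).
  by apply: measurable_expR_comp; exact: measurable_nidens2.
have mmix : measurable_fun setT mix_density.
  by apply: measurable_funM => //; exact: measurable_sum.
have mout m k : measurable_fun setT (fun o => Zn S NZ U codebook_code m k o).
  apply: eq_measurable_fun (measurable_out false m k) => o _.
  by apply: eq_from_tnth => i; rewrite !tnth_mktuple.
have mS := measurable_S model; have mN := measurable_noise model.
have mnull : measurable_fun setT (fun o => [tuple S i o + NZ i o | i < n]%R).
  by apply: measurable_mktuple => i; apply: measurable_funD; [exact: mS|exact: (mN false)].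
have mh : measurable_fun setT (fun p : vec * vec => null_output T sig2 false p.1 p.2).
  by apply: measurable_mktuple => i; msolve.
have mg : measurable_fun setT (vscale (out_std false) : vec -> vec) by exact: measurable_vscale.
have ind0 (A : set vec) y : 0 <= ((\1_A y)%:E : \bar R) by rewrite lee_fin indicE.
have mind (A : set vec) : measurable A -> measurable_fun setT (fun y => (\1_A y)%:E : \bar R).
  by move=> mA; apply/measurable_EFinP; exact: measurable_indic.
have fp d1 (D : measurableType d1) (Q : probability D R) (X : D -> vec) A : measurable_fun setT X ->
    measurable A -> \int[Q]_o (\1_A (X o))%:E = Q (X @^-1` A).
  move=> mX mA; have [_ _ ->] := mean_indic Q mX mA.
  by rewrite fineK// fin_num_measure// -[X in measurable X]setTI; exact: mX.
have nuE A : measurable A -> Q0n (n:=n) P S NZ A = (g \x g) ((fun p => null_output T sig2 false p.1 p.2) @^-1` A).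
  move=> mA; rewrite /Q0n -fp//.
  rewrite (null_law T0 sig0 model (mind _ mA) (ind0 A)) -fp//.
  rewrite (int_prod g g (f := fun s w => (\1_A (null_output T sig2 false s w))%:E))//.
  exact: (measurableT_comp (mind _ mA) mh).
have md j : measurable_fun setT (cell_deficit j) by exact: measurable_deficit.
have d0 j x : (0 <= cell_deficit j x)%R by exact: deficit_ge0.
have d1 j x : (cell_deficit j x <= 1)%R by exact: deficit_le1.
apply: (@rel_entropy_le R _ _ _ _ Om vec vec (vec * vec)%type P g (g \x g : probability (vec * vec)%type R)
  _ (fun j : J2 => Zn S NZ U codebook_code j.1 j.2) _ _ (vscale (out_std false)) mix_density
  (fun p => null_output T sig2 false p.1 p.2) (fun p => N2^-1 * \sum_(j : J2) cell_deficit j p.1)%R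
  s eta v) => //.
- by rewrite card_prod !card_ord muln_gt0 NM0.
- by move=> A mA; rewrite /warden_law avg_mkE N2E.
- move=> A mA; rewrite nuE// -fp//.
  rewrite (int_prod g g (f := fun s w => (\1_A (null_output T sig2 false s w))%:E))//; last first.
    exact: (measurableT_comp (mind _ mA) mh).
  by rewrite (null_output_law T0 sig0 false (mind _ mA) (ind0 A)) -fp.
- move=> z; apply: mulr_gt0; first by rewrite invr_gt0.
  have k0 : (0 < #|{: J3}|)%N by rewrite -(ltr0n R).
  by case/card_gt0P: k0 => j _; rewrite (bigD1 j)//= ltr_pwDl ?expR_gt0// sumr_ge0// => i _; exact: expR_ge0.
- split => //; first by move=> z; rewrite mulr_ge0// sumr_ge0// => i _; exact: expR_ge0.
  rewrite /mix_density; under eq_integral do rewrite EFinM -sumEFin.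
  rewrite intZ//; last 2 first.
  + by apply: emeasurable_sum => j; exact/measurable_EFinP.
  + by move=> z; apply: sume_ge0 => j _; rewrite lee_fin expR_ge0.
  rewrite int_sum; last 2 first.
  + by move=> j; exact/measurable_EFinP.
  + by move=> j z; rewrite lee_fin expR_ge0.
  rewrite (eq_bigr (fun=> 1%:E)) => [|j _]; last exact: nidens_int1.
  by rewrite sumEFin sumr_cst -EFinM mulr1 mulVf// gt_eqF.
- move=> p; rewrite ler_pdivrMl// mulr1 -N2E.
  by rewrite -[leRHS]mulr1 -sumr_cst; apply: ler_sum => j _.
- have [m1 p1 i1] := heta.
  apply/(@mean_prod _ _ _ _ _ _ _ (fun s (w : vec) => N2^-1 * \sum_(j : J2) cell_deficit j s)%R); split.
  + exact: (measurableT_comp m1 (@measurable_fst _ _ vec vec)).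
  + by move=> x y; exact: p1.
  + by rewrite -i1; apply: eq_integral => x _; rewrite int_prob_cst.
move=> A mA.
have mIA (j : J3) : measurable_fun setT (fun z => (expR (nidens (rho false) (cb j) z))%:E * (\1_A (vscale (out_std false) z))%:E).
  by apply: emeasurable_funM; [exact/measurable_EFinP|exact: (measurableT_comp (mind _ mA) mg)].
have mDA (j : J2) : measurable_fun setT (fun p : vec * vec => (cell_deficit j p.1)%:E * (\1_A (null_output T sig2 false p.1 p.2))%:E).
  apply: emeasurable_funM; last exact: (measurableT_comp (mind _ mA) mh).
  by apply/measurable_EFinP; apply: (measurableT_comp (md j)); exact: measurable_fst.
apply: le_trans (avg_J2_le (f := fun j => \int[g]_z ((expR (nidens (rho false) (cb j) z))%:E * (\1_A (vscale (out_std false) z))%:E))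
   (h := fun j => \int[g]_s \int[g]_w ((cell_deficit j s)%:E * (\1_A (null_output T sig2 false s w))%:E)) _ _ _) _.
- by move=> j; apply: integral_ge0 => z _; rewrite mule_ge0// lee_fin expR_ge0.
- by move=> j; apply: integral_ge0 => s' _; apply: integral_ge0 => w _; rewrite mule_ge0// lee_fin.
- move=> m k.
  have := encode_channel T0 sig0 model L0 rhoS1 (fun l => cb (m, k, l)) (out_std_gt0 false) (rho1 false)
    (match1 false) (match2 false) (mind _ mA) (ind0 A).
  apply: le_trans; rewrite -fp; last 2 first.
  + exact: mout.
  + by [].
  rewrite le_eqVlt; apply/orP; left; apply/eqP; apply: eq_integral => o _.
  by congr ((\1_A _)%:E); apply: eq_from_tnth => i; rewrite !tnth_mktuple.
apply: leeD; rewrite le_eqVlt; apply/orP; left; apply/eqP.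
  rewrite -int_sum//.
  rewrite -intZ//; last 2 first.
  + exact: emeasurable_sum.
  + by move=> z; apply: sume_ge0 => j _; rewrite mule_ge0// lee_fin expR_ge0.
  apply: eq_integral => z _; under eq_bigr do rewrite -EFinM.
  by rewrite sumEFin -EFinM -mulr_suml mulrA mulrC.
rewrite (eq_bigr (fun j => \int[g \x g]_p ((cell_deficit j p.1)%:E * (\1_A (null_output T sig2 false p.1 p.2))%:E))); last first.
  move=> j _; rewrite (int_prod g g (f := fun s w => (cell_deficit j s)%:E * (\1_A (null_output T sig2 false s w))%:E))//.
  by move=> x y; rewrite mule_ge0// lee_fin.
rewrite -int_sum//; last by move=> j z; rewrite mule_ge0// lee_fin.
rewrite -intZ//; last 2 first.
+ exact: emeasurable_sum.
+ by move=> z; apply: sume_ge0 => j _; rewrite mule_ge0// lee_fin.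
apply: eq_integral => z _; under eq_bigr do rewrite -EFinM.
by rewrite sumEFin -EFinM -mulr_suml mulrA mulrC.
Qed.

End Code.

(** * Random coding *)

Section MeanSelect.
Local Open Scope ereal_scope.
Context (R : realType) d1 d2 (X : measurableType d1) (Y : measurableType d2)
  (m1 : probability X R) (m2 : probability Y R).

(** Otherwise every section would integrate to more than a + e, and so would the whole. *)
Lemma mean_select (f : X -> Y -> R) (a e : R) : (0 < e)%R ->
  mean (m1 \x m2 : probability (X * Y)%type R) (fun p => f p.1 p.2) a ->
  exists x b, mean m2 (f x) b /\ (b <= a + e)%R.
Proof.
move=> e0 /(@mean_prod _ _ _ _ _ _ _ f)[mf f0 fE].
have mfE : measurable_fun setT (fun p : X * Y => (f p.1 p.2)%:E) by exact/measurable_EFinP.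
have [[x hx]|h] := pselect (exists x, \int[m2]_y (f x y)%:E <= (a + e)%:E).
  have mx : measurable_fun setT (f x) by apply/measurable_EFinP; exact: (measurable_app1 (f := fun x y => (f x y)%:E) mfE).
  exists x; have [b hb bE] := mean_exists mx (f0 x) hx.
  by exists b.
exfalso; have : (a + e)%:E <= a%:E.
  rewrite -fE -[leLHS](int_prob_cst m1); apply: int_le.
  - exact: measurable_cst.
  - by apply: measurable_int1.
  - move=> x; rewrite lee_fin addr_ge0 ?(ltW e0)//.
    by rewrite -lee_fin -fE; apply: integral_ge0 => y _; apply: integral_ge0 => z _; rewrite lee_fin.
  - by move=> x; rewrite leNgt; apply/negP => hx; apply: h; exists x; exact: ltW.
by rewrite lee_fin gerDl leNgt e0.
Qed.

(** One weighted sum selects a codebook that is good for four criteria at once: a large weight W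
    forces the last three to be small, while the first, the power, stays close to its mean. *)
Lemma mean_select4 (f1 f2 f3 f4 : X -> Y -> R) (a1 a2 a3 a4 W e : R) : (0 < e)%R -> (0 < W)%R ->
  mean (m1 \x m2 : probability (X * Y)%type R) (fun p => f1 p.1 p.2) a1 ->
  mean (m1 \x m2 : probability (X * Y)%type R) (fun p => f2 p.1 p.2) a2 ->
  mean (m1 \x m2 : probability (X * Y)%type R) (fun p => f3 p.1 p.2) a3 ->
  mean (m1 \x m2 : probability (X * Y)%type R) (fun p => f4 p.1 p.2) a4 ->
  exists x b1 b2 b3 b4, [/\ mean m2 (f1 x) b1, mean m2 (f2 x) b2, mean m2 (f3 x) b3, mean m2 (f4 x) b4 &
    (b1 + W * (b2 + b3 + b4) <= a1 + W * (a2 + a3 + a4) + e)%R].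
Proof.
move=> e0 W0 h1 h2 h3 h4.
have h := meanD h1 (meanZ (ltW W0) (meanD (meanD h2 h3) h4)).
have [x [b [hb be]]] := @mean_select (fun x y => f1 x y + W * (f2 x y + f3 x y + f4 x y))%R _ _ e0 h.
have sec (f : X -> Y -> R) a : mean (m1 \x m2 : probability (X * Y)%type R) (fun p => f p.1 p.2) a ->
    measurable_fun setT (f x) /\ forall y, (0 <= f x y)%R.
  move=> /(@mean_prod _ _ _ _ _ _ _ f)[mf f0 _]; split => //.
  apply/measurable_EFinP; apply: (measurable_app1 (f := fun x y => (f x y)%:E)).
  exact/measurable_EFinP.
have [k1 p1] := sec _ _ h1; have [k2 p2] := sec _ _ h2.
have [k3 p3] := sec _ _ h3; have [k4 p4] := sec _ _ h4.
have Wi : (0 <= W^-1)%R by rewrite invr_ge0 ltW.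
have ex (f : Y -> R) (c : R) : (0 <= c)%R -> measurable_fun setT f -> (forall y, 0 <= f y)%R ->
   (forall y, f y <= c * (f1 x y + W * (f2 x y + f3 x y + f4 x y)))%R -> exists a, mean m2 f a.
  move=> c0 mf f0 fle; have [a ha _] := mean_exists_le mf f0 (meanZ c0 hb) fle.
  by exists a.
have s0 y : (0 <= W * (f2 x y + f3 x y + f4 x y))%R.
  by apply: mulr_ge0; [exact: ltW|rewrite !addr_ge0].
have le y (t : R) : (t <= f2 x y + f3 x y + f4 x y)%R ->
   (t <= W^-1 * (f1 x y + W * (f2 x y + f3 x y + f4 x y)))%R.
  by move=> ht; rewrite mulrDr mulKf ?gt_eqF//; apply: ler_wpDl ht; exact: mulr_ge0.
have [b1 g1] : exists a, mean m2 (f1 x) a.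
  by apply: (ex _ 1%R) => // y; rewrite mul1r lerDl.
have [b2 g2] : exists a, mean m2 (f2 x) a.
  by apply: (ex _ W^-1)%R => // y; apply: le; rewrite -addrA lerDl addr_ge0.
have [b3 g3] : exists a, mean m2 (f3 x) a.
  by apply: (ex _ W^-1)%R => // y; apply: le; rewrite addrAC lerDr addr_ge0.
have [b4 g4] : exists a, mean m2 (f4 x) a.
  by apply: (ex _ W^-1)%R => // y; apply: le; rewrite lerDr addr_ge0.
exists x, b1, b2, b3, b4; split => //; apply: le_trans be.
rewrite le_eqVlt; apply/orP; left; apply/eqP.
exact: mean_uniq (meanD g1 (meanZ (ltW W0) (meanD (meanD g2 g3) g4))) hb.
Qed.

End MeanSelect.

Section RandomCode.
Local Open Scope ereal_scope.
Context (R : realType) (n L NM NK : nat) (rhoS cB cS rhoY rhoZ th e l : R).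
Hypothesis n0 : (0 < n)%N.
Hypothesis L0 : (0 < L)%N.
Hypothesis NM0 : (0 < NM)%N.
Hypothesis NK0 : (0 < NK)%N.
Hypothesis rhoS1 : (rhoS ^+ 2 < 1)%R.
Hypothesis rhoY1 : (rhoY ^+ 2 < 1)%R.
Hypothesis rhoZ1 : (rhoZ ^+ 2 < 1)%R.
Hypothesis cB0 : (0 < cB)%R.
Hypothesis e0 : (0 < e)%R.
Hypothesis e1 : (e <= 1)%R.
Hypothesis l0 : (0 < l)%R.
Local Notation vec := (n.-tuple R).
Local Notation g := (gaussn R n).
Local Notation J3 := ('I_NM * 'I_NK * 'I_L)%type.
Local Notation J2 := ('I_NM * 'I_NK)%type.
Local Notation D := (#|{: J3}|.-tuple vec).
Local Notation Pc := (tprod #|{: J3}| (fun=> g) : probability D R).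
Local Notation Q := (Pc \x g : probability (D * vec)%type R).
Local Notation gg := (g \x g : probability (vec * vec)%type R).
Local Notation N3 := (#|{: J3}|%:R : R).
Local Notation N2 := ((NM * NK)%:R : R).

(** The random codebook is one long tuple read by rank, so that distinct codewords are distinct
    coordinates of a product law. *)
Definition cword (j : J3) (w : D) : vec := tnth w (enum_rank j).

Definition mgf_exp (rho t : R) : R := (- (t * ln (1 - rho ^+ 2) / 2) - ln (1 - t ^+ 2 * rho ^+ 2) / 2)%R.

Lemma measurable_cword j : measurable_fun setT (cword j).
Proof. exact: measurable_tnth. Qed.

Lemma cword1 j (f : vec -> \bar R) : measurable_fun setT f -> (forall x, 0 <= f x) ->
  \int[Pc]_w f (cword j w) = \int[g]_u f u.
Proof. by move=> mf f0; exact: tprod_coord. Qed.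

Lemma cword2 i j (f : vec -> vec -> \bar R) : i != j ->
  measurable_fun setT (fun p : vec * vec => f p.1 p.2) -> (forall x y, 0 <= f x y) ->
  \int[Pc]_w f (cword i w) (cword j w) = \int[g]_u \int[g]_v f u v.
Proof.
by move=> ij mf f0; apply: tprod_coord2 => //; apply: contra ij => /eqP/enum_rank_inj ->.
Qed.

Lemma card_J3_gt0 : (0 < #|{: J3}|)%N.
Proof. by rewrite !card_prod !card_ord !muln_gt0 NM0 NK0. Qed.

Lemma mean_mgf rho t : (rho ^+ 2 < 1)%R -> (`|t| <= 1)%R ->
  mean gg (fun p => expR ((1 + t) * nidens rho p.1 p.2)) (expR (n%:R * mgf_exp rho t)).
Proof.
move=> r1 t1; apply/(@mean_prod _ _ _ _ _ _ _ (fun u z => expR ((1 + t) * nidens rho u z))); split.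
- by apply: measurable_expR_comp; apply: measurable_funM => //; exact: measurable_nidens.
- by move=> x y; exact: expR_ge0.
- exact: nidens_mgf.
Qed.

Let N30 : (0 < N3)%R. Proof. by rewrite ltr0n card_J3_gt0. Qed.
Let N3i : (0 <= N3^-1)%R. Proof. by rewrite invr_ge0 ltW. Qed.

Definition power_term (w : D) (x : vec) : R :=
  (N3^-1 * \sum_(j : J3) expR (nidens rhoS (cword j w) x) * energy (vinput cB cS (cword j w) x))%R.

Lemma mean_power_term : mean Q (fun p => power_term p.1 p.2)
  (cB ^+ 2 + cS ^+ 2 - 2 * cB * cS * rhoS).
Proof.
set v := (_ - _)%R.
have h : mean gg (fun p => expR (nidens rhoS p.1 p.2) * energy (vinput cB cS p.1 p.2))%R v.
  apply/(@mean_prod _ _ _ _ _ _ _ (fun u s => expR (nidens rhoS u s) * energy (vinput cB cS u s))%R); split.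
  - apply: measurable_funM; first by apply: measurable_expR_comp; exact: measurable_nidens.
    apply: (measurableT_comp (@measurable_energy _ _)).
    by apply: measurable_vinput; [exact: measurable_fst|exact: measurable_snd].
  - by move=> x y; rewrite mulr_ge0 ?expR_ge0 ?energy_ge0.
  - have nn : (0 <= n%:R^-1 :> R)%R by rewrite invr_ge0.
    have := @nidens_power R n rhoS cB (- cS) rhoS1 cB0.
    have -> : (cB ^+ 2 + (- cS) ^+ 2 + 2 * cB * - cS * rhoS = v)%R by rewrite /v; ring.
    move=> hp.
    transitivity (n%:R^-1%:E * (n%:R * v)%:E : \bar R); last first.
      by rewrite -EFinM mulKf// gt_eqF// ltr0n.
    rewrite -hp.
    have mX : measurable_fun setT (fun p : vec * vec => (expR (nidens rhoS p.1 p.2))%:E *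
        (\sum_(i < n) (cB * tnth p.1 i + - cS * tnth p.2 i) ^+ 2)%:E).
      apply: emeasurable_funM; last by msolve.
      by apply/measurable_EFinP; apply: measurable_expR_comp; exact: measurable_nidens.
    have X0 (u s : vec) : 0 <= (expR (nidens rhoS u s))%:E *
        (\sum_(i < n) (cB * tnth u i + - cS * tnth s i) ^+ 2)%:E.
      by rewrite mule_ge0// lee_fin ?expR_ge0// sumr_ge0// => i _; exact: sqr_ge0.
    rewrite -intZ//; last 2 first.
    + exact: (measurable_int1 g (f := fun u s => (expR (nidens rhoS u s))%:E *
        (\sum_(i < n) (cB * tnth u i + - cS * tnth s i) ^+ 2)%:E)).
    + by move=> u; exact: integral_ge0.
    apply: eq_integral => u _; rewrite -intZ//; last first.
      exact: (measurable_app1 (f := fun u s => (expR (nidens rhoS u s))%:E *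
        (\sum_(i < n) (cB * tnth u i + - cS * tnth s i) ^+ 2)%:E)).
    apply: eq_integral => s _; rewrite /energy EFinM [in RHS]muleCA; congr (_ * _).
    rewrite -EFinM; congr (_ * _)%:E; apply: eq_bigr => i _.
    by rewrite tnth_mktuple mulNr.
have hj j := @mean_codeword R _ _ _ D vec vec Pc g g J3 cword measurable_cword cword1 j
  (fun u s => expR (nidens rhoS u s) * energy (vinput cB cS u s))%R v h.
have := meanZ N3i (mean_sum hj).
by rewrite sumr_cst mulKf// gt_eqF.
Qed.

Definition error_term (w : D) (x : vec) : R :=
  (N3^-1 * \sum_(j : J3) expR (nidens rhoY (cword j w) x) *
     (expR (e * (th - nidens rhoY (cword j w) x)) +
      \sum_(i : J3 | (i.1.1 != j.1.1) && (i.1.2 == j.1.2)) expR (nidens rhoY (cword i w) x - th)))%R.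

(** Competitors share the key, which leaves a choice of message and covering index only. *)
Lemma card_same_key (j : J3) (c : R) : (0 <= c)%R ->
  (\sum_(i : J3) (if (i.1.1 != j.1.1) && (i.1.2 == j.1.2) then c else 0) <= NM%:R * L%:R * c)%R.
Proof.
move=> c0.
apply: (@le_trans _ _ (\sum_(i : J3) (if i.1.2 == j.1.2 then c else 0))%R).
  by apply: ler_sum => i _; case: (i.1.1 != _) => //=; case: ifP.
have -> : (\sum_(i : J3) (if i.1.2 == j.1.2 then c else 0) =
    \sum_(m : 'I_NM) \sum_(k : 'I_NK) \sum_(l : 'I_L) (if k == j.1.2 then c else 0))%R.
  by rewrite pair_bigA pair_bigA; apply: eq_bigr => -[[]].
under eq_bigr do under eq_bigr do rewrite sumr_cst card_ord.
rewrite sumr_cst card_ord -mulr_sumr mulrA -big_mkcond big_pred1_eq//.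
Qed.

(** Missing the threshold is a Chernoff bound with the moment of order 1 - e. A competitor is
    independent of the sent codeword, so its density has mean one and the union bound charges exp (-
    th) for each. *)
Lemma mean_error_term : exists2 a, mean Q (fun p => error_term p.1 p.2) a &
  (a <= expR (e * th + n%:R * mgf_exp rhoY (- e)) + NM%:R * L%:R * expR (- th))%R.
Proof.
have mI := @measurable_nidens R n rhoY.
have I1 z := @nidens_int1r R n rhoY z rhoY1.
have he : (`|- e| <= 1)%R by rewrite normrN ger0_norm// ltW.
have h1 (j : J3) := meanZ (expR_ge0 (e * th)) (@mean_codeword R _ _ _ D vec vec Pc g g J3 cword measurable_cword cword1 j
  (fun u z => expR ((1 - e) * nidens rhoY u z)) _ (mean_mgf rhoY1 he)).
have h2 (i j : J3) : mean Q (fun p => if (i.1.1 != j.1.1) && (i.1.2 == j.1.2) then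
    expR (- th) * (expR (nidens rhoY (cword j p.1) p.2) * expR (nidens rhoY (cword i p.1) p.2)) else 0)%R
    (if (i.1.1 != j.1.1) && (i.1.2 == j.1.2) then expR (- th) else 0)%R.
  case: ifP => [/andP[ij _]|_]; last exact: mean_cst.
  have ji : j != i by apply: contra ij => /eqP ->.
  have := meanZ (expR_ge0 (- th)) (@mean_codeword2 R _ _ _ D vec vec Pc g g J3 cword (nidens rhoY)
    measurable_cword mI cword2 I1 j i (fun u z => expR (nidens rhoY u z)) 1 ji (mean_density g mI I1)).
  by rewrite mulr1.
have h := meanZ N3i (mean_sum (fun j => meanD (h1 j) (mean_sum (h2^~ j)))).
eexists.
  apply: mean_ext h => p; rewrite /error_term; congr (_ * _)%R; apply: eq_bigr => j _.
  rewrite mulrDr; congr (_ + _)%R.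
    by rewrite -!expRD; congr expR; ring.
  rewrite -big_mkcond mulr_sumr; apply: eq_bigr => i _.
  by rewrite -!expRD; congr expR; ring.
rewrite ler_pdivrMl// -sumr_cst; apply: ler_sum => j _.
by rewrite expRD; apply: lerD => //; apply: card_same_key; exact: expR_ge0.
Qed.

Definition deficit_term (w : D) (x : vec) : R :=
  (N2^-1 * \sum_(j : J2) deficit rhoS (fun i => cword (j, i) w) x)%R.

(** For each message and key the L codewords have to cover the state: [soft_covering] with the
    density [nidens rhoS], then [deficit_le_phi] with the free parameter [l]. *)
Lemma mean_deficit_term : exists2 a, mean Q (fun p => deficit_term p.1 p.2) a &
  (a <= l + e^-1 * expR (- (e * ln L%:R)) * expR (n%:R * mgf_exp rhoS e) / l)%R.
Proof.
have mI := @measurable_nidens R n rhoS.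
have I1 z := @nidens_int1r R n rhoS z rhoS1.
have he : (`|e| <= 1)%R by rewrite ger0_norm// ltW.
set M := (e^-1 * _ * _)%R.
have LL : (0 < #|'I_L|)%N by rewrite card_ord.
have h (j : J2) : exists2 a, mean Q (fun p => deficit rhoS (fun i => cword (j, i) p.1) p.2) a & (a <= l + M / l)%R.
  pose C (i : 'I_L) (w : D) := cword (j, i) w.
  have mC i : measurable_fun setT (C i) by exact: measurable_cword.
  have C1 i (f : vec -> \bar R) : measurable_fun setT f -> (forall x, 0 <= f x) ->
    \int[Pc]_w f (C i w) = \int[g]_u f u by exact: cword1.
  have C2 i i' (f : vec -> vec -> \bar R) : i != i' ->
    measurable_fun setT (fun p : vec * vec => f p.1 p.2) -> (forall x y, 0 <= f x y) ->
    \int[Pc]_w f (C i w) (C i' w) = \int[g]_u \int[g]_v f u v.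
    by move=> ii; apply: cword2; apply: contra ii => /eqP[->].
  have [_ _ mg] := (mean_prod _ _ (fun u z => expR ((1 + e) * nidens rhoS u z)) _).1 (mean_mgf rhoS1 he).
  have := soft_covering LL mC mI C1 C2 I1 e0 e1 mg.
  move=> /(deficit_le_phi LL mC mI l0); rewrite card_ord -/M => hd.
  have dE w x : deficit rhoS (fun i => cword (j, i) w) x = Num.max 0%R (1 - mixture C (nidens rhoS) w x)%R.
    by rewrite /deficit /mixture /avg_density card_ord.
  have md : measurable_fun setT (fun p : D * vec => Num.max 0 (1 - mixture C (nidens rhoS) p.1 p.2))%R.
    by apply: measurable_maxr => //; apply: measurable_funB => //; exact: measurable_mixture.
  have d0 w x : (0 <= Num.max 0 (1 - mixture C (nidens rhoS) w x))%R by rewrite le_max lexx.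
  have [a ha ale] : exists2 a, mean Q (fun p => Num.max 0 (1 - mixture C (nidens rhoS) p.1 p.2))%R a & (a <= l + M / l)%R.
    apply: mean_exists => //.
    rewrite (int_prod Pc g (f := fun w x => (Num.max 0 (1 - mixture C (nidens rhoS) w x))%R%:E))//.
    exact/measurable_EFinP.
  by exists a => //; apply: mean_ext ha => p; rewrite dE.
have /cid[a aE] : exists a : J2 -> R, forall j,
    mean Q (fun p => deficit rhoS (fun i => cword (j, i) p.1) p.2) (a j) /\ (a j <= l + M / l)%R.
  have hh j : exists a, mean Q (fun p => deficit rhoS (fun i => cword (j, i) p.1) p.2) a /\ (a <= l + M / l)%R.
    by have [b] := h j; exists b.
  by exists (fun j => projT1 (cid (hh j))) => j; exact: (projT2 (cid (hh j))).
have N20 : (0 < N2)%R by rewrite ltr0n muln_gt0 NM0.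
have N2i : (0 <= N2^-1)%R by rewrite invr_ge0 ltW.
exists (N2^-1 * \sum_j a j)%R.
  exact: meanZ N2i (mean_sum (fun j => (aE j).1)).
rewrite ler_pdivrMl//; have -> : N2 = #|{: J2}|%:R by rewrite card_prod !card_ord.
by rewrite -sumr_cst; apply: ler_sum => j _; exact: (aE j).2.
Qed.

(** Here the whole codebook, over messages, keys and covering indices, has to cover the warden's
    output; this is where the key helps. *)
Lemma mean_phi_term : exists2 a,
  mean Q (fun p => phi (mixture cword (nidens rhoZ) p.1 p.2)) a &
  (a <= e^-1 * expR (- (e * ln N3)) * expR (n%:R * mgf_exp rhoZ e))%R.
Proof.
have mI := @measurable_nidens R n rhoZ.
have I1 z := @nidens_int1r R n rhoZ z rhoZ1.
have he : (`|e| <= 1)%R by rewrite ger0_norm// ltW.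
have [_ _ mg] := (mean_prod _ _ (fun u z => expR ((1 + e) * nidens rhoZ u z)) _).1 (mean_mgf rhoZ1 he).
have := soft_covering card_J3_gt0 measurable_cword mI cword1 cword2 I1 e0 e1 mg.
have mp : measurable_fun setT (fun p : D * vec => phi (mixture cword (nidens rhoZ) p.1 p.2)).
  by apply: (measurableT_comp (@measurable_phi _)); exact: (measurable_mixture measurable_cword mI).
have p0 w x : (0 <= phi (mixture cword (nidens rhoZ) w x))%R.
  by apply: phi_ge0; apply: mixture_gt0; exact: card_J3_gt0.
move=> h; apply: mean_exists => //.
rewrite (int_prod Pc g (f := fun w x => (phi (mixture cword (nidens rhoZ) w x))%:E))//.
exact/measurable_EFinP.
Qed.

End RandomCode.

Section RandomCoding.
Local Open Scope ereal_scope.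
Context (R : realType) (d : measure_display) (Om : measurableType d)
  (P : probability Om R) (T sig2 : R) (S NY NZ : nat -> Om -> R) (U : Om -> R).
Hypothesis T0 : (0 < T)%R.
Hypothesis sig0 : (0 < sig2)%R.
Hypothesis model : gaussian_state_model P T sig2 S NY NZ U.
Variables (rhoS cB cS : R) (rho : bool -> R).
Hypothesis cB0 : (0 < cB)%R.
Hypothesis rhoS1 : (rhoS ^+ 2 < 1)%R.
Hypothesis rho1 : forall b, (rho b ^+ 2 < 1)%R.
Hypothesis match1 : forall b, (cB + (Num.sqrt T - cS) * rhoS = rho b * out_std T sig2 b)%R.
Hypothesis match2 : forall b, ((Num.sqrt T - cS) ^+ 2 * (1 - rhoS ^+ 2) + noise_std sig2 b ^+ 2 =
  out_std T sig2 b ^+ 2 * (1 - rho b ^+ 2))%R.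

Lemma avg_int n (J : finType) (f : J -> n.-tuple R -> R) (b : R) : (0 < #|J|)%N ->
  (forall j, measurable_fun setT (f j)) -> (forall j x, 0 <= f j x)%R ->
  mean (gaussn R n) (fun x => #|J|%:R^-1 * \sum_j f j x)%R b ->
  (#|J|%:R^-1)%:E * (\sum_j \int[gaussn R n]_x (f j x)%:E) = b%:E.
Proof.
move=> J0 mf f0 [_ _ <-].
have mfE j : measurable_fun setT (fun x => (f j x)%:E) by exact/measurable_EFinP.
rewrite -int_sum//.
rewrite -intZ//; last 2 first.
- exact: emeasurable_sum.
- by move=> x; apply: sume_ge0 => j _; rewrite lee_fin.
by apply: eq_integral => x _; rewrite EFinM sumEFin.
Qed.

(** The selected weighted sum is at most B, so the power is at most B and each of the other criteria
    at most B / W. *)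
Lemma random_code (n L NM NK : nat) (th e l W s del : R) :
  (0 < n)%N -> (0 < L)%N -> (0 < NM)%N -> (0 < NK)%N -> (0 < e)%R -> (e <= 1)%R ->
  (0 < l)%R -> (0 < W)%R -> (0 < s)%R -> (s <= 1)%R -> (0 < del)%R ->
  let B := (cB ^+ 2 + cS ^+ 2 - 2 * cB * cS * rhoS +
    W * ((expR (e * th + n%:R * mgf_exp (rho true) (- e)) + NM%:R * L%:R * expR (- th)) +
      (l + e^-1 * expR (- (e * ln L%:R)) * expR (n%:R * mgf_exp rhoS e) / l) +
      e^-1 * expR (- (e * ln (NM%:R * NK%:R * L%:R))) * expR (n%:R * mgf_exp (rho false) e)) + del)%R in
  exists c : @nc_code R n NM NK,
  [/\ avg_power P S U c <= B%:E, err_prob P S NY U c <= (B / W)%:E &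
   rel_entropy (warden_law P S NZ U c) (Q0n (n:=n) P S NZ) <=
     ((ln 2)^-1 * (B / W + B / W * (2 - 2 * ln s) + 3 * s))%:E].
Proof.
move=> n0 L0 NM0 NK0 e0 e1 l0 W0 s0 s1 del0 B.
pose J3 : finType := ('I_NM * 'I_NK * 'I_L)%type.
have N3E : #|J3|%:R = (NM%:R * NK%:R * L%:R)%R :> R by rewrite !card_prod !card_ord !natrM.
have h1 := @mean_power_term R n L NM NK rhoS cB cS n0 L0 NM0 NK0 rhoS1 cB0.
have [a2 h2 l2] := @mean_error_term R n L NM NK (rho true) th e L0 NM0 NK0 (rho1 true) e0 e1.
have [a3 h3 l3] := @mean_deficit_term R n L NM NK rhoS e l L0 NM0 NK0 rhoS1 e0 e1 l0.
have [a4 h4 l4] := @mean_phi_term R n L NM NK (rho false) e L0 NM0 NK0 (rho1 false) e0 e1.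
have [w [b1 [b2 [b3 [b4 [g1 g2 g3 g4 hb]]]]]] :=
  mean_select4 (f1 := power_term rhoS cB cS) (f2 := error_term (rho true) th e) (f3 := deficit_term rhoS)
    (f4 := fun w x => phi (mixture (cword (NK:=NK)) (nidens (rho false)) w x)) del0 W0 h1 h2 h3 h4.
have {hb}hb : (b1 + W * (b2 + b3 + b4) <= B)%R.
  apply: le_trans hb _; rewrite /B lerD2r lerD2l ler_pM2l//.
  by rewrite -N3E; apply: lerD => //; exact: lerD.
have p1 := mean_ge0 g1; have p2 := mean_ge0 g2; have p3 := mean_ge0 g3; have p4 := mean_ge0 g4.
have b1B : (b1 <= B)%R.
  by apply: le_trans hb; rewrite lerDl mulr_ge0 ?(ltW W0)// !addr_ge0.
have bW : (b2 + b3 + b4 <= B / W)%R.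
  by rewrite ler_pdivlMr// mulrC; apply: le_trans hb; rewrite lerDr.
pose cb (j : J3) := cword j w.
have J30 : (0 < #|J3|)%N by rewrite -(ltr0n R) N3E !mulr_gt0// ltr0n.
have J20 : (0 < #|{: 'I_NM * 'I_NK}|)%N by rewrite card_prod !card_ord muln_gt0 NM0.
exists (codebook_code T sig2 rhoS cB cS rho th L0 NM0 cb); split.
- apply: le_trans (code_power T0 sig0 model rhoS cB cS rho th L0 NM0 cb) _.
  apply: (@le_trans _ _ b1%:E); last by rewrite lee_fin.
  rewrite le_eqVlt; apply/orP; left; apply/eqP.
  refine (etrans _ (@avg_int n J3 (fun j s => expR (nidens rhoS (cb j) s) * energy (vinput cB cS (cb j) s))%R b1 J30 _ _ g1)).
  + by [].
  + move=> j; apply: measurable_funM; first by apply: measurable_expR_comp; exact: measurable_nidens2.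
    by apply: (measurableT_comp (@measurable_energy _ _)); exact: measurable_vinput.
  + by move=> j x; rewrite mulr_ge0 ?expR_ge0 ?energy_ge0.
- apply: le_trans (code_error T0 sig0 model th L0 NM0 rhoS1 rho1 match1 match2 cb (ltW e0)) _.
  have mY j : measurable_fun setT (fun z => nidens (rho true) (cb j) z) by exact: measurable_nidens2.
  have := @avg_int n J3 (fun j z => expR (nidens (rho true) (cb j) z) * (expR (e * (th - nidens (rho true) (cb j) z)) +
     \sum_(i : J3 | (i.1.1 != j.1.1) && (i.1.2 == j.1.2)) expR (nidens (rho true) (cb i) z - th)))%R b2 J30 _ _ g2.
  move=> ->//; last 2 first.
  + move=> j; apply: measurable_funM; first exact: measurable_expR_comp.
    apply: measurable_funD; first by apply: measurable_expR_comp; apply: measurable_funM => //; exact: measurable_funB.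
    rewrite (_ : (fun z => _) = (fun z => \sum_(i : J3) if (i.1.1 != j.1.1) && (i.1.2 == j.1.2) then expR (nidens (rho true) (cb i) z - th) else 0)%R).
      apply: measurable_sum => i; case: (_ && _) => //.
      by apply: measurable_expR_comp; exact: measurable_funB.
    by apply/funext => z; rewrite big_mkcond.
  + move=> j z; rewrite mulr_ge0 ?expR_ge0// addr_ge0 ?expR_ge0// sumr_ge0// => i _; exact: expR_ge0.
  have N2E : (NM * NK)%:R = #|{: 'I_NM * 'I_NK}|%:R :> R by rewrite card_prod !card_ord.
  move: g3; rewrite /deficit_term N2E => g3.
  have := @avg_int n _ (fun (j : 'I_NM * 'I_NK) x => deficit rhoS (fun i => cb (j, i)) x) b3 J20 _ _ g3.
  move=> ->//; last 2 first.
  + by move=> j; exact: measurable_deficit.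
  + by move=> j x; exact: deficit_ge0.
  by rewrite -EFinD lee_fin; apply: le_trans bW; rewrite lerDl.
- apply: le_trans (code_kl T0 sig0 model th L0 NM0 NK0 rhoS1 rho1 match1 match2 (cb := cb) s0 s1 g3 g4) _.
  rewrite lee_fin ler_pM2l ?invr_gt0 ?ln2_gt0// lerD2r.
  have ls : (0 <= 2 - 2 * ln s)%R by have := ln_le0 s1; lra.
  apply: lerD; first by apply: le_trans bW; rewrite lerDr addr_ge0.
  by apply: ler_wpM2r => //; apply: le_trans bW; rewrite addrAC lerDr addr_ge0.
Qed.

End RandomCoding.

(** * Rates *)

Section SchemeParams.
Context (R : realType).
Variables (T sig2 Ppow : R).
Hypotheses (T0 : 0 < T) (sig0 : 0 < sig2) (Pp0 : 0 < Ppow).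
Local Notation gam := (gamma_star T Ppow).
Local Notation Ts := (T_star T Ppow).
Local Notation Ps := (P_star T Ppow).
Local Notation al := (alpha_star T Ppow).
Local Notation sqT := (Num.sqrt T).
Local Notation V := (out_std T sig2).

(** Dirty-paper scheme with X' of law N(0, P_star) independent of S: the input is X' - gam S, and
    the auxiliary variable X' + al (1 - gam) S has variance [B_star]. Its normalisation u has
    correlation [rho_state] with the state and [rho_out] with the outputs; [coef_u] and [coef_s]
    express the input through u and the normalised state. As X + S = X' + (1 - gam) S has variance
    P_star + T_star = T, the warden's ideal output follows the null law. *)
Definition B_star : R := Ps + al ^+ 2 * Ts.
Definition coef_u : R := Num.sqrt B_star.
Definition coef_s : R := (al * (1 - gam) + gam) * sqT.
Definition rho_state : R := al * (1 - gam) * sqT / coef_u.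
Definition rho_out (b : bool) : R := (Ps + al * Ts) / (coef_u * V b).

Let Ps0 : 0 < Ps. Proof. exact: P_star_gt0. Qed.
Let sqT2 : sqT ^+ 2 = T. Proof. by rewrite sqr_sqrtr// ltW. Qed.
Let TsE : Ts = (1 - gam) ^+ 2 * T. Proof. by []. Qed.
Let Ts0 : 0 <= Ts. Proof. by rewrite TsE mulr_ge0 ?sqr_ge0// ltW. Qed.

Lemma B_star_gt0 : 0 < B_star.
Proof. by rewrite ltr_pwDl// mulr_ge0// sqr_ge0. Qed.

Lemma coef_u_gt0 : 0 < coef_u.
Proof. by rewrite sqrtr_gt0 B_star_gt0. Qed.

Let cu2 : coef_u ^+ 2 = B_star. Proof. by rewrite sqr_sqrtr// ltW// B_star_gt0. Qed.
Let cuN : coef_u != 0. Proof. by rewrite gt_eqF// coef_u_gt0. Qed.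
Let V0 b : 0 < V b. Proof. exact: out_std_gt0. Qed.
Let VN b : V b != 0. Proof. by rewrite gt_eqF. Qed.

Lemma rho_state_sq : 1 - rho_state ^+ 2 = Ps / B_star.
Proof.
have BN : B_star != 0 by rewrite gt_eqF// B_star_gt0.
rewrite /rho_state expr_div_n cu2 exprMn sqT2 exprMn -mulrA -TsE.
by rewrite -[X in X - _](divff BN) -mulrBl addrK.
Qed.

Lemma rho_state_lt1 : rho_state ^+ 2 < 1.
Proof. by rewrite -subr_gt0 rho_state_sq divr_gt0// B_star_gt0. Qed.

Lemma V_sq b : V b ^+ 2 = T + noise_std sig2 b ^+ 2.
Proof. by rewrite sqr_sqrtr// addr_ge0 ?sqr_ge0// ltW. Qed.

Lemma rho_out_sq b : rho_out b ^+ 2 = (Ps + al * Ts) ^+ 2 / (B_star * V b ^+ 2).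
Proof. by rewrite /rho_out expr_div_n exprMn cu2. Qed.

Lemma rho_match1 b : coef_u + (sqT - coef_s) * rho_state = rho_out b * V b.
Proof.
have -> : rho_out b * V b = (Ps + al * Ts) / coef_u.
  by rewrite /rho_out; field; rewrite cuN VN.
apply: (mulIf cuN); rewrite divfK// mulrDl -expr2 cu2.
rewrite -mulrA /rho_state divfK//.
have -> : (sqT - coef_s) * (al * (1 - gam) * sqT) = (1 - (al * (1 - gam) + gam)) * (al * (1 - gam)) * sqT ^+ 2.
  by rewrite /coef_s; ring.
by rewrite sqT2 /B_star TsE; ring.
Qed.

Lemma rho_match2 b : (sqT - coef_s) ^+ 2 * (1 - rho_state ^+ 2) + noise_std sig2 b ^+ 2 =
  V b ^+ 2 * (1 - rho_out b ^+ 2).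
Proof.
have BN : B_star != 0 by rewrite gt_eqF// B_star_gt0.
have V2N : V b ^+ 2 != 0 by rewrite expf_neq0.
rewrite rho_state_sq rho_out_sq.
have -> : V b ^+ 2 * (1 - (Ps + al * Ts) ^+ 2 / (B_star * V b ^+ 2)) = V b ^+ 2 - (Ps + al * Ts) ^+ 2 / B_star.
  by field; rewrite BN VN.
rewrite V_sq.
have -> : (sqT - coef_s) ^+ 2 = (1 - al) ^+ 2 * Ts.
  have -> : (sqT - coef_s) ^+ 2 = (1 - (al * (1 - gam) + gam)) ^+ 2 * sqT ^+ 2 by rewrite /coef_s; ring.
  by rewrite sqT2 TsE; ring.
have TE : T = Ps + Ts by rewrite /P_star subrK.
have E : (1 - al) ^+ 2 * Ts * Ps + (Ps + al * Ts) ^+ 2 = (Ps + Ts) * B_star by rewrite /B_star; ring.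
have -> : (1 - al) ^+ 2 * Ts * (Ps / B_star) = Ps + Ts - (Ps + al * Ts) ^+ 2 / B_star.
  by rewrite -[Ps + Ts](mulfK BN) -E; field.
by move: TE; lra.
Qed.

Lemma rho_out_lt1 b : rho_out b ^+ 2 < 1.
Proof.
have : 0 < V b ^+ 2 * (1 - rho_out b ^+ 2).
  rewrite -rho_match2 ltr_wpDl ?exprn_gt0 ?noise_std_gt0// mulr_ge0 ?sqr_ge0//.
  by rewrite rho_state_sq divr_ge0 ?(ltW Ps0) ?ltW// B_star_gt0.
by rewrite pmulr_rgt0 ?exprn_gt0// subr_gt0.
Qed.

(** The energy of X' - gam S is P_star + gam^2 T; by definition of gam the result stays within the
    power constraint. *)
Lemma input_power : coef_u ^+ 2 + coef_s ^+ 2 - 2 * coef_u * coef_s * rho_state = 2 * gam * T.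
Proof.
have -> : 2 * coef_u * coef_s * rho_state = 2 * coef_s * (al * (1 - gam) * sqT).
  by rewrite /rho_state; field.
rewrite cu2 /coef_s.
have -> : 2 * ((al * (1 - gam) + gam) * sqT) * (al * (1 - gam) * sqT) =
  2 * (al * (1 - gam) + gam) * (al * (1 - gam)) * sqT ^+ 2 by ring.
rewrite exprMn sqT2 /B_star TsE (P_starE T Ppow); ring.
Qed.

(** The value of alpha enters here: it makes the conditional variance of the auxiliary variable
    given Y smaller than that given S by the factor 1 + P_star, as in Costa's theorem. *)
Lemma rho_out_true_sq : 1 - rho_out true ^+ 2 = Ps / B_star / (1 + Ps).
Proof.
have BN : B_star != 0 by rewrite gt_eqF// B_star_gt0.
have PN : 1 + Ps != 0 by rewrite gt_eqF// addr_gt0.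
have V2N : V true ^+ 2 != 0 by rewrite expf_neq0.
have TE : T = Ps + Ts by rewrite /P_star subrK.
have VE : V true ^+ 2 = Ps + Ts + 1 by rewrite V_sq /noise_std expr1n -TE.
have alE : al * (1 + Ps) = Ps by rewrite /alpha_star (addrC 1) divfK// addrC.
apply: (mulfI V2N); apply: (mulIf BN); apply: (mulIf PN).
rewrite rho_out_sq.
have -> : V true ^+ 2 * (1 - (Ps + al * Ts) ^+ 2 / (B_star * V true ^+ 2)) * B_star * (1 + Ps) =
  (V true ^+ 2 * B_star - (Ps + al * Ts) ^+ 2) * (1 + Ps) by field; rewrite BN VN.
have -> : V true ^+ 2 * (Ps / B_star / (1 + Ps)) * B_star * (1 + Ps) = V true ^+ 2 * Ps by field; rewrite BN PN.
rewrite VE /B_star.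
have a2 : al ^+ 2 * (1 + Ps) = al * Ps by rewrite expr2 -mulrA alE.
have : (al ^+ 2 * (1 + Ps)) * Ts * (1 + Ps) = al * Ps * Ts * (1 + Ps) by rewrite a2.
have : al * (1 + Ps) * Ps * Ts = Ps * Ps * Ts by rewrite alE.
nra.
Qed.

(** Mutual information, in nats, of a Gaussian pair with correlation rho. *)
Definition info (rho : R) : R := - (ln (1 - rho ^+ 2) / 2).

Lemma info_ge0 rho : rho ^+ 2 < 1 -> 0 <= info rho.
Proof.
move=> h; rewrite /info oppr_ge0 mulr_le0_ge0 ?invr_ge0//.
by rewrite ln_le0// gerBl sqr_ge0.
Qed.

Lemma info_gap : info (rho_out true) - info rho_state = 2^-1 * ln (1 + Ps).
Proof.
have P1 : 0 < 1 + Ps by apply: ltr_wpDl Ps0.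
have PB : 0 < Ps / B_star by apply: divr_gt0 B_star_gt0.
by rewrite /info rho_out_true_sq rho_state_sq (ln_div PB P1); lra.
Qed.

(** The threshold is the excess of the warden's information about the auxiliary variable over the
    receiver's, converted to bits. *)
Lemma key_thresholdE : key_threshold T sig2 Ppow =
  (info (rho_out false) - info (rho_out true)) / ln 2.
Proof.
have BN : B_star != 0 by rewrite gt_eqF// B_star_gt0.
have TE : Ps + Ts = T by rewrite /P_star subrK.
have key b : 2^-1 * log2 (1 + (Ps + al * Ts) ^+ 2 / (B_star * V b ^+ 2 - (Ps + al * Ts) ^+ 2)) = info (rho_out b) / ln 2.
  have h : 1 - rho_out b ^+ 2 = (B_star * V b ^+ 2 - (Ps + al * Ts) ^+ 2) / (B_star * V b ^+ 2).
    by rewrite rho_out_sq; field; rewrite BN VN.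
  have h0 : 0 < 1 - rho_out b ^+ 2 by rewrite subr_gt0 rho_out_lt1.
  have d0 : 0 < B_star * V b ^+ 2 - (Ps + al * Ts) ^+ 2.
    by move: h0; rewrite h pmulr_lgt0// invr_gt0 mulr_gt0 ?B_star_gt0// exprn_gt0.
  have -> : 1 + (Ps + al * Ts) ^+ 2 / (B_star * V b ^+ 2 - (Ps + al * Ts) ^+ 2) = (1 - rho_out b ^+ 2)^-1.
    by rewrite h; field; rewrite BN VN gt_eqF.
  by rewrite /log2 lnV ?posrE// /info; ring.
rewrite /key_threshold mulrBl -!key /B_star !V_sq TE /noise_std expr1n sqr_sqrtr ?(ltW sig0)//.
Qed.

(** At t = 0 the exponent vanishes with derivative [info rho]; for |t| <= 1/2 the remainder is at
    most t^2. *)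
Lemma mgf_exp_le (rho t : R) : rho ^+ 2 < 1 -> `|t| <= 2^-1 -> mgf_exp rho t <= t * info rho + t ^+ 2.
Proof.
move=> r1 ht.
have t2 : t ^+ 2 <= 4^-1.
  by move: ht; rewrite ler_norml => /andP[h1 h2]; nra.
set x := t ^+ 2 * rho ^+ 2.
have x0 : 0 <= x by rewrite mulr_ge0 ?sqr_ge0.
have xt : x <= t ^+ 2 by rewrite ler_piMr ?sqr_ge0// ltW.
have x1 : 0 < 1 - x by lra.
have h : - ln (1 - x) <= 2 * x.
  have := ln_ge_1subV x1; have : (1 - x)^-1 <= 1 + 2 * x.
    by rewrite -[_^-1]mul1r ler_pdivrMr//; nra.
  lra.
rewrite /mgf_exp /info -/x; lra.
Qed.

End SchemeParams.

(** Calibration of the floor: a failure mass of order s^2 beats the factor - ln s, since - ln s <= 1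
    / s - 1. *)
Lemma kl_rate_le (R : realType) (s x : R) : 0 < s -> s <= 1 -> x <= s ^+ 2 ->
  x + x * (2 - 2 * ln s) + 3 * s <= 6 * s.
Proof.
move=> s0 s1 xs.
have ls : 2 - 2 * ln s <= 2 / s by have := ln_ge_1subV s0; lra.
have ls0 : 0 <= 2 - 2 * ln s by have := ln_le0 s1; lra.
have h1 : x * (2 - 2 * ln s) <= s ^+ 2 * (2 - 2 * ln s) by exact: ler_wpM2r.
have h2 : s ^+ 2 * (2 - 2 * ln s) <= s ^+ 2 * (2 / s) by rewrite ler_pM2l// exprn_gt0.
have h3 : s ^+ 2 * (2 / s) = 2 * s by field; rewrite gt_eqF.
have h4 : s ^+ 2 <= s by rewrite expr2 ler_piMl// ltW.
lra.
Qed.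

(* The rates leave slack [2 * del] in the three constraints
   [R' > I_S], [r + R' < I_Y] and [r + R_K + R' > I_Z]. *)
Lemma rate_exponents (R : realType) (N IS IY IZ lr lk lr' l2 del e mS mY mZ a b c : R) :
  0 < N -> 0 < e -> e <= 2^-1 -> e <= del / 2 ->
  4 * del <= IY - IS - lr -> 4 * del <= lk - (IZ - IY) -> lr' = IY - lr - 2 * del ->
  mS <= e * IS + e ^+ 2 -> mZ <= e * IZ + e ^+ 2 -> mY <= - e * IY + e ^+ 2 ->
  N * lr <= a -> a <= N * lr + l2 -> N * lk <= b -> N * lr' <= c -> c <= N * lr' + l2 ->
  [/\ e * (N * (IY - del)) + N * mY <= - (N * (e * del / 2)),
      a + c + - (N * (IY - del)) <= l2 + l2 + - (N * (e * del / 2)),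
      - (e * c) + N * mS <= - (N * (e * del / 2)) + - (N * (e * del / 2)) &
      - (e * (a + b + c)) + N * mZ <= - (N * (e * del / 2))].
Proof.
move=> N0 e0 e2 ed d1 d2 -> hS hZ hY la ua lb lc uc.
have ee : e ^+ 2 <= e * del / 2 by rewrite expr2 -mulrA ler_pM2l.
have Nee := ler_wpM2l (ltW N0) ee.
have Ne : 0 < N * (e * del) by rewrite !mulr_gt0//; lra.
split.
- have := ler_wpM2l (ltW N0) hY; lra.
- have : N * (e * del / 2) <= N * del by rewrite ler_pM2l//; nra.
  lra.
- have := ler_wpM2l (ltW N0) hS.
  have : e * (N * (IS + 2 * del)) <= e * c.
    by rewrite ler_pM2l//; apply: le_trans lc; rewrite ler_pM2l//; lra.
  lra.
- have := ler_wpM2l (ltW N0) hZ.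
  have : e * (N * (IZ + 2 * del)) <= e * (a + b + c).
    rewrite ler_pM2l//; have : N * (IZ + 2 * del) <= N * (lr + lk + (IY - lr - 2 * del)) by rewrite ler_pM2l//; lra.
    lra.
  lra.
Qed.

(** * Existence of good codes *)

Section Achievability.
Context (R : realType) (d : measure_display) (Om : measurableType d)
  (P : probability Om R) (T sig2 Ppow RK r : R) (S NY NZ : nat -> Om -> R) (U : Om -> R).
Hypothesis T0 : 0 < T.
Hypothesis sig0 : 0 < sig2.
Hypothesis Pp0 : 0 < Ppow.
Hypothesis model : gaussian_state_model P T sig2 S NY NZ U.
Hypothesis RK0 : 0 <= RK.
Hypothesis key : key_threshold T sig2 Ppow < RK.
Hypothesis r0 : 0 <= r.
Hypothesis rC : r * ln 2 < 2^-1 * ln (1 + P_star T Ppow).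

Definition good_code n (s : R) (c : @nc_code R n (idx_size n r) (idx_size n RK)) :=
  [/\ (avg_power P S U c <= (Ppow + s)%:E)%E, (err_prob P S NY U c <= s%:E)%E &
   (rel_entropy (warden_law P S NZ U c) (Q0n (n:=n) P S NZ) <= ((ln 2)^-1 * (6 * s))%:E)%E].

Lemma good_codes (s : R) : 0 < s -> s <= 1 -> \forall n \near \oo, exists c, @good_code n s c.
Proof.
move=> s0 s1.
set rS := rho_state T Ppow; set rO := rho_out T sig2 Ppow.
have rS1 : rS ^+ 2 < 1 by exact: rho_state_lt1.
have rO1 b : rO b ^+ 2 < 1 by exact: rho_out_lt1.
have l2 := ln2_gt0 R.
set IS := info rS; set IY := info (rO true); set IZ := info (rO false).
have IS0 : 0 <= IS by exact: info_ge0.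
have gap := info_gap sig2 T0 Pp0; rewrite -/rS -/rO -/IS -/IY in gap.
have keyE : (IZ - IY) < RK * ln 2.
  by move: key; rewrite key_thresholdE// ltr_pdivrMr.
(* A quarter of the smaller of the two slacks, in the rate and in the key rate. *)
pose del : R := Num.min (IY - IS - r * ln 2) (RK * ln 2 - (IZ - IY)) / 4.
have del0 : 0 < del by rewrite divr_gt0// lt_min; apply/andP; split; [move: rC gap|move: keyE]; lra.
have del1 : 4 * del <= IY - IS - r * ln 2 by rewrite /del mulrC divfK// ge_min lexx.
have del2 : 4 * del <= RK * ln 2 - (IZ - IY) by rewrite /del mulrC divfK// ge_min lexx orbT.
(* The rate of the covering index stays 2 del below what the receiver can resolve besides the
   message; the slack in r keeps it at least 2 del above I_S. *)
pose r' := (IY - r * ln 2 - 2 * del) / ln 2.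
have r'E : r' * ln 2 = IY - r * ln 2 - 2 * del by rewrite /r' divfK// gt_eqF.
have r'0 : 0 <= r' by rewrite /r' divr_ge0 ?(ltW l2)//; lra.
pose e : R := Num.min 2^-1 (del / 2).
have e0 : 0 < e by rewrite lt_min invr_gt0 ltr0n divr_gt0.
have e2 : e <= 2^-1 by rewrite ge_min lexx.
have ed : e <= del / 2 by rewrite ge_min lexx orbT.
have e1 : e <= 1 by lra.
(* The selected sum will be at most Ppow + s^2 <= Ppow + 1, so division by W leaves s^2 for error,
   deficit and divergence. *)
pose W := (Ppow + 1) / s ^+ 2.
have ss : 0 < s ^+ 2 by rewrite exprn_gt0.
have W0 : 0 < W by rewrite divr_gt0// addr_gt0.
(* Collects q and 4 q from decoding, q + q / e from the deficit and q / e from the warden. *)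
pose K := 6 + 2 / e.
have K0 : 0 < K by rewrite addr_gt0// divr_gt0.
have ed0 : 0 < e * del / 2 by rewrite divr_gt0// mulr_gt0.
have h1 := near_div_le (W * K * (2 / s ^+ 2)) ed0.
have h2 : \forall n \near \oo, (0 < n)%N by exists 1%N.
apply: filterS2 h1 h2 => n h1 n0.
set N := n%:R : R in h1; have N0 : 0 < N by rewrite ltr0n.
(* Common exponential rate of all terms. [q] is also used as the free parameter [l] of the deficit
   bound, which works because the covering moment decays like q^2. *)
pose q := expR (- (N * (e * del / 2))).
have q0 : 0 < q by exact: expR_gt0.
have qK : W * (q * K) <= s ^+ 2 / 2.
  have h3 : W * K * (2 / s ^+ 2) <= expR (N * (e * del / 2)).
    by apply: le_trans h1 _; have := expR_ge1Dx (N * (e * del / 2)); lra.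
  have : W * K * (2 / s ^+ 2) * (q * (s ^+ 2 / 2)) <= expR (N * (e * del / 2)) * (q * (s ^+ 2 / 2)).
    by apply: ler_wpM2r => //; rewrite mulr_ge0 ?divr_ge0 ?(ltW q0)// ltW.
  have qe : expR (N * (e * del / 2)) * q = 1 by rewrite /q -expRD subrr expR0.
  rewrite [leRHS]mulrA qe mul1r.
  have -> // : W * K * (2 / s ^+ 2) * (q * (s ^+ 2 / 2)) = W * (q * K) by field; rewrite gt_eqF.
set NM := idx_size n r; set NK := idx_size n RK; pose L := idx_size n r'.
have s20 : 0 < s ^+ 2 / 2 by rewrite divr_gt0.
have := @random_code R d Om P T sig2 S NY NZ U T0 sig0 model rS (coef_u T Ppow) (coef_s T Ppow) rO
  (coef_u_gt0 T0 Pp0) rS1 rO1 (rho_match1 sig2 T0 Pp0) (rho_match2 sig2 T0 Pp0)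
  n L NM NK (N * (IY - del)) e q W s (s ^+ 2 / 2) n0 (idx_size_gt0 n r') (idx_size_gt0 n r)
  (idx_size_gt0 n RK) e0 e1 q0 W0 s0 s1 s20.
set B := (_ + _ + s ^+ 2 / 2).
have he : `|e| <= 2^-1 by rewrite ger0_norm// ltW.
have he' : `|- e| <= 2^-1 by rewrite normrN.
have mS := mgf_exp_le rS1 he; have mZ := mgf_exp_le (rO1 false) he.
have mY := mgf_exp_le (rO1 true) he'.
rewrite -/IS in mS; rewrite -/IZ in mZ; rewrite -/IY sqrrN in mY.
have NMl := ln_idx_size_le n r0; have Ll := ln_idx_size_le n r'0.
have NMg := ln_idx_size_ge n r0; have Lg := ln_idx_size_ge n r'0; have NKg := ln_idx_size_ge n RK0.
have p (k : R) : 0 <= k -> 0 < (idx_size n k)%:R :> R by rewrite ltr0n idx_size_gt0.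
have pNM := p _ r0; have pL := p _ r'0; have pNK := p _ RK0.
rewrite -/N -/NM -/L -/NK in NMl Ll NMg Lg NKg pNM pL pNK.
have NMg' : N * (r * ln 2) <= ln NM%:R by rewrite mulrA.
have NKg' : N * (RK * ln 2) <= ln NK%:R by rewrite mulrA.
have Lg' : N * (r' * ln 2) <= ln L%:R by rewrite mulrA.
have NMl' : ln NM%:R <= N * (r * ln 2) + ln 2 by move: NMl; rewrite mulrDl mul1r mulrA.
have Ll' : ln L%:R <= N * (r' * ln 2) + ln 2 by move: Ll; rewrite mulrDl mul1r mulrA.
have [x1 x2 x3 x4] := rate_exponents N0 e0 e2 ed del1 del2 r'E mS mZ mY NMg' NMl' NKg' Lg' Ll'.
have t1 : expR (e * (N * (IY - del)) + N * mgf_exp (rO true) (- e)) <= q by rewrite ler_expR.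
have t2 : NM%:R * L%:R * expR (- (N * (IY - del))) <= 4 * q.
  have -> : NM%:R * L%:R = expR (ln NM%:R + ln L%:R) :> R by rewrite expRD (lnK pNM) (lnK pL).
  (* Rounding up the two index sets costs a factor 2 each. *)
  have -> : 4 = expR (ln 2 + ln 2) :> R by rewrite expRD (lnK (ltr0n R 2)) -natrM.
  by rewrite /q -!expRD ler_expR.
have t3 : q + e^-1 * expR (- (e * ln L%:R)) * expR (N * mgf_exp rS e) / q <= q + e^-1 * q.
  by rewrite lerD2l ler_pdivrMr// -!mulrA ler_pM2l ?invr_gt0// -!expRD ler_expR.
have t4 : e^-1 * expR (- (e * ln (NM%:R * NK%:R * L%:R))) * expR (N * mgf_exp (rO false) e) <= e^-1 * q.
  have -> : ln (NM%:R * NK%:R * L%:R) = ln NM%:R + ln NK%:R + ln L%:R :> R.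
    by rewrite lnM ?posrE ?mulr_gt0// lnM ?posrE.
  by rewrite -!mulrA ler_pM2l ?invr_gt0// -!expRD ler_expR.
have BP : B <= Ppow + s ^+ 2.
  have ip := input_power T0 Pp0; rewrite -/rS in ip.
  have gp := gamma_star_power_le Ppow T0.
  have : W * (expR (e * (N * (IY - del)) + N * mgf_exp (rO true) (- e)) + NM%:R * L%:R * expR (- (N * (IY - del))) +
    (q + e^-1 * expR (- (e * ln L%:R)) * expR (N * mgf_exp rS e) / q) +
    e^-1 * expR (- (e * ln (NM%:R * NK%:R * L%:R))) * expR (N * mgf_exp (rO false) e)) <= W * (q * K).
    by rewrite ler_pM2l// /K; lra.
  rewrite /B ip; lra.
have s2s : s ^+ 2 <= s by rewrite expr2 ler_piMl// ltW.
have BW : B / W <= s ^+ 2.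
  by rewrite ler_pdivrMr// /W mulrC divfK ?gt_eqF//; lra.
move=> [c [c1 c2 c3]]; exists c; split.
- by apply: le_trans c1 _; rewrite lee_fin (le_trans BP)// lerD2l.
- by apply: le_trans c2 _; rewrite lee_fin (le_trans BW).
apply: le_trans c3 _; rewrite lee_fin ler_pM2l ?invr_gt0//.
exact: kl_rate_le.
Qed.

End Achievability.

(** * Capacity *)

Section Limits.
Context (R : realType).

(* At stage [n] use the largest index [k <= n] whose threshold [N k] has been passed. *)
Lemma diagonal (G : nat -> R -> Prop) :
  (forall s, 0 < s -> s <= 1 -> \forall n \near \oo, G n s) ->
  exists t : nat -> R, (\forall n \near \oo, G n (t n)) /\
    forall e, 0 < e -> \forall n \near \oo, t n <= e.
Proof.
move=> HG.
have sk0 k : 0 < (k.+1%:R^-1 : R) by rewrite invr_gt0.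
have sk1 k : (k.+1%:R^-1 : R) <= 1 by rewrite invf_le1// ler1n.
have /cid[N NE] : exists N : nat -> nat, forall k n, (N k <= n)%N -> G n (k.+1%:R^-1 : R).
  have ex k : exists N, forall n, (N <= n)%N -> G n (k.+1%:R^-1 : R).
    by have [N _ h] := HG _ (sk0 k) (sk1 k); exists N => n; exact: h.
  by exists (fun k => projT1 (cid (ex k))) => k; exact: (projT2 (cid (ex k))).
pose f n := (\max_(k < n.+1 | (N k <= n)%N) k)%N.
exists (fun n => (f n).+1%:R^-1 : R); split.
  exists (N 0%N) => // n /= hn.
  have c0 : (0 < #|[pred k : 'I_n.+1 | (N k <= n)%N]|)%N.
    by apply/card_gt0P; exists ord0.
  have [k hk fk] := eq_bigmax_cond (fun k : 'I_n.+1 => k : nat) c0.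
  have -> : f n = k by rewrite -fk.
  by apply: NE; rewrite inE in hk.
move=> e e0; have [K _ hK] := near_div_le 1 e0.
exists (maxn K (N K)) => // n /=; rewrite geq_max => /andP[Kn NKn].
have h : (K <= f n)%N.
  have Kn' : (K < n.+1)%N by [].
  exact: (@leq_bigmax_cond _ (fun k : 'I_n.+1 => (N k <= n)%N) (fun k => k : nat) (Ordinal Kn') NKn).
have h1 := hK K (leqnn K).
rewrite -[leLHS]mul1r ler_pdivrMr// mulrC; apply: le_trans h1 _.
by apply: ler_wpM2r; [exact: ltW|rewrite ler_nat; exact: leqW].
Qed.

Lemma limn_esup_le (u : nat -> \bar R) (a : R) :
  (forall e, 0 < e -> \forall n \near \oo, (u n <= (a + e)%:E)%E) -> (limn_esup u <= a%:E)%E.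
Proof.
move=> h; apply/lee_addgt0Pr => e /= e0; rewrite -EFinD.
have V := h e e0.
apply: ereal_inf_le; exists (ereal_sup (u @` [set n | (u n <= (a + e)%:E)%E])); first by exists [set n | (u n <= (a + e)%:E)%E].
by apply: ge_ereal_sup => _ [n /= hn <-].
Qed.

Lemma cvge0 (u : nat -> \bar R) : (forall n, 0 <= u n)%E ->
  (forall e, 0 < e -> \forall n \near \oo, (u n <= e%:E)%E) -> (u n @[n --> \oo] --> 0)%E.
Proof.
move=> u0 h.
have fin : \forall n \near \oo, u n \is a fin_num.
  by apply: filterS (h 1 ltr01) => n hn; rewrite ge0_fin_numE// (le_lt_trans hn)// ltry.
apply/fine_cvgP; split => //; apply/cvgr0Pnorm_le => e e0.
apply: filterS2 fin (h e e0) => n fn hn /=.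
by rewrite ger0_norm ?fine_ge0// -lee_fin fineK.
Qed.

End Limits.

Section Nonnegativity.
Context (R : realType) (d : measure_display) (Om : measurableType d)
  (P : probability Om R) (T sig2 : R) (S NY NZ : nat -> Om -> R) (U : Om -> R).
Hypothesis model : gaussian_state_model P T sig2 S NY NZ U.
Variables (n NM NK : nat) (c : @nc_code R n NM NK).
Hypotheses (NM0 : (0 < NM)%N) (NK0 : (0 < NK)%N).

Lemma err_prob_ge0 : (0 <= err_prob P S NY U c)%E.
Proof.
rewrite /err_prob /avg_mk mule_ge0// ?lee_fin ?invr_ge0//.
by apply: sume_ge0 => m _; exact: sume_ge0.
Qed.

(** The one-cell partition contributes 0 to the supremum. *)
Lemma rel_entropy_ge0 : (0 <= rel_entropy (warden_law P S NZ U c) (Q0n (n:=n) P S NZ))%E.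
Proof.
apply: ereal_sup_ubound; exists 1%N, (fun=> setT); split => //.
- by move=> i j; rewrite !ord1.
- by apply/seteqP; split => // x _; exists ord0.
rewrite big_ord1.
have -> : Q0n (n:=n) P S NZ setT = 1%E by rewrite /Q0n preimage_setT probability_setT.
have -> : warden_law P S NZ U c setT = 1%E.
  rewrite /warden_law avg_mkE (eq_bigr (fun=> 1%E)) => [|j _]; last by rewrite preimage_setT probability_setT.
  rewrite sumEFin sumr_cst card_prod !card_ord mulr1 -EFinM mulVf//.
  by rewrite gt_eqF// ltr0n muln_gt0 NM0.
by rewrite /kl_term/= oner_eq0 divr1 /log2 ln1 mul0r mulr0.
Qed.

End Nonnegativity.

Section Capacity.
Context (R : realType) (d : measure_display) (Om : measurableType d)
  (P : probability Om R) (T sig2 Ppow RK r : R) (S NY NZ : nat -> Om -> R) (U : Om -> R).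

(** Filler for the blocklengths at which no good code is available. *)
Lemma nc_code_exists n NM NK : (0 < NM)%N -> exists c : @nc_code R n NM NK, True.
Proof.
move=> NM0.
have me (m : 'I_NM) (k : 'I_NK) : measurable_fun setT (fun _ : n.-tuple R * R => [tuple (0 : R) | i < n]).
  exact: measurable_cst.
have md (k : 'I_NK) (m : 'I_NM) : measurable [set y : n.-tuple R | (fun _ _ => Ordinal NM0) k y = m].
  have [<-|h] := eqVneq (Ordinal NM0) m.
    by rewrite (_ : [set _ | _] = setT)//; apply/seteqP; split.
  by rewrite (_ : [set _ | _] = set0)//; apply/seteqP; split => // y /= e; rewrite e eqxx in h.
by exists (NcCode me md).
Qed.

Lemma achievability : 0 < T -> 0 < sig2 -> 0 < Ppow -> 0 <= RK ->
  gaussian_state_model P T sig2 S NY NZ U -> key_threshold T sig2 Ppow < RK ->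
  0 <= r -> r * ln 2 < 2^-1 * ln (1 + P_star T Ppow) ->
  nc_achievable P S NY NZ U Ppow RK r.
Proof.
move=> T0 sig0 Pp0 RK0 model key r0 rC; split=> //.
(* [good_codes] works at a fixed accuracy; the diagonal argument lets the accuracy tend to 0 with n,
   so that one sequence of codes serves. *)
have [t [ht tt]] := diagonal (good_codes T0 sig0 Pp0 model RK0 key r0 rC).
have ex n : exists c : @nc_code R n (idx_size n r) (idx_size n RK),
   (exists c' : @nc_code R n (idx_size n r) (idx_size n RK), good_code P Ppow S NY NZ U (t n) c') -> good_code P Ppow S NY NZ U (t n) c.
  have [[c hc]|h] := pselect (exists c' : @nc_code R n (idx_size n r) (idx_size n RK), good_code P Ppow S NY NZ U (t n) c'); first by exists c.
  by have [c _] := nc_code_exists n (idx_size n RK) (idx_size_gt0 n r); exists c.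
exists (fun n => projT1 (cid (ex n))).
have good : \forall n \near \oo, good_code P Ppow S NY NZ U (t n) (projT1 (cid (ex n))).
  by apply: filterS ht => n; exact: (projT2 (cid (ex n))).
split; [|split].
- apply: limn_esup_le => e e0; apply: filterS2 good (tt e e0) => n [h _ _] tn.
  by apply: le_trans h _; rewrite lee_fin lerD2l.
- apply: cvge0 => [n|e e0]; first exact: err_prob_ge0.
  by apply: filterS2 good (tt e e0) => n [_ h _] tn; apply: le_trans h _; rewrite lee_fin.
- apply: cvge0 => [n|e e0]; first by apply: rel_entropy_ge0; exact: idx_size_gt0.
  have e1 : 0 < e * ln 2 / 6 by rewrite divr_gt0// mulr_gt0// ln2_gt0.
  apply: filterS2 good (tt _ e1) => n [_ _ h] tn; apply: le_trans h _; rewrite lee_fin.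
  by rewrite ler_pdivrMl ?ln2_gt0//; move: tn; lra.
Qed.

End Capacity.

Theorem theorem6 (R : realType) (d : measure_display) (Om : measurableType d)
  (P : probability Om R) (T sig2 Ppow RK : R)
  (S NY NZ : nat -> Om -> R) (U : Om -> R) :
  0 < T -> 0 < sig2 -> 0 < Ppow -> 0 <= RK ->
  gaussian_state_model P T sig2 S NY NZ U ->
  key_threshold T sig2 Ppow < RK ->
  covert_capacity_nc P S NY NZ U Ppow RK =
    (2^-1 * log2 (1 + P_star T Ppow))%:E.
Proof.
move=> T0 sig0 Pp0 RK0 model key; apply/eqP; rewrite eq_le; apply/andP; split.
  by apply: ge_ereal_sup => _ [r hr <-]; rewrite lee_fin; exact: (converse T0 sig0 model Pp0 hr).
have l2 := ln2_gt0 R.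
have C0 : 0 < 2^-1 * log2 (1 + P_star T Ppow).
  rewrite /log2 mulr_gt0 ?invr_gt0// divr_gt0//.
  by rewrite ln_gt0// ltrDl P_star_gt0.
set C := 2^-1 * _ in C0 *.
have CE : C * ln 2 = 2^-1 * ln (1 + P_star T Ppow) by rewrite /C /log2 mulrA divfK// gt_eqF.
apply/lee_addgt0Pr => e /= e0.
(* Achievable rates are nonnegative by definition, hence the truncation at 0, which stays below C
   because C > 0. *)
pose r : R := Num.max 0 (C - e).
have r0 : 0 <= r by rewrite le_max lexx.
have rC : r < C by rewrite gt_max C0 ltrBlDr ltrDl.
have h : nc_achievable P S NY NZ U Ppow RK r.
  by apply: achievability T0 sig0 Pp0 RK0 model key r0 _; rewrite -CE ltr_pM2r.
apply: (@le_trans _ _ (r%:E + e%:E)%E).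
  by rewrite -EFinD lee_fin -lerBlDr le_max lexx orbT.
by apply: leeD => //; apply: ereal_sup_ubound; exists r.
Qed.
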